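(* Let $\alpha\ge0$, $\gamma\ge0$, and let $\mu,\nu\ge0$ satisfy $\mu\nu=\gamma$, $\mu+\nu=\alpha-\gamma$ (with $\mu=0$, $\nu=\alpha$ when $\gamma=0$). Let $\delta\ge1$. Let $\lambda$ be real-valued, non-negative and integrable on $(0,1)$ with $\int_0^1\lambda(t)\,dt=1$, differentiable and non-vanishing on $(0,1)$. Let $\beta<1$ satisfy $\frac{\beta}{1-\beta}=-\int_0^1\lambda(t)g_{\mu,\nu}^\delta(t)\,dt$. Assume that $\Lambda_\nu^\delta$ and $\Pi_{\mu,\nu}^\delta$ are positive on $(0,1)$ and integrable on $[0,1]$. Suppose that one of the following holds for all $t\in(0,1)$: (a) $\gamma>0$, $1\le\delta\le\min\{\mu,\nu\}$ and $\displaystyle\frac{t\lambda'(t)}{\lambda(t)}\le5-\frac\delta\mu-\frac\delta\nu$; (b) $\gamma=0$, $\alpha\in\left(0,\frac\delta3\right]\cup[\delta,\infty)$ and $\displaystyle\frac{t\lambda'(t)}{\lambda(t)}\le3-\frac\delta\alpha$. Then for every $f\in\mathcal W_\beta^\delta(\alpha,\gamma)$ the function $F_\delta=V_\lambda^\delta(f)$ belongs to $\mathcal S^\ast\left(1-\frac1\delta\right)$, equivalently $z^{1-\delta}(F_\delta(z))^\delta\in\mathcal S^\ast=\mathcal S^\ast(0)$.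
   Context: $\mathbb D=\{z\in\mathbb C:|z|<1\}$; $\mathcal A$ is the class of analytic $f$ on $\mathbb D$ with $f(0)=0$, $f'(0)=1$. Powers such as $(f(z)/z)^\delta$ are taken with the branch equal to $1$ at $z=0$. $\mathcal S^\ast(\xi)$ ($0\le\xi<1$) is the class of $f\in\mathcal A$ with $\mathrm{Re}(zf'(z)/f(z))>\xi$ on $\mathbb D$. For $\alpha\ge0$, $\gamma\ge0$, $\beta<1$, $\delta>0$, $\mathcal W_\beta^\delta(\alpha,\gamma)$ is the class of $f\in\mathcal A$ for which there is $\phi\in\mathbb R$ with $\mathrm{Re}\,e^{i\phi}(H(z)-\beta)>0$ on $\mathbb D$, where $$H=(1-\alpha+2\gamma)\left(\tfrac fz\right)^\delta+\left(\alpha-3\gamma+\gamma\left[\left(1-\tfrac1\delta\right)\tfrac{zf'}{f}+\tfrac1\delta\left(1+\tfrac{zf''}{f'}\right)\right]\right)\left(\tfrac fz\right)^\delta\tfrac{zf'}{f}.$$ The integral operator is $V_\lambda^\delta(f)(z)=\left(\int_0^1\lambda(t)\left(\frac{f(tz)}{t}\right)^\delta dt\right)^{1/\delta}$, so that $z^{1-\delta}(V_\lambda^\delta(f)(z))^\delta=z\int_0^1\lambda(t)\left(\frac{f(tz)}{tz}\right)^\delta dt$. The function $g_{\mu,\nu}^\delta$ on $[0,1]$ (here with the order parameter $\xi=0$) satisfies $g_{\mu,\nu}^\delta(0)=1$ and: if $\gamma=0$ ($\mu=0,\nu=\alpha$), $$\frac{d}{dt}\left(t^{\delta/\alpha}\frac{1+g_{0,\alpha}^\delta(t)}2\right)=\frac{\delta}{\alpha(1+t)^2}t^{\delta/\alpha-1};$$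 if $\gamma>0$, $$\frac{d}{dt}\left(t^{\delta/\nu}\frac{1+g_{\mu,\nu}^\delta(t)}2\right)=\frac{\delta^2t^{\delta/\nu-1}}{\mu\nu}\int_0^1\frac{1}{(1+st)^2}s^{\delta/\mu-1}ds.$$ $\Lambda_\nu^\delta(t)=\int_t^1\frac{\lambda(s)}{s^{\delta/\nu}}ds$ for $\nu>0$; $\Pi_{\mu,\nu}^\delta(t)=\int_t^1\frac{\Lambda_\nu^\delta(s)}{s^{\delta/\mu-\delta/\nu+1}}ds$ if $\gamma>0$, and $\Pi_{0,\alpha}^\delta(t)=\Lambda_\alpha^\delta(t)$ if $\gamma=0$. *)

(* Defs.v *)
From mathcomp Require Import all_boot all_order all_algebra.
From mathcomp Require Export complex.
From mathcomp Require Import all_classical all_reals all_analysis.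

Set Implicit Arguments.
Unset Strict Implicit.
Unset Printing Implicit Defensive.

Import Order.TTheory GRing.Theory Num.Theory.
Import numFieldNormedType.Exports.

Local Open Scope ring_scope.
Local Open Scope classical_set_scope.
Local Open Scope complex_scope.

Section ComplexFunctions.
Variable R : realType.
(* [R[i]^o] is the normed module of the complex numbers over themselves, so
   [derivable _ _ 1] and [derive1] on it are complex differentiability and the
   complex derivative. *)
Local Notation C := (R[i]^o).

Definition disc (r : R) : set C := [set z | `|z| < r%:C].

Definition analytic_on (D : set C) (f : C -> C) : Prop :=
  forall z, D z -> derivable f z 1.

Definition cexp (z : C) : C :=
  let r := expR (complex.Re z) in
  (r * cos (complex.Im z)) +i* (r * sin (complex.Im z)).

(* [p] is the branch on the unit disc of [h ^ delta] equal to 1 at 0: an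
   analytic function on the disc whose germ at 0 is exp (delta * log h) with
   log (h 0) = 0.  When [h] is analytic on the disc, [h 0 = 1] and [h] has no
   zero there, [p] exists and is exp (delta * log h) on the whole disc; it may
   also exist when [h] has zeros, e.g. [p = h] for [delta = 1].  It is unique
   on the disc. *)
Definition is_bpow (delta : R) (h p : C -> C) : Prop :=
  analytic_on (disc 1) p /\
  exists (r : R) (L : C -> C),
    [/\ 0 < r, analytic_on (disc r) L, L 0 = 0 &
        forall z, disc r z -> disc 1 z ->
          h z = cexp (L z) /\ p z = cexp (delta%:C * L z)].

(* The value is the zero function if the branch does not exist. *)
Definition bpow (delta : R) (h : C -> C) : C -> C :=
  xget (fun=> 0) [set p | is_bpow delta h p].

(* f(z)/z, with its removable singularity at 0 filled in when f(0) = 0. *)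
Definition fdivz (f : C -> C) (z : C) : C :=
  if z == 0 then derive1 f 0 else f z / z.

Definition classA (f : C -> C) : Prop :=
  [/\ analytic_on (disc 1) f, f 0 = 0 & derive1 f 0 = 1].

(* At z = 0 the quotient z f'/f has the removable value 1 > xi. *)
Definition starlike (xi : R) (f : C -> C) : Prop :=
  classA f /\
  forall z, disc 1 z -> z != 0 ->
    f z != 0 /\ xi < complex.Re (z * derive1 f z / f z).

Definition Hform (alpha gamma delta : R) (f : C -> C) (z : C) : C :=
  let q := z * derive1 f z / f z in
  let P := bpow delta (fdivz f) z in
  (1 - alpha + 2 * gamma)%:C * P +
  ((alpha - 3 * gamma)%:C +
   gamma%:C * ((1 - delta^-1)%:C * q +
               (delta^-1)%:C * (1 + z * derive1 (derive1 f) z / derive1 f z)))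
  * P * q.

(* The denominators in [Hform] vanish only at the isolated zeros of f and f',
   which are removable singularities; [H] is the analytic function on the disc
   that [Hform] defines. *)
Definition classW (beta delta alpha gamma : R) (f : C -> C) : Prop :=
  [/\ classA f, exists p, is_bpow delta (fdivz f) p &
      exists (H : C -> C) (phi : R),
        [/\ analytic_on (disc 1) H,
            forall z, disc 1 z -> z != 0 -> f z != 0 -> derive1 f z != 0 ->
              H z = Hform alpha gamma delta f z &
            forall z, disc 1 z ->
              0 < complex.Re (cexp (phi *i) * (H z - beta%:C))]].

Definition cintegral (D : set R) (F : R -> C) : C :=
  (\int[@lebesgue_measure R]_(t in D) complex.Re (F t)) +i*
  (\int[@lebesgue_measure R]_(t in D) complex.Im (F t)).

(* (int_0^1 lam(t) (f(tz)/t)^delta dt)^(1/delta), the factor z being taken out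
   of the powers so that only branches of f(z)/z are involved. *)
Definition Vop (lam : R -> R) (delta : R) (f : C -> C) (z : C) : C :=
  z * bpow delta^-1
        (fun w => cintegral `]0, 1[
           (fun t => (lam t)%:C * bpow delta (fdivz f) (t%:C * w))) z.

End ComplexFunctions.

Section RealFunctions.
Variable R : realType.

(* The differential equation determines t^(delta/nu) (1 + g t)/2 up to an
   additive constant, which continuity of g at 0 and g 0 = 1 fix. *)
Definition is_g (gamma delta mu nu : R) (g : R -> R) : Prop :=
  [/\ g 0 = 1, {within `[0, 1], continuous g} &
      forall t : R, 0 < t < 1 ->
        is_derive t 1 (fun x : R => x `^ (delta / nu) * ((1 + g x) / 2))
          (if gamma == 0
           then delta / (nu * (1 + t) ^+ 2) * t `^ (delta / nu - 1)
           else delta ^+ 2 * t `^ (delta / nu - 1) / (mu * nu) *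
                \int[@lebesgue_measure R]_(s in `]0, 1[)
                  ((1 + s * t) ^- 2 * s `^ (delta / mu - 1)))].

Definition Lambda (lam : R -> R) (delta nu t : R) : R :=
  \int[@lebesgue_measure R]_(s in `]t, 1[) (lam s / s `^ (delta / nu)).

Definition Pi (lam : R -> R) (gamma delta mu nu t : R) : R :=
  if gamma == 0 then Lambda lam delta nu t
  else \int[@lebesgue_measure R]_(s in `]t, 1[)
         (Lambda lam delta nu s / s `^ (delta / mu - delta / nu + 1)).

End RealFunctions.

(* Main.v *)
(** Write [(f/z)^delta] as the power series [sum c_n z^n].  On coefficients, [H]
is [sum (1 + mu n/delta) (1 + nu n/delta) c_n z^n], and
[K z = int lam(t) (f(tz)/(tz))^delta dt] is [sum l_n c_n z^n] with
[l_n = int lam(t) t^n dt].  Since [F_delta / z] is [K^(1/delta)], the claim is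
[Re (1 + z K'/K) > 0].  Otherwise [1 + z K'/K] would be purely imaginary at some
point, that is, [K + kap z K' = 0] there for some [kap] with [|2 kap - 1| = 1].
But [K + kap z K'] is the Hadamard product of [H] with
[G z = int lam(t) S(tz) dt], where [S] has the coefficients
[(1 + kap n) / ((1 + mu n/delta) (1 + nu n/delta))]; writing it as a circular mean
shows that it does not vanish as soon as [Re G >= (1 - b)/2] with
[b = beta/(1 - beta)], and by the choice of [beta] this is
[int lam(t) (Re S(tz) - (1 + g t)/2) dt >= 0].  To bound this integral, one integrates
by parts against [Lambda] (and [Pi]) and adds a nonnegative boundary function,
which yields [E] with [E' <=] integrand, [E <= 0] at [0] and [E >= 0] at [1].

The function theory needed (power series of holomorphic functions on the disc,
identity theorem, logarithms) rests on Cauchy's integral formula for circles,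
which follows by Goursat bisection applied to the contraction of the circle to
the centre. *)

(* The dual inequality has no slack: [(1 + g t)/2] is the value of [Re S(tz)] at [kap = 1],
   [z = -1], so the integrand vanishes identically in that limiting case, and the boundary function
   that is added must vanish there too. Elsewhere the kernel behind [S] can change sign in [t], so a
   pointwise estimate fails and the decay of the weight has to compensate. The parameter [kap]
   disappears at once: on the circle [|2 kap - 1| = 1] the real part of [kap V], with [V] the Koebe
   function at [tz], is at least [(Re V - |V|)/2], and what remains are Harnack bounds for the
   Poisson kernel. The thresholds 1 and 3 for [delta/alpha] are the zeros of [(3 - m)(1 - m)], whose
   sign decides whether the extremal weight [t^(3-m)] can serve for comparison. On the function
   side, [f/z] may have zeros, so [(f/z)^delta] is known as the exponential of a logarithm only near
   0; the relation between [f] and [H] is therefore proved near 0 and carried to the disc by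
   uniqueness of coefficients. *)
Require Import Defs.
From mathcomp Require Import all_boot all_order all_algebra.
From mathcomp Require Import all_classical all_reals all_analysis measurable_realfun.
From mathcomp Require Import ring lra.
Set Implicit Arguments.
Unset Strict Implicit.
Unset Printing Implicit Defensive.
Import Order.TTheory GRing.Theory Num.Theory.
Import numFieldNormedType.Exports.
Local Open Scope ring_scope.
Local Open Scope classical_set_scope.
Local Open Scope complex_scope.
Local Notation Rex := complex.Re.
Local Notation Imx := complex.Im.
(* [`|z|] is itself a complex number; [N z] is the modulus as a real number. *)
Local Notation N := Normc.normc.

(** * Complex differentiation *)

Section ComplexBase.
Variable R : realType.
Local Notation C := (R[i]^o).
Implicit Types (z w : R[i]) (f g : C -> C).

Lemma normE z : `|z| = (N z)%:C. Proof. by []. Qed.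

Lemma N_ge0 z : 0 <= N z.
Proof. by rewrite -lecR -normE normr_ge0. Qed.

Lemma N0 : N (0 : R[i]) = 0. Proof. exact: Normc.normc0. Qed.
Lemma N1 : N (1 : R[i]) = 1. Proof. exact: Normc.normc1. Qed.
Lemma NM z w : N (z * w) = N z * N w. Proof. exact: Normc.normcM. Qed.
Lemma NV z : N z^-1 = (N z)^-1. Proof. exact: Normc.normcV. Qed.
Lemma ND z w : N (z + w) <= N z + N w. Proof. exact: le_normcD. Qed.
Lemma NN z : N (- z) = N z. Proof. exact: normcN. Qed.
Lemma NB z w : N (z - w) <= N z + N w.
Proof. by rewrite -(NN w); exact: ND. Qed.
Lemma NC z w : N (z - w) = N (w - z). Proof. by rewrite -NN opprB. Qed.
Lemma N_eq0 z : (N z == 0) = (z == 0).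
Proof. by apply/eqP/eqP => [/Normc.eq0_normc//|->]; exact: N0. Qed.
Lemma N_gt0 z : (0 < N z) = (z != 0).
Proof. by rewrite lt_neqAle N_ge0 andbT eq_sym N_eq0. Qed.
Lemma NR (x : R) : N x%:C = `|x|.
Proof. by rewrite /= expr0n /= addr0 sqrtr_sqr. Qed.
Lemma NX z n : N (z ^+ n) = N z ^+ n.
Proof. by elim: n => [|n IH]; rewrite ?expr0 ?N1// !exprS NM IH. Qed.
Lemma Nsqr z : N z ^+ 2 = Rex z ^+ 2 + Imx z ^+ 2.
Proof. by case: z => a b /=; rewrite sqr_sqrtr// addr_ge0// sqr_ge0. Qed.
Lemma NRe z : `|Rex z| <= N z.
Proof. by rewrite -(@ler_pXn2r _ 2)// ?nnegrE ?N_ge0// Nsqr real_normK ?num_real// lerDl sqr_ge0. Qed.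
Lemma NIm z : `|Imx z| <= N z.
Proof. by rewrite -(@ler_pXn2r _ 2)// ?nnegrE ?N_ge0// Nsqr real_normK ?num_real// lerDr sqr_ge0. Qed.
Lemma Nle z : N z <= `|Rex z| + `|Imx z|.
Proof.
rewrite -(@ler_pXn2r _ 2)// ?nnegrE ?N_ge0 ?addr_ge0// Nsqr sqrrD !real_normK ?num_real//.
by rewrite addrAC lerDl mulrn_wge0// mulr_ge0.
Qed.
Lemma Nsum (I : Type) (r : seq I) (P : pred I) (F : I -> R[i]) :
  N (\sum_(i <- r | P i) F i) <= \sum_(i <- r | P i) N (F i).
Proof.
elim/big_ind2 : _ => [|x1 x2 y1 y2 h1 h2|//]; first by rewrite N0.
exact: le_trans (ND _ _) (lerD h1 h2).
Qed.
Lemma cReD z w : Rex (z + w) = Rex z + Rex w. Proof. by case: z w => ? ? []. Qed.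
Lemma cImD z w : Imx (z + w) = Imx z + Imx w. Proof. by case: z w => ? ? []. Qed.
Lemma cReN z : Rex (- z) = - Rex z. Proof. by case: z. Qed.
Lemma cImN z : Imx (- z) = - Imx z. Proof. by case: z. Qed.
Lemma cReM z w : Rex (z * w) = Rex z * Rex w - Imx z * Imx w.
Proof. by case: z w => ? ? []. Qed.
Lemma cImM z w : Imx (z * w) = Rex z * Imx w + Imx z * Rex w.
Proof. by case: z w => ? ? []. Qed.
Lemma Ceq z w : Rex z = Rex w -> Imx z = Imx w -> z = w.
Proof. by case: z w => ? ? [? ?] /= -> ->. Qed.
Lemma cReRM (x : R) z : Rex (x%:C * z) = x * Rex z.
Proof. by rewrite cReM /= mul0r subr0. Qed.
Lemma cImRM (x : R) z : Imx (x%:C * z) = x * Imx z.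
Proof. by rewrite cImM /= mul0r addr0. Qed.

Lemma discE r z : disc r z <-> N z < r.
Proof. by rewrite /disc /= normE ltcR. Qed.

Lemma scaleCE (a b : C) : a *: b = a * b. Proof. by []. Qed.

(** Positivity in the partial order of the complex numbers forces a zero imaginary part, so radii
    and tolerances can always be taken real. *)
Lemma C_gt0 (e : R[i]) : 0 < e -> exists2 r : R, 0 < r & e = r%:C.
Proof. by case: e => a b; rewrite ltcE /= => /andP[/eqP -> a0]; exists a. Qed.

Lemma cvgCP (T : Type) (F : set_system T) (FF : Filter F) (f : T -> C) (l : C) :
  (f @ F --> l) <-> (forall e : R, 0 < e -> \forall x \near F, N (f x - l) < e).
Proof.
split => [/cvgrPdist_lt h e e0|h].
  have := h e%:C; rewrite ltcR => /(_ e0).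
  by apply: filterS => x; rewrite normE ltcR NC.
apply/cvgrPdist_lt => e /C_gt0[r r0 ->].
by apply: filterS (h _ r0) => x; rewrite normE ltcR NC.
Qed.

Lemma nbhsCP (z : C) (P : set C) :
  nbhs z P <-> exists2 d : R, 0 < d & forall w, N (w - z) < d -> P w.
Proof.
split.
  move=> /nbhs_ballP[e /= /C_gt0[d d0 ->]] h; exists d => // w wd; apply: h.
  by rewrite -ball_normE /= normE ltcR NC.
move=> [d d0 h]; apply/nbhs_ballP; exists d%:C => /=; first by rewrite ltcR.
by move=> w; rewrite -ball_normE /= normE ltcR NC; exact: h.
Qed.

(** Differentiability as a bound on the first-order remainder, with the derivative explicit and the
    tolerance real: the form in which the estimates below are made, and which is trivially true at
    [w = z]. *)
Definition cder f (z l : C) := forall e : R, 0 < e -> exists2 d : R, 0 < d &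
  forall w, N (w - z) < d -> N (f w - f z - l * (w - z)) <= e * N (w - z).

Lemma cderP f z l : cder f z l <-> is_derive (z : C) (1 : C) f l.
Proof.
split.
  move=> h; suff lim : (fun k : C => k^-1 *: ((f \o shift z) (k *: (1 : C)) - f z)) @ (0 : C)^' --> l.
    split; first by apply/cvg_ex; exists l.
    by apply: cvg_lim lim; exact: norm_hausdorff.
  apply/cvgCP => e e0; have [d d0 hd] := h (e / 2) ltac:(lra).
  rewrite /dnbhs /within /=; apply/nbhsCP; exists d => // k; rewrite subr0 => kd k0.
  have := hd (z + k); rewrite addrAC subrr add0r => /(_ kd) {hd}.
  have -> : k *: (1 : C) = k by rewrite scaleCE mulr1.
  rewrite /= [k + z]addrC => hk.
  have -> : k^-1 *: (f (z + k) - f z) - l = k^-1 * (f (z + k) - f z - l * k).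
    by rewrite mulrBr [l * k]mulrC mulrA mulVf// mul1r.
  rewrite NM NV ltr_pdivrMl ?N_gt0//.
  have := N_gt0 k; rewrite k0 => kp; apply: le_lt_trans hk _; nra.
move=> [df vf] e e0.
have lim : (fun k : C => k^-1 *: ((f \o shift z) (k *: (1 : C)) - f z)) @ (0 : C)^' --> (l : C).
  by rewrite -vf; exact: df.
move/cvgCP : lim => /(_ _ e0); rewrite /dnbhs /within /= => /nbhsCP[d d0 hd].
exists d => // w wd.
have [->|wz] := eqVneq w z; first by rewrite !subrr mulr0 subr0 N0 mulr0.
have := hd (w - z); rewrite subr0 => /(_ wd); rewrite subr_eq0 => /(_ wz).
have -> : (w - z) *: (1 : C) = w - z by rewrite scaleCE mulr1.
rewrite /= subrK => hk0.
have hk : N ((w - z)^-1 * (f w - f z) - l) < e := hk0.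
have -> : f w - f z - l * (w - z) = (w - z) * ((w - z)^-1 * (f w - f z) - l).
  by rewrite [RHS]mulrBr mulrA mulfV ?subr_eq0// mul1r [l * _]mulrC.
by rewrite NM mulrC ler_wpM2r ?N_ge0// ltW.
Qed.

Lemma derivableC_cder f z : derivable (f : C -> C) (z : C) 1 -> cder f z (derive1 f z).
Proof. by move=> h; apply/cderP; rewrite derive1E; apply: DeriveDef. Qed.

Lemma cder_derivable f z l : cder f z l -> derivable (f : C -> C) (z : C) 1.
Proof. by move=> /cderP[]. Qed.
Lemma cder_derive1 f z l : cder f z l -> derive1 f z = l.
Proof. by move=> /cderP[? <-]; rewrite derive1E. Qed.
End ComplexBase.

(** * Real derivatives by first-order remainders *)

Section RealDeriv.
Variable R : realType.
Lemma nbhsRP (x : R) (P : set R) :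
  nbhs x P <-> exists2 d : R, 0 < d & forall y, `|y - x| < d -> P y.
Proof.
split.
  move=> /nbhs_ballP[e /= e0] h; exists e => // y yd; apply: h.
  by rewrite -ball_normE /= distrC.
by move=> [d d0 h]; apply/nbhs_ballP; exists d => //= y; rewrite -ball_normE /= distrC; exact: h.
Qed.

Lemma rderP (f : R -> R) (x l : R) : is_derive x (1 : R) f l <->
  forall e : R, 0 < e -> exists2 d : R, 0 < d &
  forall y, `|y - x| < d -> `|f y - f x - l * (y - x)| <= e * `|y - x|.
Proof.
split.
  move=> [df vf] e e0.
  have lim : (fun k : R => k^-1 *: ((f \o shift x) (k *: (1 : R)) - f x)) @ (0 : R)^' --> (l : R).
    by rewrite -vf; exact: df.
  move/cvgrPdist_lt : lim => /(_ _ e0); rewrite /dnbhs /within /= => /nbhsRP[d d0 hd].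
  exists d => // y yd.
  have [->|yx] := eqVneq y x; first by rewrite !subrr mulr0 subr0 normr0 mulr0.
  have := hd (y - x); rewrite subr0 => /(_ yd); rewrite subr_eq0 => /(_ yx).
  rewrite [_ *: 1]mulr1 subrK distrC => hk0.
  have hk : `|(y - x)^-1 * (f y - f x) - l| < e := hk0.
  have -> : f y - f x - l * (y - x) = (y - x) * ((y - x)^-1 * (f y - f x) - l).
    by rewrite [RHS]mulrBr mulrA mulfV ?subr_eq0// mul1r [l * _]mulrC.
  by rewrite normrM mulrC ler_wpM2r// ltW.
move=> h; suff lim : (fun k : R => k^-1 *: ((f \o shift x) (k *: (1 : R)) - f x)) @ (0 : R)^' --> (l : R).
  split; first by apply/cvg_ex; exists l.
  by apply: cvg_lim lim; exact: Rhausdorff.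
apply/cvgrPdist_lt => e e0; have [d d0 hd] := h (e / 2) ltac:(lra).
rewrite /dnbhs /within /=; apply/nbhsRP; exists d => // k; rewrite subr0 => kd k0.
have := hd (x + k); rewrite addrAC subrr add0r => /(_ kd) {hd}.
rewrite [_ *: 1]mulr1 /= [k + x]addrC => hk.
suff : `|l - k^-1 * (f (x + k) - f x)| < e by []; rewrite distrC.
have -> : k^-1 * (f (x + k) - f x) - l = k^-1 * (f (x + k) - f x - l * k).
  by rewrite [RHS]mulrBr [l * k]mulrC mulrA mulVf// mul1r.
rewrite normrM normfV ltr_pdivrMl ?normr_gt0//.
have kp : 0 < `|k| by rewrite normr_gt0.
apply: le_lt_trans hk _; nra.
Qed.
End RealDeriv.

(** * Rules for complex derivatives and the exponential *)

Section CDer.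
Variable R : realType.
Local Notation C := (R[i]^o).
Implicit Types (z w l : R[i]) (f g : C -> C).

Lemma cder_cst (c : C) z : cder (fun=> c) z 0.
Proof. by move=> e e0; exists 1 => // w _; rewrite subrr mul0r subr0 N0 mulr_ge0 ?N_ge0// ltW. Qed.
Lemma cder_id z : cder id z 1.
Proof. by move=> e e0; exists 1 => // w _; rewrite mul1r subrr N0 mulr_ge0 ?N_ge0// ltW. Qed.
Lemma cderD f g z l l' : cder f z l -> cder g z l' -> cder (fun w => f w + g w) z (l + l').
Proof. by move=> /cderP ? /cderP ?; apply/cderP; exact: is_deriveD. Qed.
Lemma cderN f z l : cder f z l -> cder (fun w => - f w) z (- l).
Proof. by move=> /cderP ?; apply/cderP; exact: is_deriveN. Qed.
Lemma cderB f g z l l' : cder f z l -> cder g z l' -> cder (fun w => f w - g w) z (l - l').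
Proof. by move=> ? ?; apply: cderD => //; exact: cderN. Qed.
Lemma cderM f g z l l' : cder f z l -> cder g z l' ->
  cder (fun w => f w * g w) z (l * g z + f z * l').
Proof.
move=> /cderP hf /cderP hg; apply/cderP; have := is_deriveM hf hg.
by move=> /is_derive_eq; apply; rewrite !scaleCE addrC [g z * _]mulrC.
Qed.
Lemma cderZ (c : C) f z l : cder f z l -> cder (fun w => c * f w) z (c * l).
Proof. by move=> /(cderM (cder_cst c z)); rewrite mul0r add0r. Qed.
Lemma cder_cont f z l : cder f z l -> forall e : R, 0 < e ->
  exists2 d : R, 0 < d & forall w, N (w - z) < d -> N (f w - f z) < e.
Proof.
move=> h e e0; have [d d0 hd] := h 1 ltr01.
have pL : 0 < 1 + N l by have := N_ge0 l; lra.
exists (Num.min d (e / (1 + N l))); first by rewrite lt_min d0 divr_gt0.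
move=> w; rewrite lt_min => /andP[/hd h1]; rewrite ltr_pdivlMr// => h2.
have -> : f w - f z = (f w - f z - l * (w - z)) + l * (w - z) by rewrite subrK.
apply: le_lt_trans (ND _ _) _; rewrite NM; have := N_ge0 (w - z); nra.
Qed.
Lemma cder_near f g z l : (exists2 d : R, 0 < d & forall w, N (w - z) < d -> f w = g w) ->
  cder f z l -> cder g z l.
Proof.
move=> [d d0 fg] h e e0; have [d' d0' h'] := h e e0.
exists (Num.min d d'); first by rewrite lt_min d0.
move=> w; rewrite lt_min => /andP[/fg <- /h']; rewrite (fg z)//.
by rewrite subrr N0.
Qed.
Lemma cder_eq f z l l' : cder f z l -> l = l' -> cder f z l'.
Proof. by move=> h <-. Qed.
Lemma cder_uniq f z l l' : cder f z l -> cder f z l' -> l = l'.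
Proof. by move=> /cder_derive1 <- /cder_derive1 <-. Qed.

Lemma cder_comp f g z l l' : cder g z l' -> cder f (g z) l ->
  cder (fun w => f (g w)) z (l * l').
Proof.
move=> hg hf e e0.
have pL : 0 < 1 + N l' by have := N_ge0 l'; lra.
have pL2 : 0 < 1 + N l by have := N_ge0 l; lra.
have [d1 d10 h1] := hf (e / 2 / (1 + N l')) ltac:(by rewrite !divr_gt0).
have [d2 d20 h2] := cder_cont hg d10.
have [d3 d30 h3] := hg (Num.min 1 (e / 2 / (1 + N l))) ltac:(by rewrite lt_min ltr01 !divr_gt0).
exists (Num.min d2 d3); first by rewrite lt_min d20.
move=> w; rewrite lt_min => /andP[/h2/h1 {}h1 /h3 {}h3].
have -> : f (g w) - f (g z) - l * l' * (w - z) = (f (g w) - f (g z) - l * (g w - g z))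
  + l * (g w - g z - l' * (w - z)) by ring.
apply: le_trans (ND _ _) _; rewrite NM.
have wz := N_ge0 (w - z).
have h4 : N (g w - g z) <= (1 + N l') * N (w - z).
  have -> : g w - g z = (g w - g z - l' * (w - z)) + l' * (w - z) by rewrite subrK.
  apply: le_trans (ND _ _) _; rewrite NM mulrDl mul1r lerD2r (le_trans h3)//.
  by rewrite ler_piMl// ge_min lexx.
have h5 : N (f (g w) - f (g z) - l * (g w - g z)) <= e / 2 * N (w - z).
  apply: le_trans h1 _; rewrite -mulrA; apply: ler_wpM2l; first by lra.
  by rewrite mulrC ler_pdivrMr// mulrC.
have h6 : N l * N (g w - g z - l' * (w - z)) <= e / 2 * N (w - z).
  apply: (@le_trans _ _ ((1 + N l) * (e / 2 / (1 + N l) * N (w - z)))); last first.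
    by rewrite mulrA [X in X * _]mulrC divfK// gt_eqF.
  apply: ler_pM; rewrite ?N_ge0//; first lra.
  by apply: (le_trans h3); rewrite ler_wpM2r// ge_min lexx orbT.
lra.
Qed.

Lemma cderV f z l : f z != 0 -> cder f z l -> cder (fun w => (f w)^-1) z (- l / f z ^+ 2).
Proof.
move=> fz0 /cderP [df vf]; apply/cderP; split; first exact: derivableV.
by rewrite (deriveV fz0 df) vf scaleCE mulNr mulrC mulNr.
Qed.

Lemma cexp0 : cexp 0 = 1 :> R[i].
Proof. by rewrite /cexp /= expR0 cos0 sin0 mulr0 mulr1. Qed.
Lemma cexpD z w : cexp (z + w) = cexp z * cexp w.
Proof.
by apply: Ceq; rewrite ?cReM ?cImM /cexp cReD cImD /= expRD ?cosD ?sinD; ring.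
Qed.
Lemma cexpN z : cexp (- z) = (cexp z)^-1.
Proof.
have h : cexp z * cexp (- z) = 1 by rewrite -cexpD subrr cexp0.
have z0 : cexp z != 0 by apply/eqP => h0; move/eqP : h; rewrite h0 mul0r eq_sym oner_eq0.
by apply: (mulfI z0); rewrite h mulfV.
Qed.
Lemma cexp_neq0 z : cexp z != 0.
Proof.
have h : cexp z * cexp (- z) = 1 by rewrite -cexpD subrr cexp0.
by apply/eqP => h0; move/eqP : h; rewrite h0 mul0r eq_sym oner_eq0.
Qed.
Lemma N_cexp z : N (cexp z) = expR (Rex z).
Proof.
apply/eqP; rewrite -(@eqrXn2 _ 2)// ?N_ge0 ?expR_ge0//; apply/eqP.
by rewrite Nsqr /= !exprMn -mulrDr cos2Dsin2 mulr1.
Qed.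
(** Injectivity of the exponential near 0, which lets two logarithms be compared. The modulus gives
    [Re z = 0]; then [sin (Im z) = 0] with [|Im z| < 1 < pi]. *)
Lemma cexp_eq1 z : N z < 1 -> cexp z = 1 -> z = 0.
Proof.
move=> z1 h; have := N_cexp z; rewrite h N1 => h1.
have x0 : Rex z = 0 by apply: expR_inj; rewrite expR0.
have s0 : sin (Imx z) = 0 by have := congr1 (fun u => Imx u) h; rewrite /cexp /= x0 expR0 mul1r.
have i1 : `|Imx z| < 1 := le_lt_trans (NIm z) z1.
have pi2 := pi_ge2 R.
apply: Ceq => //=.
apply/eqP; case: (ltgtP (Imx z) 0) => // hz.
  have : 0 < sin (- Imx z).
    by apply: sin_gt0_pi; rewrite ?oppr_gt0// in i1 *; rewrite (ltr0_norm hz) in i1; apply/andP; lra.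
  by rewrite sinN s0 oppr0 ltxx.
have : 0 < sin (Imx z).
  by apply: sin_gt0_pi; rewrite (gtr0_norm hz) in i1; lra.
by rewrite s0 ltxx.
Qed.
Lemma cder_cexp z : cder (@cexp R) z (cexp z).
Proof.
have h0 : cder (@cexp R) 0 1.
  (* With [m] the minimum below, the remainders [A], [B], [D] of exp, cos, sin cost [m * N w] each
     and the two products cost [2 m N w] and [4 m N w]: nine in all, which 16 covers. *)
  move=> e e0; have e4 : 0 < Num.min 1 (e / 16) by rewrite lt_min ltr01 divr_gt0.
  have [d1 d10 h1] := (rderP _ _ _).1 (is_derive_expR 0) _ e4.
  have [d2 d20 h2] := (rderP _ _ _).1 (is_derive_cos 0) _ e4.
  have [d3 d30 h3] := (rderP _ _ _).1 (is_derive_sin 0) _ e4.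
  exists (Num.min (Num.min (Num.min 1 (e / 16)) d1) (Num.min d2 d3)); first by rewrite lt_min [in X in _ && X]lt_min lt_min e4 d10 d20 d30.
  move=> w; rewrite subr0 lt_min [in X in _ && X]lt_min lt_min => /andP[/andP[w1 wd1] /andP[wd2 wd3]].
  rewrite cexp0 mul1r.
  have hx := NRe w; have hy := NIm w.
  have := h1 (Rex w); rewrite subr0 expR0 mul1r => /(_ (le_lt_trans hx wd1)) {}h1.
  have := h2 (Imx w); rewrite subr0 cos0 sin0 oppr0 mul0r subr0 => /(_ (le_lt_trans hy wd2)) {}h2.
  have := h3 (Imx w); rewrite subr0 sin0 cos0 mul1r subr0 => /(_ (le_lt_trans hy wd3)) {}h3.
  set x := Rex w in hx h1 *; set y := Imx w in hy h2 h3 *.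
  have nw := N_ge0 w.
  set A := expR x - 1 - x in h1; set B := cos y - 1 in h2; set D := sin y - y in h3.
  set m := Num.min 1 (e / 16) in e4 h1 h2 h3 w1.
  have m1 : m <= 1 by rewrite ge_min lexx.
  have m8 : m <= e / 16 by rewrite ge_min lexx orbT.
  have hA : `|A| <= m * N w by apply: le_trans h1 _; rewrite ler_pM2l.
  have hB : `|B| <= m * N w by apply: le_trans h2 _; rewrite ler_pM2l.
  have hD : `|D| <= m * N w by apply: le_trans h3 _; rewrite ler_pM2l.
  have ex : expR x = 1 + x + A by rewrite /A; lra.
  have -> : cexp w - 1 - w = (A + B + (x + A) * B) +i* (D + (x + A) * (y + D)).
    by apply: Ceq; rewrite ?(cReD, cImD, cReN, cImN) /= -/x -/y ex /B /D; ring.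
  have hxA : `|x + A| <= 2 * N w by apply: le_trans (ler_normD _ _) _; nra.
  have hyD : `|y + D| <= 2 * N w by apply: le_trans (ler_normD _ _) _; nra.
  have b1 : `|(x + A) * B| <= 2 * N w * m.
    rewrite normrM; apply: ler_pM => //; apply: le_trans hB _; nra.
  have b2 : `|(x + A) * (y + D)| <= 2 * N w * (2 * m).
    by rewrite normrM; apply: ler_pM => //; apply: le_trans hyD _; rewrite ler_pM2l ?ltW.
  apply: le_trans (Nle _) _ => /=.
  have b3 := ler_normD (A + B) ((x + A) * B); have b4 := ler_normD A B.
  have b5 := ler_normD D ((x + A) * (y + D)).
  nra.
have -> : @cexp R = (fun w => cexp z * cexp (w - z)).
  by apply/funext => w; rewrite -cexpD addrC subrK.
rewrite subrr cexp0 mulr1 -[X in cder _ _ X]mulr1; apply: cderZ.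
rewrite -[1 in X in cder _ _ X]mulr1; apply: cder_comp; last by rewrite subrr.
by rewrite -[1]subr0; apply: cderB; [exact: cder_id|exact: cder_cst].
Qed.
Lemma cder_ray f z l (t : R) : cder f (t%:C * z) l ->
  is_derive t (1 : R) (fun s : R => Rex (f (s%:C * z))) (Rex (l * z)).
Proof.
move=> h; apply/rderP => e e0.
have pz : 0 < 1 + N z by have := N_ge0 z; lra.
have [d d0 hd] := h (e / (1 + N z)) ltac:(by rewrite divr_gt0).
exists (d / (1 + N z)); first by rewrite divr_gt0.
move=> s; rewrite ltr_pdivlMr// => st.
have E : s%:C * z - t%:C * z = (s - t)%:C * z by rewrite -mulrBl rmorphB.
have En : N ((s - t)%:C * z) <= `|s - t| * (1 + N z).
  by rewrite NM NR ler_wpM2l// lerDr.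
have := hd (s%:C * z); rewrite E => /(_ (le_lt_trans En st)) h1.
have -> : Rex (f (s%:C * z)) - Rex (f (t%:C * z)) - Rex (l * z) * (s - t) =
   Rex (f (s%:C * z) - f (t%:C * z) - l * ((s - t)%:C * z)).
  by rewrite !cReD !cReN [l * (_ * z)]mulrCA cReRM [Rex _ * (s - t)]mulrC.
apply: le_trans (NRe _) _; apply: le_trans h1 _.
apply: (@le_trans _ _ (e / (1 + N z) * (`|s - t| * (1 + N z)))).
  by rewrite ler_wpM2l// divr_ge0// ltW.
by rewrite mulrCA divfK ?gt_eqF// mulrC.
Qed.
End CDer.

(** * Integrals of complex functions of a real variable *)

Section CInt.
Variable R : realType.
Local Notation C := (R[i]^o).
Local Notation mu := (@lebesgue_measure R).
Implicit Types (D : set R) (F G : R -> C) (a b x : R).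

Definition cintegrable D F := mu.-integrable D (fun x => (Rex (F x))%:E) /\
  mu.-integrable D (fun x => (Imx (F x))%:E).

Definition ct F x := F @ x --> (F x : C).

Lemma ct_Re F x : ct F x -> {for x, continuous (fun x => Rex (F x))}.
Proof.
move=> /cvgCP h; apply/cvgrPdist_lt => e /h; apply: filterS => y.
by apply: le_lt_trans; rewrite distrC -cReN -cReD; exact: NRe.
Qed.
Lemma ct_Im F x : ct F x -> {for x, continuous (fun x => Imx (F x))}.
Proof.
move=> /cvgCP h; apply/cvgrPdist_lt => e /h; apply: filterS => y.
by apply: le_lt_trans; rewrite distrC -cImN -cImD; exact: NIm.
Qed.
Lemma ct_ReIm F x : {for x, continuous (fun x => Rex (F x))} ->
  {for x, continuous (fun x => Imx (F x))} -> ct F x.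
Proof.
move=> /cvgrPdist_lt h1 /cvgrPdist_lt h2; apply/cvgCP => e e0.
have e2 : 0 < e / 2 by lra.
move: (h1 _ e2) (h2 _ e2); apply: filterS2 => y.
rewrite -cReN -cReD -cImN -cImD => i1 i2; rewrite NC.
by apply: le_lt_trans (Nle _) _; lra.
Qed.
Lemma ct_cst (c : C) x : ct (fun=> c) x. Proof. exact: cvg_cst. Qed.
Lemma ctD F G x : ct F x -> ct G x -> ct (fun y => F y + G y) x.
Proof. exact: cvgD. Qed.
Lemma ctN F x : ct F x -> ct (fun y => - F y) x.
Proof. exact: cvgN. Qed.
Lemma ctB F G x : ct F x -> ct G x -> ct (fun y => F y - G y) x.
Proof. exact: cvgB. Qed.
Lemma ctM F G x : ct F x -> ct G x -> ct (fun y => F y * G y) x.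
Proof. exact: cvgM. Qed.
Lemma ctV F x : F x != 0 -> ct F x -> ct (fun y => (F y)^-1) x.
Proof. by move=> F0 /cvgV; exact. Qed.
Lemma ct_cder (f : C -> C) F x l : ct F x -> cder f (F x) l -> ct (fun y => f (F y)) x.
Proof.
move=> /cvgCP hF /cder_cont hf; apply/cvgCP => e /hf[d d0 hd].
by apply: filterS (hF _ d0) => y /hd.
Qed.
Lemma ct_RC (h : R -> R) x : {for x, continuous h} -> ct (fun y => (h y)%:C) x.
Proof. by move=> ch; apply: ct_ReIm => //=; exact: cvg_cst. Qed.

Lemma cont_integrable (f : R -> R) a b :
  (forall x, a <= x <= b -> {for x, continuous f}) ->
  mu.-integrable `[a, b] (EFin \o f).
Proof.
move=> h; apply: continuous_compact_integrable; first exact: segment_compact.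
apply: continuous_in_subspaceT => x; rewrite inE /= in_itv /=; exact: h.
Qed.
Lemma ct_cintegrable F a b : (forall x, a <= x <= b -> ct F x) -> cintegrable `[a, b] F.
Proof. by move=> h; split; apply: cont_integrable => x /h; [exact: ct_Re|exact: ct_Im]. Qed.

Lemma cintegrableD D F G : measurable (D : set (measurableTypeR R)) -> cintegrable D F -> cintegrable D G ->
  cintegrable D (fun x => F x + G x).
Proof.
move=> mD [h1 h2] [h3 h4]; split.
  rewrite (_ : (fun x => _) = (fun x => (Rex (F x))%:E) \+ (fun x => (Rex (G x))%:E))%E.
    exact: integrableD.
  by apply/funext => x /=; rewrite cReD.
rewrite (_ : (fun x => _) = (fun x => (Imx (F x))%:E) \+ (fun x => (Imx (G x))%:E))%E.
  exact: integrableD.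
by apply/funext => x /=; rewrite cImD.
Qed.
Lemma cintD D F G : measurable (D : set (measurableTypeR R)) -> cintegrable D F -> cintegrable D G ->
  cintegral D (fun x => F x + G x) = cintegral D F + cintegral D G.
Proof.
move=> mD [h1 h2] [h3 h4]; apply: Ceq => /=.
  by rewrite -RintegralD//; apply: eq_Rintegral => x _; rewrite cReD.
by rewrite -RintegralD//; apply: eq_Rintegral => x _; rewrite cImD.
Qed.
Lemma cintegrableZ D (c : R[i]) F : measurable (D : set (measurableTypeR R)) -> cintegrable D F ->
  cintegrable D (fun x => c * F x).
Proof.
move=> mD [h1 h2]; split.
  rewrite (_ : (fun x => _) = (fun x => (Rex c)%:E * (Rex (F x))%:E) \+ (fun x => (- Imx c)%:E * (Imx (F x))%:E))%E.
    by apply: integrableD => //; apply: integrableZl.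
  by apply/funext => x /=; rewrite cReM -!EFinM -EFinD mulNr.
rewrite (_ : (fun x => _) = (fun x => (Rex c)%:E * (Imx (F x))%:E) \+ (fun x => (Imx c)%:E * (Rex (F x))%:E))%E.
  by apply: integrableD => //; apply: integrableZl.
by apply/funext => x /=; rewrite cImM.
Qed.
Lemma cintZ D (c : R[i]) F : measurable (D : set (measurableTypeR R)) -> cintegrable D F ->
  cintegral D (fun x => c * F x) = c * cintegral D F.
Proof.
move=> mD [h1 h2].
have k1 (r : R) : mu.-integrable D (EFin \o (fun x => (r * Rex (F x)))).
  by have := integrableZl mD r h1; congr (mu.-integrable D _); apply/funext => x /=.
have k2 (r : R) : mu.-integrable D (EFin \o (fun x => (r * Imx (F x)))).
  by have := integrableZl mD r h2; congr (mu.-integrable D _); apply/funext => x /=.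
apply: Ceq; rewrite ?cReM ?cImM /=.
  rewrite -!RintegralZl// -RintegralB//.
  by apply: eq_Rintegral => x _; rewrite cReM.
by rewrite -!RintegralZl// -RintegralD//; apply: eq_Rintegral => x _; rewrite cImM.
Qed.
Lemma cintB D F G : measurable (D : set (measurableTypeR R)) -> cintegrable D F -> cintegrable D G ->
  cintegral D (fun x => F x - G x) = cintegral D F - cintegral D G.
Proof.
move=> mD hF hG; rewrite -mulN1r -cintZ// -cintD//; last exact: cintegrableZ.
by congr cintegral; apply/funext => x; rewrite mulN1r.
Qed.
Lemma cint_cat F a b c : a <= b <= c -> (forall x, a <= x <= c -> ct F x) ->
  cintegral `[a, c] F = cintegral `[a, b] F + cintegral `[b, c] F.
Proof.
move=> /andP[ab bc] h; have [h1 h2] := ct_cintegrable h.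
have H (f : R -> R) : mu.-integrable `[a, c] (fun x => (f x)%:E) ->
   \int[mu]_(x in `[a, c]) f x = \int[mu]_(x in `[a, b]) f x + \int[mu]_(x in `[b, c]) f x.
  move=> hf; have hf2 : mu.-integrable `]b, c] (EFin \o f).
    by apply: integrableS hf => //; apply: subset_itvr; rewrite bnd_simp.
  rewrite -(Rintegral_itv_obnd_cbnd hf2) -(Rintegral_itvB hf) ?bnd_simp//.
  by rewrite addrC subrK.
by apply: Ceq; rewrite ?cReD ?cImD /=; exact: H.
Qed.
Lemma leb_itv a b : a <= b -> fine (mu `[a, b]) = b - a.
Proof.
move=> ab; rewrite lebesgue_measure_itv /= lte_fin.
case: ltP => [_|ba]; first by rewrite -EFinB.
have e : b = a by apply/le_anti; rewrite ab ba.
by rewrite e subrr.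
Qed.
Lemma Rint_norm_le (f : R -> R) a b (M : R) : a <= b ->
  mu.-integrable `[a, b] (EFin \o f) -> (forall x, a <= x <= b -> `|f x| <= M) ->
  `|\int[mu]_(x in `[a, b]) f x| <= M * (b - a).
Proof.
move=> ab hf hM; apply: le_trans (le_normr_Rintegral _ hf) _ => //.
apply: (@le_trans _ _ (\int[mu]_(x in `[a, b]) M)).
  apply: le_Rintegral => //.
  - exact: integrable_norm.
  - by apply: cont_integrable => x _; exact: cvg_cst.
by rewrite Rintegral_cst//= leb_itv.
Qed.
(** The factor 2 is the price of bounding the real and imaginary parts separately. *)
Lemma cint_norm F a b (M : R) : a <= b -> (forall x, a <= x <= b -> ct F x) ->
  (forall x, a <= x <= b -> N (F x) <= M) -> N (cintegral `[a, b] F) <= 2 * M * (b - a).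
Proof.
move=> ab h hM; have [h1 h2] := ct_cintegrable h.
apply: le_trans (Nle _) _.
have b1 := Rint_norm_le ab h1 (fun x hx => le_trans (NRe _) (hM x hx)).
have b2 := Rint_norm_le ab h2 (fun x hx => le_trans (NIm _) (hM x hx)).
by rewrite /cintegral /=; lra.
Qed.
Lemma Rint_FTC (f F : R -> R) a b : a <= b ->
  (forall x, a <= x <= b -> is_derive x (1 : R) F (f x)) ->
  (forall x, a <= x <= b -> {for x, continuous f}) ->
  \int[mu]_(x in `[a, b]) f x = F b - F a.
Proof.
rewrite le_eqVlt => /predU1P[->|ab] dF cf.
  by rewrite set_itv1 Rintegral_set1 subrr.
have cF x : a <= x <= b -> {for x, continuous F}.
  by move=> /dF [h _]; apply: differentiable_continuous; exact/derivable1_diffP.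
rewrite /Rintegral (@continuous_FTC2 _ f F)//=.
- by apply: continuous_in_subspaceT => x; rewrite inE /= in_itv /=; exact: cf.
- split.
  + move=> x; rewrite in_itv /= => /andP[ax xb].
    by case: (dF x) => //; rewrite !ltW.
  + by apply: cvg_at_right_filter; apply: cF; rewrite lexx ltW.
  + by apply: cvg_at_left_filter; apply: cF; rewrite lexx ltW.
- move=> x; rewrite in_itv /= => /andP[ax xb].
  have [_ v] := dF x ltac:(by rewrite !ltW).
  by rewrite derive1E.
Qed.
Lemma cint_FTC (f F : R -> C) a b : a <= b ->
  (forall x, a <= x <= b -> is_derive x (1 : R) (fun x => Rex (F x)) (Rex (f x)) /\
    is_derive x (1 : R) (fun x => Imx (F x)) (Imx (f x))) ->
  (forall x, a <= x <= b -> ct f x) ->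
  cintegral `[a, b] f = F b - F a.
Proof.
move=> ab dF cf; apply: Ceq; rewrite ?(cReD, cReN, cImD, cImN) /=.
  apply: (Rint_FTC (F := fun x => Rex (F x))) => // x hx.
    by have [] := dF x hx.
  exact/ct_Re/cf.
apply: (Rint_FTC (F := fun x => Imx (F x))) => // x hx.
  by have [] := dF x hx.
exact/ct_Im/cf.
Qed.
Lemma cint_cst (c : R[i]) a b : a <= b -> cintegral `[a, b] (fun=> c : C) = (b - a)%:C * c.
Proof.
move=> ab; apply: Ceq; rewrite ?cReRM ?cImRM.
  by rewrite /cintegral [LHS]/= Rintegral_cst//= leb_itv// mulrC.
by rewrite /cintegral [LHS]/= Rintegral_cst//= leb_itv// mulrC.
Qed.
End CInt.

(** * Cauchy's integral formula *)

Section Goursat.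
Variable R : realType.
Local Notation C := (R[i]^o).

Lemma nested_intervals (u v : nat -> R) : (forall n, u n <= u n.+1) -> (forall n, v n.+1 <= v n) ->
  (forall n, u n <= v n) -> exists x, forall n, u n <= x <= v n.
Proof.
move=> hu hv huv.
have mu m n : (m <= n)%N -> u m <= u n.
  by move=> /subnK <-; elim: (n - m)%N => [//|k IH]; apply: le_trans IH (hu _).
have mv m n : (m <= n)%N -> v n <= v m.
  by move=> /subnK <-; elim: (n - m)%N => [//|k IH]; apply: le_trans (hv _) IH.
have uv m n : u m <= v n.
  by case: (leqP m n) => [/mu h|/ltnW/mv h]; [apply: le_trans h _|apply: le_trans _ h].
exists (sup (range u)) => n; apply/andP; split.
  apply: ub_le_sup; last by exists n.
  by exists (v 0%N) => _ [m _ <-].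
apply: ge_sup; first by exists (u 0%N); exists 0%N.
by move=> _ [m _ <-].
Qed.

Variable (I : R -> R -> R -> R -> R[i]) (X1 X2 Y1 Y2 : R).
Hypothesis (X12 : X1 <= X2) (Y12 : Y1 <= Y2).
Hypothesis Hadd : forall x1 x2 y1 y2, X1 <= x1 -> x1 <= x2 -> x2 <= X2 ->
  Y1 <= y1 -> y1 <= y2 -> y2 <= Y2 ->
  I x1 x2 y1 y2 = I x1 ((x1 + x2) / 2) y1 ((y1 + y2) / 2) +
   I ((x1 + x2) / 2) x2 y1 ((y1 + y2) / 2) +
   I x1 ((x1 + x2) / 2) ((y1 + y2) / 2) y2 +
   I ((x1 + x2) / 2) x2 ((y1 + y2) / 2) y2.
Hypothesis Hloc : forall x y, X1 <= x <= X2 -> Y1 <= y <= Y2 -> forall e : R, 0 < e ->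
  exists2 d : R, 0 < d & forall x1 x2 y1 y2, X1 <= x1 <= x -> x <= x2 <= X2 ->
    Y1 <= y1 <= y -> y <= y2 <= Y2 -> x2 - x1 < d -> y2 - y1 < d ->
    N (I x1 x2 y1 y2) <= e * ((x2 - x1) + (y2 - y1)) ^+ 2.

(* Goursat: an additive function of rectangles that is small compared to the squared
   diameter near every point vanishes. *)
Lemma bisection_eq0 : I X1 X2 Y1 Y2 = 0.
Proof.
apply/eqP; rewrite -N_eq0; apply/negPn/negP => I0.
have I0p : 0 < N (I X1 X2 Y1 Y2) by rewrite lt_neqAle eq_sym I0 N_ge0.
pose L := (X2 - X1) + (Y2 - Y1).
have X12p := X12; have Y12p := Y12.
have L0 : 0 <= L by rewrite addr_ge0// subr_ge0.
(* With this [e] the whole rectangle is [bad] at level 0. [L + 1] replaces [L] so that a degenerate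
   rectangle causes no division by 0. *)
pose e := N (I X1 X2 Y1 Y2) / (L + 1) ^+ 2.
have L1 : 0 < (L + 1) ^+ 2 by rewrite exprn_gt0//; lra.
have e0 : 0 < e by rewrite divr_gt0.
pose lx n := (X2 - X1) / 2 ^+ n; pose ly n := (Y2 - Y1) / 2 ^+ n.
pose S n := (L + 1) / 2 ^+ n.
have p2 n : 0 < (2 : R) ^+ n by rewrite exprn_gt0.
have lx0 n : 0 <= lx n by apply: divr_ge0; [rewrite subr_ge0|exact: ltW].
have ly0 n : 0 <= ly n by apply: divr_ge0; [rewrite subr_ge0|exact: ltW].
have hlx n : lx n = 2 * lx n.+1 by rewrite /lx exprS; field; rewrite gt_eqF.
have hly n : ly n = 2 * ly n.+1 by rewrite /ly exprS; field; rewrite gt_eqF.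
have hS n : S n = 2 * S n.+1 by rewrite /S exprS; field; rewrite gt_eqF.
have S0 n : 0 < S n by rewrite divr_gt0//; lra.
pose Q n (c : R * R) := N (I c.1 (c.1 + lx n) c.2 (c.2 + ly n)).
(* [S n] halves at each level, so the threshold is divided by 4: if all four quarters stayed below
   theirs, additivity would put the rectangle below its own. Hence a bad rectangle has a bad
   quarter, which [next] selects. *)
pose bad n c := e * S n ^+ 2 <= Q n c.
pose next n (c : R * R) : R * R :=
  if bad n.+1 c then c else
  if bad n.+1 (c.1 + lx n.+1, c.2) then (c.1 + lx n.+1, c.2) else
  if bad n.+1 (c.1, c.2 + ly n.+1) then (c.1, c.2 + ly n.+1) else
  (c.1 + lx n.+1, c.2 + ly n.+1).
pose ok n (c : R * R) := [/\ X1 <= c.1, c.1 + lx n <= X2, Y1 <= c.2, c.2 + ly n <= Y2 & bad n c].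
have next_ok n c : ok n c -> [/\ ok n.+1 (next n c), c.1 <= (next n c).1,
   (next n c).1 + lx n.+1 <= c.1 + lx n, c.2 <= (next n c).2 &
   (next n c).2 + ly n.+1 <= c.2 + ly n].
  move=> [h1 h2 h3 h4 h5].
  have := lx0 n.+1; have := ly0 n.+1; have := hlx n; have := hly n => k1 k2 k3 k4.
  rewrite /next; case: ifPn => [b1|/negP b1]; first by split; rewrite /ok /=; try split => //; lra.
  case: ifPn => [b2|/negP b2]; first by split; rewrite /ok /=; try split => //=; lra.
  case: ifPn => [b3|/negP b3]; first by split; rewrite /ok /=; try split => //=; lra.
  split; rewrite /ok /=; try lra; split => //=; try lra.
  rewrite /bad leNgt; apply/negP => b4.
  move: b1 b2 b3 => /negP; rewrite /bad -ltNge => b1 /negP; rewrite /bad -ltNge => b2 /negP; rewrite /bad -ltNge => b3.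
  move: h5; rewrite /bad leNgt => /negP; apply.
  rewrite {1}/Q Hadd//; [|lra..].
  have -> : (c.1 + (c.1 + lx n)) / 2 = c.1 + lx n.+1 by lra.
  have -> : (c.2 + (c.2 + ly n)) / 2 = c.2 + ly n.+1 by lra.
  move: b1 b2 b3 b4; rewrite /Q /=.
  have -> : c.1 + lx n.+1 + lx n.+1 = c.1 + lx n by lra.
  have -> : c.2 + ly n.+1 + ly n.+1 = c.2 + ly n by lra.
  move=> b1 b2 b3 b4.
  have -> : e * S n ^+ 2 = e * S n.+1 ^+ 2 + e * S n.+1 ^+ 2 + e * S n.+1 ^+ 2 + e * S n.+1 ^+ 2.
    by rewrite hS; ring.
  apply: le_lt_trans (ND _ _) _; apply: ltrD => //.
  apply: le_lt_trans (ND _ _) _; apply: ltrD => //.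
  by apply: le_lt_trans (ND _ _) _; apply: ltrD.
pose fix c n := if n is n'.+1 then next n' (c n') else (X1, Y1).
have cok n : ok n (c n).
  elim: n => [|n /next_ok[]//]; rewrite /ok /= /lx /ly expr0; split; rewrite ?lexx//; try lra.
  rewrite /bad /S /Q /= /lx /ly expr0 !divr1 /e divfK ?gt_eqF//.
  by rewrite !(addrC _ (_ - _)) !subrK.
have [x hx] := @nested_intervals (fun n => (c n).1) (fun n => (c n).1 + lx n)
   (fun n => let: And5 _ h _ _ _ := next_ok n _ (cok n) in h)
   (fun n => let: And5 _ _ h _ _ := next_ok n _ (cok n) in h)
   ltac:(by move=> n; rewrite lerDl).
have [y hy] := @nested_intervals (fun n => (c n).2) (fun n => (c n).2 + ly n)
   (fun n => let: And5 _ _ _ h _ := next_ok n _ (cok n) in h)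
   (fun n => let: And5 _ _ _ _ h := next_ok n _ (cok n) in h)
   ltac:(by move=> n; rewrite lerDl).
have xX : X1 <= x <= X2.
  by have [h1 h2 _ _ _] := cok 0%N; have := hx 0%N; lra.
have yY : Y1 <= y <= Y2.
  by have [_ _ h1 h2 _] := cok 0%N; have := hy 0%N; lra.
(* Half of [e], so that the local bound at the common point contradicts badness strictly. *)
have e2 : 0 < e / 2 by lra.
have [d d0 hd] := Hloc xX yY e2.
have [n Sn] : exists n, S n < d.
  have [n hn] : exists n, (L + 1) / d < n%:R.
    by exists (Num.bound ((L + 1) / d)); apply: archi_boundP; rewrite divr_ge0 ?ltW//; lra.
  exists n; rewrite /S ltr_pdivrMr//.
  have h2 : n%:R < (2 : R) ^+ n by rewrite -natrX ltr_nat ltn_expl.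
  by move: hn; rewrite ltr_pdivrMr// mulrC => hn; apply: lt_trans hn _; rewrite ltr_pM2l.
have [h1 h2 h3 h4 h5] := cok n.
have hxy : lx n + ly n <= S n.
  by rewrite /lx /ly /S -mulrDl ler_pM2r ?invr_gt0// lerDl.
have hx1 := hx n; have hy1 := hy n; have l1 := lx0 n; have l2 := ly0 n.
have := hd (c n).1 ((c n).1 + lx n) (c n).2 ((c n).2 + ly n).
have -> : (c n).1 + lx n - (c n).1 = lx n by ring.
have -> : (c n).2 + ly n - (c n).2 = ly n by ring.
move=> /(_ ltac:(lra) ltac:(lra) ltac:(lra) ltac:(lra) ltac:(lra) ltac:(lra)) hI.
have : e * S n ^+ 2 <= e / 2 * S n ^+ 2.
  apply: le_trans h5 _; apply: le_trans hI _; rewrite ler_pM2l//.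
  by rewrite ler_pXn2r ?nnegrE ?addr_ge0// ltW.
have s2 : 0 < S n ^+ 2 by rewrite exprn_gt0.
by rewrite ler_pM2r// => ?; lra.
Qed.
End Goursat.

Section Cauchy.
Variable R : realType.
Local Notation C := (R[i]^o).
Local Notation mu := (@lebesgue_measure R).

Definition cis (t : R) : C := cexp (t *i).

Definition ic : C := Complex 0 1.
Lemma Nic : N ic = 1. Proof. by rewrite /= expr0n expr1n add0r sqrtr1. Qed.
Lemma N_cis t : N (cis t) = 1. Proof. by rewrite N_cexp /= expR0. Qed.
Lemma Re_cis t : Rex (cis t) = cos t. Proof. by rewrite /= expR0 mul1r. Qed.
Lemma Im_cis t : Imx (cis t) = sin t. Proof. by rewrite /= expR0 mul1r. Qed.
Lemma ct_cis t : ct cis t.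
Proof.
apply: ct_ReIm.
  by rewrite (funext Re_cis); exact: continuous_cos.
by rewrite (funext Im_cis); exact: continuous_sin.
Qed.
Lemma cisD s t : cis (s + t) = cis s * cis t.
Proof. by rewrite /cis -cexpD; congr cexp; apply: Ceq => //=; rewrite addr0. Qed.
Lemma cis0 : cis 0 = 1. Proof. exact: cexp0. Qed.
Lemma cis2pi : cis (2 * pi) = 1.
Proof.
apply: Ceq; rewrite ?Re_cis ?Im_cis.
  by rewrite mulrC mulr_natr cos2pi.
by rewrite mulrC mulr_natr sin2pi.
Qed.

Lemma cis_Lip s t : N (cis s - cis t) <= 2 * `|s - t|.
Proof.
wlog st : s t / t <= s => [h|].
  by case: (leP t s) => [/h//|/ltW/h]; rewrite NC distrC.
have dc x : is_derive x (1 : R) (fun x => Rex (cis x)) (Rex (ic * cis x)) /\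
    is_derive x (1 : R) (fun x => Imx (cis x)) (Imx (ic * cis x)).
  rewrite cReM cImM Re_cis Im_cis (funext Re_cis) (funext Im_cis) /=.
  rewrite !mul0r !mul1r sub0r add0r.
  by split; [exact: is_derive_cos|exact: is_derive_sin].
rewrite -(cint_FTC st (fun x _ => dc x)); last first.
  by move=> x _; apply: ctM; [exact: ct_cst|exact: ct_cis].
rewrite ger0_norm ?subr_ge0// -[2]mulr1; apply: cint_norm => //.
  by move=> x _; apply: ctM; [exact: ct_cst|exact: ct_cis].
by move=> x _; rewrite NM N_cis Nic mulr1.
Qed.

Lemma expR_Lip (s t : R) : s <= 0 -> t <= 0 -> `|expR s - expR t| <= `|s - t|.
Proof.
wlog st : s t / t <= s => [h|s0 t0].
  by move=> s0 t0; case: (leP t s) => [/h->//|/ltW/h]; rewrite distrC (distrC s); apply.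
rewrite !ger0_norm ?subr_ge0 ?ler_expR//.
have -> : expR s - expR t = expR s * (1 - expR (t - s)).
  by rewrite mulrBr mulr1 -expRD [s + _]addrC subrK.
have h := expR_ge1Dx (t - s).
have h1 : expR s <= 1 by rewrite -expR0 ler_expR.
have h2 : expR (t - s) <= 1 by rewrite -expR0 ler_expR subr_le0.
have h3 := expR_gt0 s; nra.
Qed.

Variables (f : C -> C) (r : R) (a : C).
Hypothesis (r0 : 0 < r) (r1 : r < 1) (ar : N a < r).
Hypothesis fder : forall z, N z < 1 -> exists l, cder f z l.

Definition circ (t : R) : C := r%:C * cis t.
(* The circle at [s = 0], contracting to [a] as [s] tends to minus infinity. *)
Definition homot (s t : R) : C := a + (expR s)%:C * (circ t - a).
(** The logarithmic derivative in [t] of [circ t - a], and so of [homot s t - a] for every [s]: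
    [cker t dt] is [dw/(w - a)] along each contracted circle. *)
Definition cker (t : R) : C := ic * circ t / (circ t - a).

Lemma N_circ t : N (circ t) = r. Proof. by rewrite /circ NM NR N_cis mulr1 gtr0_norm. Qed.
Lemma circ_neq t : circ t - a != 0.
Proof. by rewrite subr_eq0; apply/eqP => h; move: ar; rewrite -h N_circ ltxx. Qed.
Lemma N_circ_ge t : r - N a <= N (circ t - a).
Proof. by have := ND (circ t - a) a; rewrite subrK N_circ; lra. Qed.
Lemma N_circ_le2 t : N (circ t - a) <= 2.
Proof. apply: le_trans (NB (circ t) a) _. rewrite N_circ; have := r1; have := ar; lra. Qed.
Lemma N_homot s t : s <= 0 -> N (homot s t) <= r.
Proof.
move=> s0; have h1 : expR s <= 1 by rewrite -expR0 ler_expR.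
have h3 := expR_gt0 s.
have -> : homot s t = (1 - expR s)%:C * a + (expR s)%:C * circ t.
  by rewrite /homot rmorphB /=; ring.
apply: le_trans (ND _ _) _; rewrite (NM _ a) (NM _ (circ t)) !NR N_circ (gtr0_norm h3) ger0_norm ?subr_ge0//.
have h4 : 0 <= (1 - expR s) * (r - N a) by rewrite mulr_ge0 ?subr_ge0// ltW.
lra.
Qed.
Lemma ct_circ t : ct circ t.
Proof. by apply: ctM; [exact: ct_cst|exact: ct_cis]. Qed.
Lemma ct_homot_l s t : ct (fun s => homot s t) s.
Proof.
apply: ctD; first exact: ct_cst.
apply: ctM; last exact: ct_cst.
by apply: ct_RC; exact: continuous_expR.
Qed.
Lemma ct_homot_r s t : ct (fun t => homot s t) t.
Proof.
apply: ctD; first exact: ct_cst.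
apply: ctM; first exact: ct_cst.
by apply: ctB; [exact: ct_circ|exact: ct_cst].
Qed.
Lemma ct_cker t : ct cker t.
Proof.
apply: ctM; first by apply: ctM; [exact: ct_cst|exact: ct_circ].
by apply: ctV; [exact: circ_neq|apply: ctB; [exact: ct_circ|exact: ct_cst]].
Qed.
Definition cker_bound := (r - N a)^-1.
Lemma cker_bound_gt0 : 0 < cker_bound. Proof. rewrite /cker_bound;by rewrite invr_gt0 subr_gt0. Qed.
Lemma N_cker t : N (cker t) <= cker_bound.
Proof.
rewrite /cker /cker_bound (NM _ (_^-1)) (NM ic) NV N_circ Nic mul1r.
have h := N_circ_ge t; have h0 : 0 < r - N a by rewrite subr_gt0.
have h1 : 0 < N (circ t - a) by apply: lt_le_trans h0 h.
rewrite ler_pdivrMr// mulrC ler_pdivlMr//.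
have := r1; have := r0; nra.
Qed.
Lemma homot_Lip s t s' t' : s <= 0 -> s' <= 0 ->
  N (homot s t - homot s' t') <= 2 * (`|s - s'| + `|t - t'|).
Proof.
move=> s0 s0'.
have -> : homot s t - homot s' t' = (expR s - expR s')%:C * (circ t - a) + ((expR s')%:C * r%:C) * (cis t - cis t').
  by rewrite /homot rmorphB /= /circ; ring.
apply: le_trans (ND _ _) _; rewrite !NM !NR.
have h1 := expR_Lip s0 s0'; have h2 := N_circ_le2 t; have h3 := cis_Lip t t'.
have h4 : expR s' <= 1 by rewrite -expR0 ler_expR.
have h5 := expR_gt0 s'.
rewrite (gtr0_norm h5) (gtr0_norm r0) mulrDr; apply: lerD.
  by rewrite mulrC; apply: ler_pM; rewrite ?N_ge0.
rewrite -[leRHS]mul1r; apply: ler_pM; rewrite ?N_ge0//.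
  by apply: mulr_ge0; exact: ltW.
by have := r1; have := r0; nra.
Qed.

(** The integral of [g dw/(w - a)] along the image under [homot] of the boundary of the rectangle.
    Since [homot s t - a] is [exp s] times [circ t - a], the form [dw/(w - a)] is [ds + cker t dt],
    which is why only the sides in [t] carry a kernel. *)
Definition rect_bd (g : R -> R -> C) (x1 x2 y1 y2 : R) : C :=
  cintegral `[x1, x2] (fun s => g s y1) - cintegral `[x1, x2] (fun s => g s y2)
  + (cintegral `[y1, y2] (fun t => cker t * g x2 t) - cintegral `[y1, y2] (fun t => cker t * g x1 t)).

Definition ct2 (g : R -> R -> C) := (forall s t, s <= 0 -> ct (fun s => g s t) s) /\
  (forall s t, s <= 0 -> ct (fun t => g s t) t).

Lemma rect_bd_add g x1 x2 y1 y2 x3 y3 : ct2 g -> x1 <= x3 -> x3 <= x2 -> x2 <= 0 ->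
  y1 <= y3 -> y3 <= y2 ->
  rect_bd g x1 x2 y1 y2 = rect_bd g x1 x3 y1 y3 + rect_bd g x3 x2 y1 y3 + rect_bd g x1 x3 y3 y2 + rect_bd g x3 x2 y3 y2.
Proof.
move=> [g1 g2] h1 h2 h3 h4 h5.
have H1 y : cintegral `[x1, x2] (fun s => g s y) = cintegral `[x1, x3] (fun s => g s y) + cintegral `[x3, x2] (fun s => g s y).
  by apply: cint_cat => [|x hx]; [rewrite h1 h2|apply: g1; lra].
have H2 x : x <= 0 -> cintegral `[y1, y2] (fun t => cker t * g x t) =
    cintegral `[y1, y3] (fun t => cker t * g x t) + cintegral `[y3, y2] (fun t => cker t * g x t).
  move=> x0; apply: cint_cat => [|y hy]; first by rewrite h4 h5.
  by apply: ctM; [exact: ct_cker|exact: g2].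
rewrite /rect_bd !H1 !H2 //; last by apply: le_trans h2 h3 || exact: le_trans h1 (le_trans h2 h3).
by do ? (move: (cintegral _ _) => ?); ring.
Qed.

Lemma rect_bd_lin g h (c : C) x1 x2 y1 y2 : ct2 g -> ct2 h -> x1 <= x2 -> x2 <= 0 -> y1 <= y2 ->
  rect_bd (fun s t => g s t + c * h s t) x1 x2 y1 y2 = rect_bd g x1 x2 y1 y2 + c * rect_bd h x1 x2 y1 y2.
Proof.
move=> [g1 g2] [h1 h2] x12 x20 y12.
have m1 (p q : R) : measurable (`[p, q]%classic : set (measurableTypeR R)) by [].
have I1 (k : R -> R -> C) (k1 : forall s t, s <= 0 -> ct (fun s => k s t) s) y :
   cintegrable `[x1, x2] (fun s => k s y).
  by apply: ct_cintegrable => x hx; apply: k1; lra.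
have I2 (k : R -> R -> C) (k2 : forall s t, s <= 0 -> ct (fun t => k s t) t) x : x <= 0 ->
   cintegrable `[y1, y2] (fun t => cker t * k x t).
  by move=> x0; apply: ct_cintegrable => y hy; apply: ctM; [exact: ct_cker|exact: k2].
have H1 y : cintegral `[x1, x2] (fun s => g s y + c * h s y) =
    cintegral `[x1, x2] (fun s => g s y) + c * cintegral `[x1, x2] (fun s => h s y).
  rewrite cintD// ?cintZ//; first exact: I1.
  - exact: I1.
  - by apply: cintegrableZ => //; exact: I1.
have H2 x : x <= 0 -> cintegral `[y1, y2] (fun t => cker t * (g x t + c * h x t)) =
    cintegral `[y1, y2] (fun t => cker t * g x t) + c * cintegral `[y1, y2] (fun t => cker t * h x t).
  move=> x0; rewrite -cintZ//; last exact: I2.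
  rewrite -cintD//.
  - by congr cintegral; apply/funext => t; ring.
  - exact: I2.
  - by apply: cintegrableZ => //; exact: I2.
rewrite /rect_bd !H1 !H2 //; last by apply: le_trans x20.
by do ? (move: (cintegral _ _) => ?); ring.
Qed.

Lemma rect_bd_cst x1 x2 y1 y2 : rect_bd (fun _ _ => 1) x1 x2 y1 y2 = 0.
Proof. by rewrite /rect_bd !subrr addr0. Qed.

(** For [g = w - a] the form [g dw/(w - a)] is [dw], which is exact. *)
Lemma rect_bd_homot x1 x2 y1 y2 : x1 <= x2 -> y1 <= y2 -> rect_bd (fun s t => homot s t - a) x1 x2 y1 y2 = 0.
Proof.
move=> x12 y12.
have m1 (p q : R) : measurable (`[p, q]%classic : set (measurableTypeR R)) by [].
pose J := cintegral `[x1, x2] (fun s => (expR s)%:C : C).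
have HJ : J = (expR x2)%:C - (expR x1)%:C.
  rewrite /J; apply: (cint_FTC (F := fun s => (expR s)%:C : C)) => //.
    by move=> x _ /=; split; [exact: is_derive_expR|exact: is_derive_cst].
  by move=> x _; apply: ct_RC; exact: continuous_expR.
have H1 y : cintegral `[x1, x2] (fun s => homot s y - a) = (circ y - a) * J.
  rewrite -cintZ//; last first.
    by apply: ct_cintegrable => x _; apply: ct_RC; exact: continuous_expR.
  by congr cintegral; apply/funext => s; rewrite /homot; ring.
have dw x : is_derive x (1 : R) (fun x => Rex (circ x)) (Rex (ic * circ x)) /\
    is_derive x (1 : R) (fun x => Imx (circ x)) (Imx (ic * circ x)).
  have Rw t : Rex (circ t) = r * cos t by rewrite /circ cReRM Re_cis.
  have Iw t : Imx (circ t) = r * sin t by rewrite /circ cImRM Im_cis.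
  rewrite (cReM ic) (cImM ic) Rw Iw (funext Rw) (funext Iw) /= !mul0r !mul1r sub0r add0r -mulrN.
  split; first exact: (is_deriveZ r (is_derive_cos x)).
  exact: (is_deriveZ r (is_derive_sin x)).
have H2 x : cintegral `[y1, y2] (fun t => cker t * (homot x t - a)) = (expR x)%:C * (circ y2 - circ y1).
  rewrite -(cint_FTC y12 (fun x _ => dw x)); last first.
    by move=> t _; apply: ctM; [exact: ct_cst|exact: ct_circ].
  rewrite -cintZ//; last first.
    by apply: ct_cintegrable => t _; apply: ctM; [exact: ct_cst|exact: ct_circ].
  congr cintegral; apply/funext => t; rewrite /cker /homot.
  by rewrite addrAC subrr add0r mulrCA divfK ?circ_neq.
by rewrite /rect_bd !H1 !H2 HJ; ring.
Qed.

Lemma rect_bd_small g (M : R) x1 x2 y1 y2 : ct2 g -> x1 <= x2 -> x2 <= 0 -> y1 <= y2 -> 0 <= M ->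
  (forall s t, x1 <= s <= x2 -> y1 <= t <= y2 -> N (g s t) <= M) ->
  N (rect_bd g x1 x2 y1 y2) <= 4 * (1 + cker_bound) * M * ((x2 - x1) + (y2 - y1)).
Proof.
move=> [g1 g2] x12 x20 y12 M0 hM.
have H1 y : y1 <= y <= y2 -> N (cintegral `[x1, x2] (fun s => g s y)) <= 2 * M * (x2 - x1).
  by move=> hy; apply: cint_norm => // s hs; [apply: g1; lra|exact: hM].
have H2 x : x1 <= x <= x2 -> N (cintegral `[y1, y2] (fun t => cker t * g x t)) <= 2 * (cker_bound * M) * (y2 - y1).
  move=> hx; apply: cint_norm => // t ht.
    by apply: ctM; [exact: ct_cker|apply: g2; lra].
  by rewrite NM; apply: ler_pM; rewrite ?N_ge0 ?N_cker ?hM.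
have b1 := H1 y1 ltac:(by rewrite lexx y12); have b2 := H1 y2 ltac:(by rewrite lexx y12).
have b3 := H2 x1 ltac:(by rewrite lexx x12); have b4 := H2 x2 ltac:(by rewrite lexx x12).
apply: le_trans (ND _ _) _.
apply: le_trans (lerD (NB _ _) (NB _ _)) _.
have Bp := cker_bound_gt0.
have p1 : 0 <= M * (y2 - y1) by rewrite mulr_ge0 ?subr_ge0.
have p2 : 0 <= cker_bound * (M * (x2 - x1)).
  by apply: mulr_ge0; [exact: ltW|rewrite mulr_ge0 ?subr_ge0].
lra.
Qed.

Definition fhom s t := f (homot s t).

Lemma ct2_homot : ct2 homot.
Proof. by split => s t _; [exact: ct_homot_l|exact: ct_homot_r]. Qed.
Lemma ct2_fhom : ct2 fhom.
Proof.
split => s t s0; have [l hl] := fder (le_lt_trans (N_homot t s0) r1).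
  exact: (ct_cder (@ct_homot_l s t) hl).
exact: (ct_cder (@ct_homot_r s t) hl).
Qed.
Lemma ct2_lin g h (c : C) : ct2 g -> ct2 h -> ct2 (fun s t => g s t + c * h s t).
Proof.
move=> [g1 g2] [h1 h2]; split => s t s0.
  by apply: ctD; [exact: g1|apply: ctM; [exact: ct_cst|exact: h1]].
by apply: ctD; [exact: g2|apply: ctM; [exact: ct_cst|exact: h2]].
Qed.
Lemma ct2_cst (c : C) : ct2 (fun _ _ => c).
Proof. by split => s t _; exact: ct_cst. Qed.

(** Goursat: near [(x, y)] replace [f] by its first-order expansion at [homot x y]. Its affine part
    is a combination of 1 and [w - a], whose boundary integrals vanish, and the remainder [er] is
    small compared with the size of the rectangle. The point [a] is never reached, because [expR s]
    is positive. *)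
Lemma rect_bd_fhom x1 y1 y2 : x1 <= 0 -> y1 <= y2 -> rect_bd fhom x1 0 y1 y2 = 0.
Proof.
move=> x10 y12; apply: bisection_eq0 => //.
  by move=> p1 p2 q1 q2 h1 h2 h3 h4 h5 h6; apply: rect_bd_add => //; [exact: ct2_fhom|lra..].
move=> x y hx hy e e0.
have x0 : x <= 0 by case/andP: hx.
have [l hl] := fder (le_lt_trans (N_homot y x0) r1).
have Bp := cker_bound_gt0; have B8 : 0 < 8 * (1 + cker_bound) by lra.
(* This cancels the factor [4 (1 + cker_bound)] of [rect_bd_small] and the Lipschitz constant 2 of
   [homot]. *)
pose eta := e / (8 * (1 + cker_bound)).
have eta0 : 0 < eta by rewrite divr_gt0.
have [d d0 hd] := hl _ eta0.
(* [homot] moves by at most twice the sum of the side lengths, hence by less than [d]. *)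
exists (d / 4); first by lra.
move=> p1 p2 q1 q2 hp1 hp2 hq1 hq2 hp hq.
pose er s t := fhom s t - f (homot x y) - l * (homot s t - homot x y).
pose c := f (homot x y) - l * (homot x y - a).
have er2 : ct2 er.
  have -> : er = fun s t => (fhom s t + (- l) * homot s t) + 1 * (l * homot x y - f (homot x y)).
    by apply/funext => s; apply/funext => t; rewrite /er; ring.
  apply: ct2_lin; last exact: ct2_cst.
  by apply: ct2_lin; [exact: ct2_fhom|exact: ct2_homot].
have za2 : ct2 (fun s t => homot s t - a).
  have -> : (fun s t => homot s t - a) = fun s t => homot s t + (-1) * a.
    by apply/funext => s; apply/funext => t; ring.
  by apply: ct2_lin; [exact: ct2_homot|exact: ct2_cst].
have -> : rect_bd fhom p1 p2 q1 q2 = rect_bd er p1 p2 q1 q2.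
  have -> : fhom = (fun s t => (er s t + l * (homot s t - a)) + c * 1).
    by apply/funext => s; apply/funext => t; rewrite /er /c; ring.
  have p12 : p1 <= p2 by lra.
  have p20 : p2 <= 0 by lra.
  have q12 : q1 <= q2 by lra.
  rewrite (rect_bd_lin c (ct2_lin l er2 za2) (ct2_cst 1) p12 p20 q12).
  by rewrite (rect_bd_lin l er2 za2 p12 p20 q12) rect_bd_cst (rect_bd_homot p12 q12) !mulr0 !addr0.
set S := (p2 - p1) + (q2 - q1).
have S0 : 0 <= S by rewrite /S; lra.
have -> : e * S ^+ 2 = 4 * (1 + cker_bound) * (2 * eta * S) * S.
  by rewrite /eta; field; rewrite gt_eqF//; lra.
apply: rect_bd_small => //; try lra.
  by rewrite mulr_ge0//; lra.
move=> s t hs ht.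
have hz : N (homot s t - homot x y) <= 2 * S.
  apply: le_trans (homot_Lip _ _ _ _) _ => //; first lra.
  rewrite ler_pM2l//; apply: lerD; rewrite ler_norml; lra.
apply: le_trans (hd _ _) _; first by apply: le_lt_trans hz _; rewrite /S; lra.
have -> : 2 * eta * S = eta * (2 * S) by ring.
by rewrite ler_pM2l.
Qed.

(** On the rectangle [[s, 0] x [0, 2 pi]] the sides [t = 0] and [t = 2 pi] cancel because the circle
    closes up, so the integral is the same on every contracted circle; as [s] tends to minus
    infinity [f] tends to [f a] there. The integral of [cker] is kept as a factor; its value follows
    later from the case [f = 1] of the series expansion. *)
Lemma cauchy_cint : cintegral `[0, 2 * pi] (fun t => cker t * f (circ t)) =
  f a * cintegral `[0, 2 * pi] cker.
Proof.
have pi0 := pi_ge0 R; have pi2 : 0 <= 2 * pi :> R by lra.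
have m1 : measurable (`[0, 2 * pi]%classic : set (measurableTypeR R)) by [].
have ze0 t : homot 0 t = circ t by rewrite /homot expR0 mul1r addrC subrK.
have G s : s <= 0 -> cintegral `[0, 2 * pi] (fun t => cker t * f (circ t)) =
   cintegral `[0, 2 * pi] (fun t => cker t * fhom s t).
  move=> s0; have := rect_bd_fhom s0 pi2; rewrite /rect_bd.
  have -> : (fun s => fhom s 0) = (fun s => fhom s (2 * pi)).
    by apply/funext => p; rewrite /fhom /homot /circ cis2pi cis0.
  rewrite subrr add0r => /eqP; rewrite subr_eq0 => /eqP <-.
  by congr cintegral; apply/funext => t; rewrite /fhom ze0.
apply/eqP; rewrite -subr_eq0 -N_eq0; apply/negPn/negP => H0.
set T := N _ in H0; have T0 : 0 < T by rewrite lt_neqAle eq_sym H0 N_ge0.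
have Bp := cker_bound_gt0.
pose e := T / (4 * cker_bound * (2 * pi + 1)).
have D0 : 0 < 4 * cker_bound * (2 * pi + 1) by rewrite !mulr_gt0//; lra.
have e0 : 0 < e by rewrite divr_gt0.
have [l hl] := fder (lt_trans ar r1).
have [d d0 hd] := cder_cont hl e0.
(* [expR s <= d / 4] and [N (circ t - a) <= 2] put the contracted circle within [d / 2] of [a]; the
   minimum with 0 keeps it inside the disc. *)
pose s := Num.min 0 (ln (d / 4)).
have s0 : s <= 0 by rewrite ge_min lexx.
have es : expR s <= d / 4.
  rewrite -[leRHS]lnK ?posrE; last by lra.
  by rewrite ler_expR ge_min lexx orbT.
have cF : forall t, 0 <= t <= 2 * pi -> ct (fun t => cker t * fhom s t) t.
  by move=> t _; apply: ctM; [exact: ct_cker|exact: ct2_fhom.2].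
have cb : forall t, 0 <= t <= 2 * pi -> ct (fun t => f a * cker t) t.
  by move=> t _; apply: ctM; [exact: ct_cst|exact: ct_cker].
suff : T <= 2 * (cker_bound * e) * (2 * pi - 0).
  have -> : 2 * (cker_bound * e) * (2 * pi - 0) = T * (4 * pi * cker_bound) / (4 * cker_bound * (2 * pi + 1)).
    by rewrite /e subr0; ring.
  rewrite ler_pdivlMr// ler_pM2l//; nra.
rewrite /T (G _ s0) -cintZ//; last first.
  by apply: ct_cintegrable => t _; exact: ct_cker.
rewrite -(cintB m1 (ct_cintegrable cF) (ct_cintegrable cb)).
apply: (cint_norm pi2) => t ht.
  by apply: ctB; [exact: cF|exact: cb].
have -> : cker t * fhom s t - f a * cker t = cker t * (f (homot s t) - f a) by rewrite /fhom; ring.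
rewrite NM; apply: ler_pM; rewrite ?N_ge0 ?N_cker//.
apply: ltW; apply: hd.
have -> : homot s t - a = (expR s)%:C * (circ t - a) by rewrite /homot addrAC subrr add0r.
rewrite NM NR (gtr0_norm (expR_gt0 _)).
have := N_circ_le2 t; have := N_ge0 (circ t - a); have := expR_gt0 s; nra.
Qed.
End Cauchy.

(** * Power series *)

Section Taylor.
Variable R : realType.
Local Notation C := (R[i]^o).
Local Notation mu := (@lebesgue_measure R).
Local Notation I2pi := (`[0, 2 * pi]%classic : set R).

Lemma geo_small (M th e : R) : 0 <= th < 1 -> 0 < e -> exists n, M * th ^+ n < e.
Proof.
move=> /andP[t0 t1] e0.
have M0 : 0 < `|M| + 1 by rewrite ltr_wpDl.
have h : (fun n => th ^+ n) @ \oo --> (0 : R) by apply: cvg_expr; rewrite ger0_norm.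
move/cvgrPdist_lt : h => /(_ (e / (`|M| + 1)) ltac:(by rewrite divr_gt0)) [n _ /(_ n (leqnn n))] /=.
rewrite sub0r normrN ger0_norm ?exprn_ge0// ltr_pdivlMr// => hn.
exists n; apply: le_lt_trans hn.
have := exprn_ge0 n t0; have := ler_norm M; nra.
Qed.
Lemma geo_le0 (M th x : R) : 0 <= th < 1 -> (forall n, x <= M * th ^+ n) -> x <= 0.
Proof.
move=> ht h; rewrite leNgt; apply/negP => x0.
by have [n hn] := geo_small M ht x0; move: (lt_le_trans hn (h n)); rewrite ltxx.
Qed.
Lemma geo_le (M th x y : R) : 0 <= th < 1 -> (forall n, x <= y + M * th ^+ n) -> x <= y.
Proof.
move=> ht h; rewrite -subr_le0; apply: (@geo_le0 M th) => // n.
by rewrite lerBlDl.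
Qed.

Lemma cis_ray (n t : R) : cis (n * t) = cexp (t%:C * (n *i)).
Proof. by rewrite /cis; congr cexp; apply: Ceq; rewrite ?cReRM ?cImRM /= ?mulr0// mulrC. Qed.
Lemma ct_cisM (n t : R) : ct (fun t => cis (n * t)) t.
Proof.
have h : {for t, continuous (fun t => n * t)} by apply: cvgM; [exact: cvg_cst|exact: cvg_id].
exact: (cvg_comp _ _ h (@ct_cis R (n * t))).
Qed.
Lemma cint_cis0 (n : R) : n != 0 -> cis (n * (2 * pi)) = 1 ->
  cintegral I2pi (fun t => cis (n * t)) = 0.
Proof.
move=> n0 h1.
have pi0 := pi_ge0 R; have pi2 : 0 <= 2 * pi :> R by lra.
have m1 : measurable (I2pi : set (measurableTypeR R)) by [].
have z0 : (n *i) != 0 by apply/eqP => -[/eqP]; rewrite (negbTE n0).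
apply: (mulfI z0); rewrite mulr0 -cintZ//; last first.
  by apply: ct_cintegrable => t _; exact: ct_cisM.
rewrite (cint_FTC (F := fun t => cis (n * t)) pi2).
- by rewrite h1 mulr0 cis0 subrr.
- move=> x _.
  have e1 : (fun x => Rex (cis (n * x))) = (fun s : R => Rex (cexp (s%:C * (n *i)))).
    by apply/funext => s; rewrite cis_ray.
  have e2 : (fun x => Imx (cis (n * x))) = (fun s : R => Rex ((- ic R) * cexp (s%:C * (n *i)))).
    by apply/funext => s; rewrite cis_ray cReM cReN cImN oppr0 mul0r sub0r mulNr mul1r opprK.
  rewrite e1 e2 cis_ray; split.
    apply: is_derive_eq (cder_ray (cder_cexp (x%:C * n*i))) _.
    by rewrite [in RHS]mulrC.
  apply: is_derive_eq (cder_ray (f := fun z => - ic R * cexp z) (cderZ (- ic R) (cder_cexp (x%:C * n*i)))) _.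
  by rewrite !cReM !cImM !cReN !cImN /=; ring.
- move=> x _; apply: ctM; first exact: ct_cst.
  exact: ct_cisM.
Qed.
Lemma cis_nat2pi (n : nat) : cis (n%:R * (2 * pi)) = 1 :> C.
Proof. by elim: n => [|n IH]; rewrite ?mul0r ?cis0// -natr1 mulrDl mul1r cisD IH cis2pi mulr1. Qed.
Lemma cisX (t : R) n : cis t ^+ n = cis (n%:R * t).
Proof. by elim: n => [|n IH]; rewrite ?mul0r ?cis0// -natr1 mulrDl mul1r cisD -IH exprSr. Qed.
Lemma cisN (t : R) : cis (- t) = (cis t)^-1.
Proof. by rewrite /cis -cexpN; congr cexp; apply: Ceq => //=; rewrite oppr0. Qed.
Lemma cisNn (t : R) n : cis t ^- n = cis (- n%:R * t).
Proof. by rewrite cisX -cisN mulNr. Qed.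
Lemma cint_cisN n : cintegral I2pi (fun t => (cis t : C) ^- n) = if n == 0%N then (2 * pi)%:C else 0.
Proof.
have pi0 := pi_ge0 R; have pi2 : 0 <= 2 * pi :> R by lra.
case: eqP => [->|/eqP n0].
  have -> : (fun t : R => cis t ^- 0) = (fun _ => 1 : C) by apply/funext => t; rewrite expr0 invr1.
  by rewrite cint_cst// subr0 mulr1.
rewrite (funext (fun t => cisNn t n)) cint_cis0 ?oppr_eq0 ?pnatr_eq0//.
by rewrite mulNr cisN cis_nat2pi invr1.
Qed.
Lemma cint_cisP n : cintegral I2pi (fun t => (cis t : C) ^+ n) = if n == 0%N then (2 * pi)%:C else 0.
Proof.
have pi0 := pi_ge0 R; have pi2 : 0 <= 2 * pi :> R by lra.
case: eqP => [->|/eqP n0].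
  have -> : (fun t : R => cis t ^+ 0) = (fun _ => 1 : C) by apply/funext => t; rewrite expr0.
  by rewrite cint_cst// subr0 mulr1.
by rewrite (funext (fun t => cisX t n)) cint_cis0 ?oppr_eq0 ?pnatr_eq0// cis_nat2pi.
Qed.

Lemma ctX (F : R -> C) t n : ct F t -> ct (fun s => F s ^+ n) t.
Proof.
move=> h; elim: n => [|n IH]; first exact: ct_cst.
by rewrite (_ : (fun _ => _) = (fun s => F s * F s ^+ n)); [exact: ctM|apply/funext => s; rewrite exprS].
Qed.
Lemma ct_N (F : R -> C) t : ct F t -> {for t, continuous (fun s => N (F s))}.
Proof.
move=> /cvgCP h; apply/cvgrPdist_lt => e /h; apply: filterS => y; apply: le_lt_trans.
have h1 := ND (F t - F y) (F y); have h2 := ND (F y - F t) (F t).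
by rewrite subrK in h1; rewrite subrK in h2; rewrite ler_norml; rewrite NC in h1; lra.
Qed.

Lemma ct_bounded (F : R -> C) (a b : R) : a <= b -> (forall t, a <= t <= b -> ct F t) ->
  exists2 M, 0 <= M & forall t, a <= t <= b -> N (F t) <= M.
Proof.
move=> ab hF.
have [c _ hc] : exists2 c, c \in `[a, b]%R & forall t, t \in `[a, b]%R -> N (F t) <= N (F c).
  apply: (EVT_max (f := fun t => N (F t))) => //; apply: continuous_in_subspaceT => x; rewrite inE /= in_itv /= => hx.
  exact/ct_N/hF.
by exists (N (F c)); [exact: N_ge0|move=> t ht; apply: hc; rewrite in_itv].
Qed.

(* Expansions are expressed through geometric bounds on the remainders, so that
   infinite sums never occur. *)
Definition PSr (r : R) (c : nat -> R[i]) (f : C -> C) := exists M : R, forall n (z : R[i]),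
  N z <= r -> N (f z - \sum_(k < n) c k * z ^+ k) <= M * (N z / r) ^+ n.
Definition PS (c : nat -> R[i]) (f : C -> C) := forall r : R, 0 < r < 1 -> PSr r c f.

Lemma cint_sum D n (F : nat -> R -> C) :
  measurable (D : set (measurableTypeR R)) -> (forall k, cintegrable D (F k)) ->
  cintegrable D (fun t => \sum_(k < n) F k t) /\
  cintegral D (fun t => \sum_(k < n) F k t) = \sum_(k < n) cintegral D (F k).
Proof.
move=> mD h; elim: n => [|n [IH1 IH2]].
  have e : (fun t => \sum_(k < 0) F k t) = fun=> 0 :> R[i] by apply/funext => t; rewrite big_ord0.
  rewrite e big_ord0; split.
    by split; exact: integrable0.
  by apply: Ceq => /=; rewrite Rintegral_cst ?mul0r.
have e : (fun t => \sum_(k < n.+1) F k t) = fun t => \sum_(k < n) F k t + F n t.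
  by apply/funext => t; rewrite big_ord_recr.
by rewrite e big_ord_recr /= cintD// IH2; split => //; exact: cintegrableD.
Qed.

(** The Cauchy kernel is expanded as a finite geometric sum in [a / w], and the term left over
    carries the factor [(a / w)^n], which is the required remainder on [N a <= r < rho]. *)
Lemma cder_PSr (f : C -> C) (r rho : R) : (forall z, N z < 1 -> exists l, cder f z l) ->
  0 < r -> r < rho -> rho < 1 -> exists c, PSr r c f.
Proof.
move=> fder r0 rrho rho1.
have rho0 : 0 < rho by lra.
have pi0 := pi_gt0 R; have pi2 : 0 <= 2 * pi :> R by lra.
have m1 : measurable (I2pi : set (measurableTypeR R)) by [].
have Nwr t : N (circ rho t) = rho by exact: N_circ.
have cw (t : R) : ct (circ rho) t by exact: ct_circ.
have w0 t : circ rho t != 0 by rewrite -N_eq0 Nwr gt_eqF.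
have cwV n (t : R) : ct (fun t => circ rho t ^- n) t.
  by apply: ctV; [rewrite expf_neq0|exact: ctX].
have I1 n : cintegrable I2pi (fun t => circ rho t ^- n) by apply: ct_cintegrable => t _.
have fw (g : C -> C) (gd : forall z, N z < 1 -> exists l, cder g z l) (t : R) : ct (fun t => g (circ rho t)) t.
  have [l hl] := gd (circ rho t) ltac:(by rewrite Nwr).
  exact: (ct_cder (cw t) hl).
pose c (g : C -> C) k := ((2 * pi)^-1)%:C * cintegral I2pi (fun t => circ rho t ^- k * g (circ rho t)).
(* Stated for any [g]: the choice [g = 1] yields the value of the integral of [cker], after which
   [g = f] yields the expansion. *)
have main (g : C -> C) (gd : forall z, N z < 1 -> exists l, cder g z l) (r' : R) (r'0 : 0 < r') (r'rho : r' < rho) :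
  exists M : R, forall n (a : R[i]), N a <= r' ->
   N (cintegral I2pi (fun t => cker rho a t * g (circ rho t)) - ic R * (2 * pi)%:C * \sum_(k < n) c g k * a ^+ k) <= M * (N a / r') ^+ n.
  have [M M0 hM] := ct_bounded pi2 (fun t _ => fw g gd t).
  exists (2 * ((rho - r')^-1 * M) * (2 * pi)) => n a ar.
  have arho : N a < rho by lra.
  have cbg (t : R) : ct (fun t => cker rho a t * g (circ rho t)) t.
    by apply: ctM; [exact: ct_cker|exact: fw].
  have e1 t : cker rho a t = ic R * (\sum_(k < n) a ^+ k * circ rho t ^- k) + a ^+ n * (circ rho t ^- n * cker rho a t).
    have := circ_neq rho0 arho t; rewrite /cker; set W := circ rho t => wa.
    have W0 : W != 0 by exact: w0.
    have h : (W - a) * (\sum_(k < n) a ^+ k * W ^- k) = W - a ^+ n * W ^- n * W.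
      elim: n => [|n IH]; first by rewrite big_ord0 mulr0 expr0 invr1 !mul1r subrr.
      rewrite big_ord_recr /= mulrDr IH !exprS.
      by field; rewrite ?W0 ?expf_neq0.
    have -> : \sum_(k < n) a ^+ k * W ^- k = (W - a ^+ n * W ^- n * W) / (W - a).
      by rewrite -h mulrAC mulfV// mul1r.
    by field; rewrite ?W0 ?wa ?expf_neq0.
  have Igk k : cintegrable I2pi (fun t => a ^+ k * (circ rho t ^- k * g (circ rho t))).
    apply: cintegrableZ => //; apply: ct_cintegrable => t _.
    by apply: ctM; [exact: cwV|exact: fw].
  have [Is1 Is2] := cint_sum n m1 Igk.
  have cr (t : R) : ct (fun t => circ rho t ^- n * (cker rho a t * g (circ rho t))) t.
    by apply: ctM; [exact: cwV|exact: cbg].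
  have -> : cintegral I2pi (fun t => cker rho a t * g (circ rho t)) =
     ic R * \sum_(k < n) (a ^+ k * cintegral I2pi (fun t => circ rho t ^- k * g (circ rho t))) +
     a ^+ n * cintegral I2pi (fun t => circ rho t ^- n * (cker rho a t * g (circ rho t))).
    have -> : \sum_(k < n) (a ^+ k * cintegral I2pi (fun t => circ rho t ^- k * g (circ rho t))) =
       \sum_(k < n) cintegral I2pi (fun t => a ^+ k * (circ rho t ^- k * g (circ rho t))).
      apply: eq_bigr => k _; rewrite cintZ//; apply: ct_cintegrable => t _.
      by apply: ctM; [exact: cwV|exact: fw].
    rewrite -Is2 -(cintZ _ m1 Is1) -(cintZ _ m1 (ct_cintegrable (fun t _ => cr t))).
    rewrite -(cintD m1 (cintegrableZ _ m1 Is1) (cintegrableZ _ m1 (ct_cintegrable (fun t _ => cr t)))).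
    congr cintegral; apply/funext => t; rewrite {1}e1 mulrDl; congr (_ + _).
      by rewrite -mulrA mulr_suml; congr (_ * _); apply: eq_bigr => k _; rewrite mulrA.
    by rewrite -!mulrA.
  have -> : ic R * (2 * pi)%:C * (\sum_(k < n) c g k * a ^+ k) =
     ic R * \sum_(k < n) (a ^+ k * cintegral I2pi (fun t => circ rho t ^- k * g (circ rho t))).
    rewrite -mulrA; congr (_ * _); rewrite mulr_sumr; apply: eq_bigr => k _.
    have h : ((2 * pi)^-1)%:C * (2 * pi)%:C = 1 :> R[i].
      by rewrite -rmorphM /= mulVf// gt_eqF//; lra.
    rewrite /c; move: (cintegral _ _) => J; rewrite -[RHS]mul1r -h.
    by move: (_%:C) (_%:C) => T1 T2; ring.
  rewrite addrAC subrr add0r NM NX.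
  apply: le_trans (ler_wpM2l (exprn_ge0 _ (N_ge0 _)) (cint_norm (M := rho ^- n * ((rho - r')^-1 * M)) pi2 _ _)) _ => [t _|t ht|].
  - exact: cr.
  - rewrite NM (NM (cker _ _ _)) NV NX Nwr ler_pM2l ?invr_gt0 ?exprn_gt0//.
    apply: ler_pM; rewrite ?N_ge0 ?hM//.
    apply: le_trans (N_cker rho0 rho1 arho t) _; rewrite /cker_bound.
    by rewrite lef_pV2 ?posrE; lra.
  rewrite subr0.
  have -> : N a ^+ n * (2 * (rho ^- n * ((rho - r')^-1 * M)) * (2 * pi)) = 2 * ((rho - r')^-1 * M) * (2 * pi) * (N a / rho) ^+ n.
    by rewrite expr_div_n; ring.
  apply: ler_wpM2l.
    have q0 : 0 <= (rho - r')^-1 by rewrite invr_ge0; lra.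
    by apply: mulr_ge0; [apply: mulr_ge0 => //; exact: mulr_ge0|lra].
  have rr : N a / rho <= N a / r' by rewrite ler_wpM2l ?N_ge0// lef_pV2 ?posrE//; lra.
  by apply: lerXn2r => //; rewrite nnegrE divr_ge0 ?N_ge0//; exact: ltW.
(* The radius halfway between [r] and [rho] makes [N a / r2 < 1] also when [N a = r], so that the
   remainders tend to 0. *)
have [M1 hM1] := main (fun=> 1) (fun z _ => ex_intro _ 0 (cder_cst 1 z)) ((r + rho) / 2) ltac:(lra) ltac:(lra).
have [M hM] := main f fder r r0 rrho.
set r2 := (r + rho) / 2 in hM1; have r20 : 0 < r2 by rewrite /r2; lra.
have b2pi (a : R[i]) : N a <= r -> cintegral I2pi (cker rho a) = ic R * (2 * pi)%:C.
  move=> ar; have ar2 : N a < r2 by rewrite /r2; lra.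
  have th2 : 0 <= N a / r2 < 1.
    by apply/andP; split; [apply: divr_ge0; [exact: N_ge0|exact: ltW]|rewrite ltr_pdivrMr// mul1r].
  have e0 : cintegral I2pi (fun t => cker rho a t * 1) = cintegral I2pi (cker rho a).
    by congr cintegral; apply/funext => t; rewrite mulr1.
  apply/eqP; rewrite -subr_eq0 -N_eq0 -e0; apply/eqP/le_anti; rewrite N_ge0 andbT.
  apply: (geo_le0 (M := M1 * (N a / r2)) th2) => n.
  have := hM1 n.+1 a (ltW ar2).
  have -> : \sum_(k < n.+1) c (fun=> 1) k * a ^+ k = 1.
    rewrite big_ord_recl /= big1 ?addr0 => [|k _].
      rewrite expr0 mulr1 /c.
      have -> : (fun t => circ rho t ^- 0 * 1) = (fun t : R => cis t ^- 0 : C).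
        by apply/funext => t; rewrite !expr0 mulr1.
      rewrite cint_cisN /= -rmorphM /= mulVf// gt_eqF//; lra.
    rewrite /c; have -> : (fun t => circ rho t ^- lift ord0 k * 1) = (fun t : R => (rho%:C ^- lift ord0 k) * cis t ^- lift ord0 k).
      by apply/funext => t; rewrite mulr1 /circ exprMn invfM.
    rewrite cintZ//; last by apply: ct_cintegrable => t _; apply: ctV; [rewrite expf_neq0 ?cexp_neq0|apply: ctX; exact: ct_cis].
    by rewrite cint_cisN /= !mulr0 mul0r.
  by rewrite mulr1 exprS mulrA.
exists (c f); exists (M / (2 * pi)) => n a ar.
have := hM n a ar; rewrite (cauchy_cint rho0 rho1 _ fder); last by lra.
rewrite b2pi//.
have -> : f a * (ic R * (2 * pi)%:C) - ic R * (2 * pi)%:C * (\sum_(k < n) c f k * a ^+ k) =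
  (ic R * (2 * pi)%:C) * (f a - \sum_(k < n) c f k * a ^+ k) by rewrite mulrBr; ring.
have p0 : 0 < 2 * pi :> R by lra.
rewrite NM (NM (ic R)) Nic NR (gtr0_norm p0) mul1r.
by rewrite -ler_pdivlMl// mulrCA mulrA.
Qed.
End Taylor.

Local Arguments Normc.normc : simpl never.

Section PowerSeries.
Variable R : realType.
Local Notation C := (R[i]^o).
Implicit Types (c d : nat -> R[i]) (f g : C -> C) (z : R[i]).

Lemma PSr_M (r : R) c f : PSr r c f -> 0 < r -> exists2 M : R, 0 <= M & forall n (z : R[i]),
  N z <= r -> N (f z - \sum_(k < n) c k * z ^+ k) <= M * (N z / r) ^+ n.
Proof.
move=> [M hM] r0; exists M => //.
by have := hM 0%N 0; rewrite N0 expr0 mulr1 => /(_ (ltW r0)); apply: le_trans; exact: N_ge0.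
Qed.

(** Cauchy's estimate: [c n * r ^+ n] is the difference of two consecutive remainders at the point
    [r]. *)
Lemma PSr_coef (r : R) c f : 0 < r -> PSr r c f -> exists M : R, forall n, N (c n) * r ^+ n <= M.
Proof.
move=> r0 /PSr_M/(_ r0)[M M0 hM]; exists (2 * M) => n.
have nr : N r%:C = r by rewrite NR gtr0_norm.
have h k := hM k r%:C; have {}h k : N (f r%:C - \sum_(i < k) c i * r%:C ^+ i) <= M.
  by have := h k; rewrite nr lexx divff ?gt_eqF// expr1n mulr1; exact.
have -> : N (c n) * r ^+ n = N ((f r%:C - \sum_(i < n) c i * r%:C ^+ i) - (f r%:C - \sum_(i < n.+1) c i * r%:C ^+ i)).
  rewrite -{1}nr -NX -NM; congr (N _); rewrite big_ord_recr /=; move: (\sum_(_ < _) _) => S.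
  by rewrite -rmorphXn /=; ring.
apply: le_trans (NB _ _) _; have := h n; have := h n.+1; lra.
Qed.

Lemma PSr_at0 (r : R) c f : 0 < r -> PSr r c f -> f 0 = c 0%N.
Proof.
move=> r0 /PSr_M/(_ r0)[M M0 hM]; apply/eqP; rewrite -subr_eq0 -N_eq0; apply/eqP/le_anti; rewrite N_ge0 andbT.
have := hM 1%N 0; rewrite N0 big_ord_recl big_ord0 expr0 mulr1 addr0 expr1 mul0r mulr0.
by apply; exact: ltW.
Qed.

Lemma PSr_shift (r : R) c f : 0 < r -> PSr r c f ->
  PSr r (fun n => c n.+1) (fun z => if z == 0 then c 1%N else (f z - c 0%N) / z).
Proof.
move=> r0 /PSr_M/(_ r0)[M M0 hM]; exists (M / r + N (c 1%N)) => n z zr.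
have [->|z0] := eqVneq z 0.
  case: n => [|n].
    by rewrite big_ord0 subr0 N0 mul0r expr0 mulr1 lerDr divr_ge0// ltW.
  rewrite big_ord_recl /= big1 ?expr0 ?mulr1 ?addr0 ?subrr.
    by rewrite !N0 mul0r exprS mul0r mulr0.
  by move=> i _; rewrite exprS mul0r mulr0.
have Nz : 0 < N z by rewrite N_gt0.
have -> : (f z - c 0%N) / z - \sum_(k < n) c k.+1 * z ^+ k = (f z - \sum_(k < n.+1) c k * z ^+ k) / z.
  rewrite big_ord_recl /= expr0 mulr1 opprD addrA [RHS]mulrBl; congr (_ - _).
  rewrite mulr_suml; apply: eq_bigr => k _; rewrite exprS; field.
  by [].
rewrite NM NV ler_pdivrMr//; apply: le_trans (hM _ _ zr) _.
rewrite exprS mulrDl mulrDl [leLHS](_ : _ = M / r * (N z / r) ^+ n * N z); last by ring.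
by rewrite lerDl mulr_ge0 ?N_ge0// mulr_ge0 ?N_ge0// exprn_ge0// divr_ge0 ?N_ge0// ltW.
Qed.

(** The constant coefficient is the limit of [f] at 0 along nonzero points; the others follow by
    induction through [PSr_shift]. Agreement is required only for [z != 0], since the shift divides
    by [z] and since [Hform] is known only off 0. *)
Lemma PSr_uniq (r r' d : R) c c' f f' : 0 < r -> 0 < r' -> 0 < d -> PSr r c f -> PSr r' c' f' ->
  (forall z, z != 0 -> N z < d -> f z = f' z) -> c =1 c'.
Proof.
move=> r0 r'0 d0.
have IH0 e e' g g' : PSr r e g -> PSr r' e' g' -> (forall z, z != 0 -> N z < d -> g z = g' z) -> e 0%N = e' 0%N.
  move: e e' g g' => {c c' f f'} c c' f f' hf hf' ff'.
  have [M M0 hM] := PSr_M hf r0; have [M' M'0 hM'] := PSr_M hf' r'0.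
  apply/eqP; rewrite -subr_eq0 -N_eq0; apply/negPn/negP => h0.
  set T := N _ in h0; have T0 : 0 < T by rewrite lt_neqAle eq_sym h0 N_ge0.
  pose K := M / r + M' / r' + 1.
  have K0 : 0 < K by rewrite ltr_wpDl// addr_ge0// divr_ge0// ltW.
  pose s := Num.min (Num.min (r / 2) (r' / 2)) (Num.min (d / 2) (T / K / 2)).
  have s0 : 0 < s.
    by rewrite /s !lt_min !divr_gt0.
  have [s1 [s2 [s3 s4]]] : s <= r / 2 /\ s <= r' / 2 /\ s <= d / 2 /\ s <= T / K / 2.
    by rewrite /s !ge_min !lexx /= !orbT.
  have ns : N s%:C = s by rewrite NR gtr0_norm.
  have := hM 1%N s%:C; have := hM' 1%N s%:C.
  rewrite ns !big_ord_recl !big_ord0 !expr0 !mulr1 !addr0 !expr1 -(ff' s%:C); last 2 first.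
  - by rewrite -N_eq0 ns gt_eqF.
  - by rewrite ns; lra.
  move=> /(_ ltac:(lra)) h1 /(_ ltac:(lra)) h2.
  have h3 : T <= M * (s / r) + M' * (s / r').
    apply: le_trans (lerD h2 h1).
    have -> : T = N ((f s%:C - c 0%N) - (f s%:C - c' 0%N)) by rewrite /T NC; congr (N _); ring.
    exact: NB.
  have : T < T; last by rewrite ltxx.
  apply: le_lt_trans h3 _; apply: (@le_lt_trans _ _ (s * K)).
    have -> : M * (s / r) + M' * (s / r') = s * (M / r + M' / r') by ring.
    by rewrite ler_pM2l// lerDl.
  by rewrite -ltr_pdivlMr//; apply: le_lt_trans s4 _; rewrite ltr_pdivrMr// mulr_natr mulr2n ltrDl divr_gt0.
move=> hf hf' ff' n; elim: n c c' f f' hf hf' ff' => [|n IH] c c' f f' hf hf' ff'.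
  exact: IH0 hf hf' ff'.
have c0 : c 0%N = c' 0%N.
  exact: IH0 hf hf' ff'.
apply: (IH (fun n => c n.+1) (fun n => c' n.+1) _ _ (PSr_shift r0 hf) (PSr_shift r'0 hf')).
by move=> z z0 zd; rewrite (negbTE z0) ff'// c0.
Qed.

(** The coefficients found for the radius 1/2 serve every radius, because coefficients are
    unique. *)
Lemma cder_PS f : (forall z, N z < 1 -> exists l, cder f z l) -> exists c, PS c f.
Proof.
move=> fder.
have H (r : R) : 0 < r < 1 -> exists c, PSr r c f.
  by move=> /andP[r0 r1]; apply: (cder_PSr (rho := (r + 1) / 2) fder) => //; lra.
pose q : R := 2^-1; have h2 : 0 < q < 1 by rewrite /q; lra.
have [c hc] := H _ h2; exists c => r r01; have [c' hc'] := H r r01.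
have r0 : 0 < r by case/andP: r01.
have -> : c = c'; last by [].
apply/funext; apply: (PSr_uniq (d := 1) _ r0 ltr01 hc hc') => //; lra.
Qed.

Lemma PS_uniq c c' f f' (d : R) : 0 < d -> PS c f -> PS c' f' ->
  (forall z, z != 0 -> N z < d -> f z = f' z) -> c = c'.
Proof.
move=> d0 hc hc' ff'; pose q : R := 2^-1; have h2 : 0 < q < 1 by rewrite /q; lra.
by apply/funext; apply: (PSr_uniq _ _ d0 (hc _ h2) (hc' _ h2) ff'); lra.
Qed.

Lemma PS_fun_uniq c f f' z : PS c f -> PS c f' -> N z < 1 -> f z = f' z.
Proof.
move=> h h' z1; pose r := (1 + N z) / 2; have nz := N_ge0 z.
have r01 : 0 < r < 1 by rewrite /r; lra.
have [M hM] := h r r01; have [M' hM'] := h' r r01.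
apply/eqP; rewrite -subr_eq0 -N_eq0; apply/eqP/le_anti; rewrite N_ge0 andbT.
have th : 0 <= N z / r < 1.
  by apply/andP; split; [apply: divr_ge0 => //|rewrite ltr_pdivrMr]; rewrite /r; lra.
apply: (geo_le0 (M := M + M') th) => n.
have zr : N z <= r by rewrite /r; lra.
have := hM n z zr; have := hM' n z zr; set S := \sum_(_ < _) _ => h1 h2.
rewrite mulrDl; apply: le_trans (lerD h2 h1).
by have -> : f z - f' z = (f z - S) - (f' z - S); [ring|exact: NB].
Qed.

Lemma PS_id c f f' : PS c f -> (forall z, N z < 1 -> f z = f' z) -> PS c f'.
Proof.
by move=> h e r r01; have [M hM] := h r r01; exists M => n z zr; rewrite -e ?hM//; lra.
Qed.

(** Radius of convergence at least 1; equivalent to being the coefficients of some [PS]. *)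
Definition cgrow c := forall r : R, 0 < r < 1 -> exists M : R, forall n, N (c n) * r ^+ n <= M.

Lemma PS_cgrow c f : PS c f -> cgrow c.
Proof. by move=> h r /andP[r0 r1]; apply: (PSr_coef (f := f) r0); apply: h; rewrite r0. Qed.

(** For real sequences the limit is the supremum of the lower bounds [v m - K th^m], each of which
    lies below every upper bound. The factor 2 adds the real and imaginary parts. *)
Lemma cauchy_geo (u : nat -> R[i]) (K th : R) : 0 <= th -> 0 <= K ->
  (forall n m, (n <= m)%N -> N (u m - u n) <= K * th ^+ n) ->
  exists l, forall n, N (l - u n) <= 2 * K * th ^+ n.
Proof.
move=> th0 K0 h.
have Kp n : 0 <= K * th ^+ n by rewrite mulr_ge0// exprn_ge0.
have H (v : nat -> R) : (forall n m, (n <= m)%N -> `|v m - v n| <= K * th ^+ n) ->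
    exists x, forall n, `|x - v n| <= K * th ^+ n.
  move=> hv.
  have ab m n : v m - K * th ^+ m <= v n + K * th ^+ n.
    have := Kp m; have := Kp n.
    by case: (leqP n m) => [/hv|/ltnW/hv]; rewrite ler_norml => /andP[h1 h2]; lra.
  exists (sup (range (fun m => v m - K * th ^+ m))) => n.
  rewrite ler_distl; apply/andP; split.
    apply: ub_le_sup; last by exists n.
    by exists (v 0%N + K * th ^+ 0) => _ [m _ <-]; exact: ab.
  apply: ge_sup; first by exists (v 0%N - K * th ^+ 0); exists 0%N.
  by move=> _ [m _ <-]; exact: ab.
have [x hx] := H (fun n => Rex (u n)) (fun n m nm => le_trans (eq_ind_r (fun t => `|t| <= _) (NRe _) (esym (etrans (cReD _ _) (congr1 _ (cReN _))))) (h n m nm)).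
have [y hy] := H (fun n => Imx (u n)) (fun n m nm => le_trans (eq_ind_r (fun t => `|t| <= _) (NIm _) (esym (etrans (cImD _ _) (congr1 _ (cImN _))))) (h n m nm)).
exists (x +i* y) => n; apply: le_trans (Nle _) _; rewrite cReD cReN cImD cImN /=.
have := hx n; have := hy n; lra.
Qed.

Lemma geo_sum_le (t : R) n m : 0 <= t < 1 -> (n <= m)%N ->
  \sum_(n <= k < m) t ^+ k <= t ^+ n / (1 - t).
Proof.
move=> /andP[t0 t1] nm; have t1' : 0 < 1 - t by lra.
rewrite ler_pdivlMr// mulrC.
have -> : (1 - t) * \sum_(n <= k < m) t ^+ k = t ^+ n - t ^+ m.
  rewrite big_distrr /= (eq_bigr (fun k => - (t ^+ k.+1 - t ^+ k))) => [|k _]; last by rewrite exprS; ring.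
  by rewrite sumrN telescope_sumr// opprB.
by rewrite gerBl exprn_ge0.
Qed.

Lemma psum_diff c z (n m : nat) : (n <= m)%N ->
  \sum_(k < m) c k * z ^+ k - \sum_(k < n) c k * z ^+ k = \sum_(n <= k < m) c k * z ^+ k.
Proof.
by move=> nm; rewrite -!(big_mkord xpredT (fun k => c k * z ^+ k)) (big_cat_nat _ nm)//= addrAC subrr add0r.
Qed.

Lemma psum_tail c z (r M : R) (n m : nat) : 0 < r -> N z < r -> (forall n, N (c n) * r ^+ n <= M) ->
  (n <= m)%N ->
  N (\sum_(k < m) c k * z ^+ k - \sum_(k < n) c k * z ^+ k) <= M / (1 - N z / r) * (N z / r) ^+ n.
Proof.
move=> r0 zr hM nm; rewrite psum_diff//; apply: le_trans (Nsum _ _ _) _.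
have th : 0 <= N z / r < 1.
  by apply/andP; split; [apply: divr_ge0; [exact: N_ge0|exact: ltW]|rewrite ltr_pdivrMr// mul1r].
have M0 : 0 <= M by apply: le_trans (hM 0%N); rewrite expr0 mulr1 N_ge0.
apply: (@le_trans _ _ (\sum_(n <= k < m) M * (N z / r) ^+ k)).
  apply: ler_sum => k _; rewrite NM NX expr_div_n.
  have -> : M * (N z ^+ k / r ^+ k) = (M / r ^+ k) * N z ^+ k by ring.
  apply: ler_wpM2r; first by rewrite exprn_ge0// N_ge0.
  by rewrite ler_pdivlMr ?exprn_gt0.
rewrite -big_distrr /= -mulrA; apply: ler_wpM2l => //.
by rewrite [leRHS]mulrC; exact: geo_sum_le.
Qed.

(** The sum is defined pointwise as a chosen limit of partial sums. For the bound on [N z <= r] the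
    coefficients are estimated at a larger radius [r'], so that the geometric tail has a ratio
    bounded away from 1. *)
Lemma PS_of_cgrow c : cgrow c -> exists f, PS c f.
Proof.
move=> hc.
pose lim z := [set l : R[i] | forall e : R, 0 < e -> exists n0, forall n, (n0 <= n)%N -> N (l - \sum_(k < n) c k * z ^+ k) < e].
pose f z := xget 0 (lim z).
have ex z : N z < 1 -> lim z (f z).
  move=> z1; apply: xgetPex.
  pose r := (1 + N z) / 2; have nz := N_ge0 z.
  have r0 : 0 < r by rewrite /r; lra.
  have zr : N z < r by rewrite /r; lra.
  have [M hM] := hc r ltac:(by rewrite r0 /r; lra).
  have th : 0 <= N z / r < 1.
    by apply/andP; split; [apply: divr_ge0 => //; exact: ltW|rewrite ltr_pdivrMr// mul1r].
  have M0 : 0 <= M by apply: le_trans (hM 0%N); rewrite expr0 mulr1 N_ge0.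
  have K0 : 0 <= M / (1 - N z / r) by apply: divr_ge0 => //; lra.
  have [l hl] := @cauchy_geo (fun n => \sum_(k < n) c k * z ^+ k) _ (N z / r) ltac:(by case/andP: th) K0
     (fun n m => @psum_tail c z r M n m r0 zr hM).
  exists l => e e0; have [n0 hn0] := geo_small (2 * (M / (1 - N z / r))) th e0.
  exists n0 => n nn0; apply: le_lt_trans (hl n) _; apply: le_lt_trans hn0.
  apply: ler_wpM2l; first by rewrite mulr_ge0.
  by case/andP: th => h0 h1; apply: ler_wiXn2l => //; exact: ltW.
exists f => r /andP[r0 r1]; pose r' := (1 + r) / 2.
have r'0 : 0 < r' by rewrite /r'; lra.
have rr' : r < r' by rewrite /r'; lra.
have [M hM] := hc r' ltac:(by rewrite r'0 /r'; lra).
have M0 : 0 <= M by apply: le_trans (hM 0%N); rewrite expr0 mulr1 N_ge0.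
exists (M / (1 - r / r')) => n z zr; have nz := N_ge0 z.
have zr' : N z < r' by lra.
have q1 : r / r' < 1 by rewrite ltr_pdivrMr// mul1r.
have le1 : N z / r' <= r / r' by rewrite ler_wpM2r// invr_ge0 ltW.
have le2 : N z / r' <= N z / r by rewrite ler_wpM2l// lef_pV2 ?posrE// ltW.
have q0 : 0 <= N z / r' by apply: divr_ge0 => //; exact: ltW.
have tail m : (n <= m)%N -> N (\sum_(k < m) c k * z ^+ k - \sum_(k < n) c k * z ^+ k) <= M / (1 - r / r') * (N z / r) ^+ n.
  move=> nm; apply: le_trans (psum_tail r'0 zr' hM nm) _; apply: ler_pM.
  - by apply: divr_ge0 => //; lra.
  - exact: exprn_ge0.
  - by apply: ler_wpM2l => //; rewrite lef_pV2 ?posrE; lra.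
  - by apply: lerXn2r => //; rewrite nnegrE// divr_ge0// ltW.
apply/ler_addgt0Pr => e e0.
have [n0 hn0] := ex z ltac:(lra) e e0.
have := hn0 (maxn n n0) (leq_maxr _ _); have := tail (maxn n n0) (leq_maxl _ _).
set S := \sum_(k < maxn n n0) _; set T := \sum_(k < n) _ => h1 h2.
have -> : f z - T = (f z - S) + (S - T) by ring.
by apply: le_trans (ND _ _) _; lra.
Qed.
End PowerSeries.

(** * Operations on power series and termwise differentiation *)

Section PowerSeriesCalculus.
Variable R : realType.
Local Notation C := (R[i]^o).
Implicit Types (c d : nat -> R[i]) (f g : C -> C) (z : R[i]).

Lemma PSD c d f g : PS c f -> PS d g -> PS (fun n => c n + d n) (fun z => f z + g z).
Proof.
move=> hf hg r r01; have [M hM] := hf r r01; have [M' hM'] := hg r r01.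
exists (M + M') => n z zr.
have -> : \sum_(k < n) (c k + d k) * z ^+ k = \sum_(k < n) c k * z ^+ k + \sum_(k < n) d k * z ^+ k.
  by rewrite -big_split /=; apply: eq_bigr => k _; rewrite mulrDl.
rewrite opprD addrACA mulrDl; apply: le_trans (ND _ _) _.
by apply: lerD; [exact: hM|exact: hM'].
Qed.
Lemma PSZ (a : R[i]) c f : PS c f -> PS (fun n => a * c n) (fun z => a * f z).
Proof.
move=> hf r r01; have [M hM] := hf r r01; exists (N a * M) => n z zr.
have -> : \sum_(k < n) a * c k * z ^+ k = a * \sum_(k < n) c k * z ^+ k.
  by rewrite mulr_sumr; apply: eq_bigr => k _; rewrite mulrA.
by rewrite -mulrBr NM -mulrA; apply: ler_wpM2l; [exact: N_ge0|exact: hM].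
Qed.
Lemma PS_cst (a : R[i]) : PS (fun n => if n == 0%N then a else 0) (fun=> a).
Proof.
move=> r /andP[r0 r1]; exists (N a) => n z zr; case: n => [|n].
  by rewrite big_ord0 subr0 expr0 mulr1.
rewrite big_ord_recl /= big1 ?expr0 ?mulr1 ?addr0 ?subrr; last by move=> i _; rewrite mul0r.
by rewrite N0 mulr_ge0 ?N_ge0// exprn_ge0// divr_ge0 ?N_ge0// ltW.
Qed.
Lemma PS_mulz c f : PS c f -> PS (fun n => if n is n'.+1 then c n' else 0) (fun z => z * f z).
Proof.
move=> hf r r01; have r0 : 0 < r by case/andP: r01.
have [M M0 hM] := PSr_M (hf r r01) r0; exists (M * r + N (f 0) + M + N (c 0%N)) => n z zr.
have Mr : N z <= r by [].
case: n => [|n].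
  rewrite big_ord0 subr0 expr0 mulr1 NM.
  have := hM 0%N z zr; rewrite big_ord0 subr0 expr0 mulr1 => h.
  have : N z * N (f z) <= r * M by apply: ler_pM; rewrite ?N_ge0.
  have := N_ge0 (f 0); have := N_ge0 (c 0%N); lra.
have -> : \sum_(k < n.+1) (if val k is n'.+1 then c n' else 0) * z ^+ k = z * \sum_(k < n) c k * z ^+ k.
  rewrite big_ord_recl /= mul0r add0r mulr_sumr; apply: eq_bigr => k _.
  by rewrite exprS mulrCA.
rewrite -mulrBr NM exprS.
apply: (@le_trans _ _ (N z * (M * (N z / r) ^+ n))).
  by apply: ler_wpM2l; [exact: N_ge0|exact: hM].
have -> : N z * (M * (N z / r) ^+ n) = (M * r) * (N z / r * (N z / r) ^+ n).
  by field; rewrite gt_eqF.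
apply: ler_wpM2r.
  have q : 0 <= N z / r by apply: divr_ge0; [exact: N_ge0|exact: ltW].
  by rewrite mulr_ge0// exprn_ge0.
have := N_ge0 (f 0); have := N_ge0 (c 0%N); lra.
Qed.

(** Each of the [n + 1] powers [t^k] with [k <= n] is at least [t^n], and they sum to at most
    [1/(1 - t)]. *)
Lemma nexp_bound (t : R) : 0 <= t < 1 -> exists2 K : R, 0 <= K & forall n : nat, n.+1%:R * t ^+ n <= K.
Proof.
move=> /andP[t0 t1]; exists (1 - t)^-1; first by rewrite invr_ge0; lra.
move=> n; have := @geo_sum_le R t 0 n.+1 ltac:(by rewrite t0) isT.
rewrite expr0 mul1r; apply: le_trans.
rewrite big_mkord mulr_natl -[n.+1 in X in X <= _]card_ord -sumr_const; apply: ler_sum => k _.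
by apply: ler_wiXn2l => //; [exact: ltW|rewrite -ltnS].
Qed.

Lemma cgrow_mul (a : nat -> R[i]) (K : R) c : (forall n, N (a n) <= K * n.+1%:R) -> cgrow c ->
  cgrow (fun n => a n * c n).
Proof.
move=> ha hc r /andP[r0 r1]; pose r' := (1 + r) / 2.
have r'0 : 0 < r' by rewrite /r'; lra.
have rr' : r < r' by rewrite /r'; lra.
have [M hM] := hc r' ltac:(by rewrite r'0 /r'; lra).
have M0 : 0 <= M by apply: le_trans (hM 0%N); rewrite expr0 mulr1 N_ge0.
have K0 : 0 <= K by have := ha 0%N; rewrite mulr1; apply: le_trans; exact: N_ge0.
have [B B0 hB] := @nexp_bound (r / r') ltac:(by apply/andP; split; [apply: divr_ge0; exact: ltW|rewrite ltr_pdivrMr// mul1r]).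
exists (K * B * M) => n; rewrite NM.
have -> : N (a n) * N (c n) * r ^+ n = N (a n) * (r / r') ^+ n * (N (c n) * r' ^+ n).
  by rewrite expr_div_n; field; rewrite expf_neq0// gt_eqF.
have q0 : 0 <= r / r' by apply: divr_ge0; exact: ltW.
apply: ler_pM => //.
- by rewrite mulr_ge0 ?N_ge0// exprn_ge0.
- by rewrite mulr_ge0 ?N_ge0// exprn_ge0// ltW.
apply: (@le_trans _ _ (K * n.+1%:R * (r / r') ^+ n)).
  by apply: ler_wpM2r => //; rewrite exprn_ge0.
by rewrite -mulrA; apply: ler_wpM2l.
Qed.
Lemma Nnat n : N (n%:R : R[i]) = n%:R.
Proof. by rewrite -(rmorph_nat (real_complex R)) /= NR ger0_norm. Qed.
Lemma cgrow_nat c : cgrow c -> cgrow (fun n => n%:R * c n).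
Proof. by apply: (@cgrow_mul _ 1) => n; rewrite Nnat mul1r ler_nat. Qed.
Lemma cgrow_shift c : cgrow c -> cgrow (fun n => c n.+1).
Proof.
move=> hc r r01; have r0 : 0 < r by case/andP: r01.
have [M hM] := hc r r01; exists (M / r) => n.
by rewrite ler_pdivlMr// -mulrA -exprSr.
Qed.

(** Second-order remainder of a power, by the recursion [Q (k+1) = w Q k + k z^(k-1) (w - z)^2]. The
    factor [r ^+ 2] on the left replaces a negative exponent on the right when [k < 2]. *)
Lemma diffq_bound (z w : R[i]) (r : R) k : N z <= r -> N w <= r ->
  N (w ^+ k - z ^+ k - k%:R * z ^+ k.-1 * (w - z)) * r ^+ 2 <= (k * k)%:R * r ^+ k * N (w - z) ^+ 2.
Proof.
move=> zr wr; have r0 : 0 <= r by apply: le_trans zr; exact: N_ge0.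
elim: k => [|k IH]; first by rewrite !expr0 subrr !mul0r subr0 N0 mul0r.
have -> : w ^+ k.+1 - z ^+ k.+1 - k.+1%:R * z ^+ k.+1.-1 * (w - z) =
   w * (w ^+ k - z ^+ k - k%:R * z ^+ k.-1 * (w - z)) + (k%:R * z ^+ k.-1) * ((w - z) ^+ 2).
  case: k {IH} => [|k] /=; first by rewrite !expr1 !expr0; ring.
  by rewrite !exprS -(natr1 k.+1); ring.
set Q := _ - _ in IH *.
apply: (@le_trans _ _ (r * (N Q * r ^+ 2) + k%:R * r ^+ k.+1 * N (w - z) ^+ 2)).
  apply: (@le_trans _ _ ((N w * N Q + N (k%:R * z ^+ k.-1 * (w - z) ^+ 2)) * r ^+ 2)).
    apply: ler_wpM2r; first by rewrite exprn_ge0.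
    by apply: le_trans (ND _ _) _; rewrite (NM w).
  rewrite mulrDl -mulrA; apply: lerD.
    by apply: ler_wpM2r => //; rewrite mulr_ge0 ?N_ge0 ?exprn_ge0.
  rewrite (NM _ (_ ^+ 2)) (NM k%:R) Nnat !NX.
  case: k {IH Q} => [|k]; first by rewrite !mul0r.
  have -> : k.+1%:R * N z ^+ k.+1.-1 * N (w - z) ^+ 2 * r ^+ 2 = k.+1%:R * N (w - z) ^+ 2 * r ^+ 2 * N z ^+ k.
    by rewrite /=; ring.
  have -> : k.+1%:R * r ^+ k.+2 * N (w - z) ^+ 2 = k.+1%:R * N (w - z) ^+ 2 * r ^+ 2 * r ^+ k.
    by rewrite !exprS; ring.
  apply: ler_wpM2l.
    by do !apply: mulr_ge0; rewrite ?exprn_ge0 ?N_ge0.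
  by apply: lerXn2r; rewrite ?nnegrE ?N_ge0.
apply: (@le_trans _ _ (r * ((k * k)%:R * r ^+ k * N (w - z) ^+ 2) + k%:R * r ^+ k.+1 * N (w - z) ^+ 2)).
  by rewrite lerD2r; apply: ler_wpM2l.
have -> : r * ((k * k)%:R * r ^+ k * N (w - z) ^+ 2) + k%:R * r ^+ k.+1 * N (w - z) ^+ 2
   = (k * k + k)%:R * (r ^+ k.+1 * N (w - z) ^+ 2) by rewrite [r ^+ k.+1]exprS natrD natrM; ring.
rewrite -mulrA; apply: ler_wpM2r.
  by apply: mulr_ge0; rewrite exprn_ge0 ?N_ge0.
by rewrite ler_nat mulSn mulnS [(k + _)%N]addnC leq_addl.
Qed.

(** The first-order remainder of [f] is split into those of the monomials, bounded together by
    [K |w - z|^2] uniformly in [n], and three tails that are geometrically small in [n]; then [n]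
    tends to infinity. *)
Lemma PS_der c f : PS c f -> exists2 f1 : C -> C, PS (fun n => n.+1%:R * c n.+1) f1 &
  forall z, N z < 1 -> cder f z (f1 z).
Proof.
move=> hf; have hc := PS_cgrow hf.
have hc1 := cgrow_nat hc.
have [f1 hf1] := PS_of_cgrow (cgrow_shift hc1); exists f1 => // z z1 e e0.
pose r := (1 + N z) / 2; pose r' := (1 + r) / 2.
have nz := N_ge0 z.
have r0 : 0 < r by rewrite /r; lra.
have rr' : r < r' by rewrite /r' /r; lra.
have zr : N z < r by rewrite /r; lra.
have r1 : r' < 1 by rewrite /r' /r; lra.
have r'0 : 0 < r' by lra.
clearbody r'; clearbody r.
have hc2 : cgrow (fun n => n%:R * (n%:R * c n)) by exact: cgrow_nat.
have [M hM] := hc2 r' ltac:(by rewrite r'0 r1).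
have M0 : 0 <= M by apply: le_trans (hM 0%N); rewrite expr0 mulr1 N_ge0.
have [M1 M10 hM1] := PSr_M (hf r' ltac:(by rewrite r'0 r1)) r'0.
have [M2 M20 hM2] := PSr_M (hf1 r' ltac:(by rewrite r'0 r1)) r'0.
have th : 0 <= r / r' < 1 by apply/andP; split; [apply: divr_ge0; exact: ltW|rewrite ltr_pdivrMr// mul1r].
have [t0 t1] := andP th.
pose K := M / (1 - r / r') / r ^+ 2.
have K0 : 0 <= K by rewrite divr_ge0 ?exprn_ge0// ?divr_ge0//; lra.
have K1 : 0 < K + 1 by lra.
exists (Num.min (r - N z) (e / (K + 1))).
  by rewrite lt_min subr_gt0 zr divr_gt0.
move=> w; rewrite lt_min ltr_pdivlMr// => /andP[w1 w2].
have wr : N w <= r.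
  by have := ND (w - z) z; rewrite subrK; lra.
have zr2 := ltW zr.
have main n : N (f w - f z - f1 z * (w - z)) <= K * N (w - z) ^+ 2 + (2 * M1 + M2 * N (w - z)) * (r / r') ^+ n.
  pose T := \sum_(k < n.+1) c k * (w ^+ k - z ^+ k - k%:R * z ^+ k.-1 * (w - z)).
  have -> : f w - f z - f1 z * (w - z) = T + ((f w - \sum_(k < n.+1) c k * w ^+ k) -
     (f z - \sum_(k < n.+1) c k * z ^+ k) - (f1 z - \sum_(k < n) (k.+1%:R * c k.+1) * z ^+ k) * (w - z)).
    have -> : T = \sum_(k < n.+1) c k * w ^+ k - \sum_(k < n.+1) c k * z ^+ k - (\sum_(k < n) (k.+1%:R * c k.+1) * z ^+ k) * (w - z).
      have -> : \sum_(k < n) k.+1%:R * c k.+1 * z ^+ k = \sum_(k < n.+1) k%:R * c k * z ^+ k.-1.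
        by rewrite [RHS]big_ord_recl /= !mul0r add0r; apply: eq_bigr.
      rewrite mulr_suml -!sumrB; apply: eq_bigr => k _; ring.
    by move: (\sum_(_ < _) _) (\sum_(_ < _) _) (\sum_(_ < _) _) => ? ? ?; ring.
  apply: le_trans (ND _ _) _; apply: lerD.
    apply: le_trans (Nsum _ _ _) _.
    rewrite /K mulrAC ler_pdivlMr ?exprn_gt0// mulr_suml.
    apply: (@le_trans _ _ (\sum_(k < n.+1) M * (r / r') ^+ k * N (w - z) ^+ 2)).
      apply: ler_sum => k _; rewrite (NM (c k)) -[leLHS]mulrA.
      apply: (@le_trans _ _ (N (c k) * ((k * k)%:R * r ^+ k * N (w - z) ^+ 2))).
        by apply: ler_wpM2l; [exact: N_ge0|exact: diffq_bound].
      rewrite [leLHS](_ : _ = N (c k) * (k * k)%:R * r ^+ k * N (w - z) ^+ 2); last by ring.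
      apply: ler_wpM2r; first by rewrite exprn_ge0 ?N_ge0.
      have := hM k; rewrite !NM !Nnat natrM => h.
      rewrite [(r / r') ^+ k]expr_div_n.
      have -> : N (c k) * (k%:R * k%:R) * r ^+ k = (k%:R * (k%:R * N (c k)) * r' ^+ k) * (r ^+ k / r' ^+ k).
        by field; rewrite expf_neq0// gt_eqF.
      by apply: ler_wpM2r => //; rewrite divr_ge0 ?exprn_ge0// ltW.
    rewrite -mulr_suml; apply: ler_wpM2r; first by rewrite exprn_ge0 ?N_ge0.
    rewrite -mulr_sumr; apply: ler_wpM2l => //.
    have := @geo_sum_le R (r / r') 0 n.+1 th isT.
    by rewrite expr0 mul1r big_mkord.
  have pw (x : R[i]) k : N x <= r -> (N x / r') ^+ k <= (r / r') ^+ k.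
    move=> xr; apply: lerXn2r; rewrite ?nnegrE ?divr_ge0 ?N_ge0 ?(ltW r'0) ?(ltW r0)//.
    by rewrite ler_wpM2r ?invr_ge0 ?(ltW r'0).
  have b1 : N (f w - \sum_(k < n.+1) c k * w ^+ k) <= M1 * (r / r') ^+ n.
    apply: le_trans (hM1 n.+1 w _) _; first by lra.
    apply: ler_wpM2l => //; apply: le_trans (pw _ _ wr) _.
    by apply: ler_wiXn2l => //; exact: ltW.
  have b2 : N (f z - \sum_(k < n.+1) c k * z ^+ k) <= M1 * (r / r') ^+ n.
    apply: le_trans (hM1 n.+1 z _) _; first by lra.
    apply: ler_wpM2l => //; apply: le_trans (pw _ _ zr2) _.
    by apply: ler_wiXn2l => //; exact: ltW.
  have b3 : N (f1 z - \sum_(k < n) (k.+1%:R * c k.+1) * z ^+ k) <= M2 * (r / r') ^+ n.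
    apply: le_trans (hM2 n z _) _; first by lra.
    by apply: ler_wpM2l => //; exact: pw.
  apply: le_trans (NB _ _) _; rewrite (NM _ (w - z)).
  apply: le_trans (lerD (NB _ _) (ler_wpM2r (N_ge0 _) b3)) _.
  have -> : (2 * M1 + M2 * N (w - z)) * (r / r') ^+ n = M1 * (r / r') ^+ n + M1 * (r / r') ^+ n + M2 * (r / r') ^+ n * N (w - z) by ring.
  by rewrite lerD2r; apply: lerD.
apply: le_trans (geo_le th main) _.
have := N_ge0 (w - z) => nw.
have : K * N (w - z) <= e by apply: le_trans (ltW w2); rewrite mulrDr mulr1 mulrC lerDl.
by move=> h; rewrite expr2 mulrA; apply: ler_wpM2r.
Qed.

Lemma PS_derivable c f z : PS c f -> N z < 1 -> exists l, cder f z l.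
Proof. by move=> /PS_der[f1 _ h] z1; exists (f1 z); exact: h. Qed.

(** The operator [z d/dz] multiplies coefficients by [n] without shifting them, so all differential
    relations below become multipliers. *)
Lemma PS_Dz c f : PS c f -> exists2 f1 : C -> C, (forall z, N z < 1 -> cder f z (f1 z)) &
   PS (fun n => n%:R * c n) (fun z => z * f1 z).
Proof.
move=> /PS_der[f1 h1 h2]; exists f1 => //; have := PS_mulz h1.
by congr PS; apply/funext => -[|n] //; rewrite mul0r.
Qed.
End PowerSeriesCalculus.

(** * Identity theorem, branches and logarithms *)

Section Branch.
Variable R : realType.
Local Notation C := (R[i]^o).
Implicit Types (f g h p : C -> C) (z : R[i]).

Lemma an_cder (r : R) f z : analytic_on (disc r) f -> N z < r -> cder f z (derive1 f z).
Proof. by move=> h zr; apply: derivableC_cder; apply: h; apply/discE. Qed.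
Lemma cder_an (r : R) f : (forall z, N z < r -> exists l, cder f z l) -> analytic_on (disc r) f.
Proof. by move=> h z /discE /h[l /cder_derivable]. Qed.
Lemma an_PS f : analytic_on (disc 1) f -> exists c, PS c f.
Proof. by move=> h; apply: cder_PS => z z1; exists (derive1 f z); exact: an_cder z1. Qed.

Lemma analytic_identity f g (d : R) z : 0 < d -> analytic_on (disc 1) f -> analytic_on (disc 1) g ->
  (forall z, z != 0 -> N z < d -> f z = g z) -> N z < 1 -> f z = g z.
Proof.
move=> d0 /an_PS[c hc] /an_PS[c' hc'] fg; have e := PS_uniq d0 hc hc' fg.
by rewrite -e in hc'; exact: PS_fun_uniq hc hc'.
Qed.

Lemma const_disc f : (forall z, N z < 1 -> cder f z 0) -> forall z, N z < 1 -> f z = f 0.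
Proof.
move=> h z z1; have [c hc] := cder_PS (fun z hz => ex_intro _ _ (h z hz)).
have [f1 h1 h2] := PS_der hc.
have e := PS_uniq (d := 1) ltr01 h1 (@PS_cst R 0) (fun z _ hz => cder_uniq (h2 z hz) (h z hz)).
have cS n : c n.+1 = 0.
  have := congr1 (fun u => u n) e; rewrite if_same => /eqP.
  by rewrite mulf_eq0 pnatr_eq0 /= => /eqP.
have hk : PS c (fun=> c 0%N).
  by have := @PS_cst R (c 0%N); congr PS; apply/funext => -[|n] //=; rewrite cS.
by rewrite (PS_fun_uniq hc hk z1) (PS_fun_uniq hc hk (z := 0)) ?N0.
Qed.

(** Near 0 the two logarithms differ by a small number whose exponential is 1, so they agree there,
    and so do the powers; the identity theorem extends this to the disc. *)
Lemma bpow_uniq (delta : R) h p p' : is_bpow delta h p -> is_bpow delta h p' ->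
  forall z, N z < 1 -> p z = p' z.
Proof.
move=> [anp [r [L [r0 anL L0 hL]]]] [anp' [r' [L' [r'0 anL' L'0 hL']]]] z.
have d0 : cder (fun z => L z - L' z) 0 (derive1 L 0 - derive1 L' 0).
  by apply: cderB; apply: an_cder; [exact: anL|rewrite N0|exact: anL'|rewrite N0].
have [d d1 hd] := cder_cont d0 ltr01.
apply: (@analytic_identity _ _ (Num.min d (Num.min 1 (Num.min r r')))) => //.
  by rewrite !lt_min d1 ltr01 r0.
move=> w _; rewrite !lt_min => /andP[wd /andP[w1 /andP[wr wr']]].
have [e1 e2] := hL w ltac:(exact/discE) ltac:(exact/discE).
have [e1' e2'] := hL' w ltac:(exact/discE) ltac:(exact/discE).
have : L w - L' w = 0.
  apply: cexp_eq1.
    by have := hd w; rewrite L0 L'0 !subr0; exact.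
  by rewrite cexpD cexpN -e1 -e1' mulfV// e1 cexp_neq0.
by move/eqP; rewrite subr_eq0 => /eqP e; rewrite e2 e2' e.
Qed.

Lemma bpowP (delta : R) h p : is_bpow delta h p -> is_bpow delta h (bpow delta h).
Proof. by move=> hp; apply: (@xgetPex _ _ [set p | is_bpow delta h p]); exists p. Qed.
Lemma bpowE (delta : R) h p : is_bpow delta h p -> forall z, N z < 1 -> bpow delta h z = p z.
Proof. by move=> hp z hz; exact: (bpow_uniq (bpowP hp) hp). Qed.

(** The logarithm is the series antiderivative of [f1 / f]; [f exp(-L)] then has derivative 0. *)
Lemma log_exists f f1 : (forall z, N z < 1 -> cder f z (f1 z)) ->
  (forall z, N z < 1 -> f z != 0) -> f 0 = 1 ->
  exists L : C -> C, [/\ L 0 = 0, forall z, N z < 1 -> cder L z (f1 z / f z) &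
    forall z, N z < 1 -> f z = cexp (L z)].
Proof.
move=> df f0 f01.
have [c hc] := cder_PS (fun z hz => ex_intro _ _ (df z hz)).
have [f1' h1 h2] := PS_der hc.
have e1 z : N z < 1 -> f1' z = f1 z by move=> z1; exact: cder_uniq (h2 z z1) (df z z1).
have [d hd] : exists d, PS d (fun z => f1' z / f z).
  apply: cder_PS => z z1; have [l hl] := PS_derivable h1 z1.
  by eexists; apply: cderM hl _; apply: cderV; [exact: f0|exact: df].
pose e n := if n is n'.+1 then d n' / n'.+1%:R else 0.
have ge : cgrow e.
  move=> r r01; have [M hM] := PS_cgrow hd r01; have r0 : 0 < r by case/andP: r01.
  have M0 : 0 <= M by apply: le_trans (hM 0%N); rewrite expr0 mulr1 N_ge0.
  exists (M * r) => -[|n] /=; first by rewrite N0 mul0r mulr_ge0// ltW.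
  rewrite NM NV Nnat exprS mulrCA mulrC ler_pM2r//; apply: le_trans (hM n).
  apply: ler_wpM2r; first by rewrite exprn_ge0// ltW.
  by rewrite ler_pdivrMr// ler_peMr ?N_ge0// ler1n.
have [L hL] := PS_of_cgrow ge.
have [L1 hL1 hL2] := PS_der hL.
have dL z : N z < 1 -> cder L z (f1 z / f z).
  have hL1d : PS d L1.
    by move: hL1; congr PS; apply/funext => n; rewrite /e mulrC divfK// pnatr_eq0.
  by move=> hz; apply: cder_eq (hL2 z hz) _; rewrite -e1//; exact: (PS_fun_uniq hL1d hd hz).
have h2' : (0 : R) < 2^-1 by rewrite invr_gt0.
have L00 : L 0 = 0.
  have h3 : PSr 2^-1 e L by apply: hL; rewrite h2' /= invf_lt1// ltr1n.
  exact: (PSr_at0 h2' h3).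
exists L; split => // z z1.
have : f z * cexp (- L z) = 1.
  rewrite (const_disc (f := fun z => f z * cexp (- L z)) _ z1); last first.
    move=> w w1; apply: cder_eq; first apply: cderM; first exact: df.
      by apply: (cder_comp (cderN (dL w w1))); exact: cder_cexp.
    rewrite mulrN mulrN mulrCA mulrC mulrA.
    have := f0 w w1 => fw; field.
    by [].
  by rewrite L00 oppr0 cexp0 mulr1.
by rewrite cexpN => /divr1_eq.
Qed.
End Branch.

(** The quantity [z f''/f'] when [f' = E Q] with [E = exp L], [l = L'] and [X = Q']. *)
Lemma logderiv2_alg (K : fieldType) (z E l Q X : K) : E != 0 -> Q != 0 ->
  z * (E * l * Q + E * X) / (E * Q) = z * l + z * X / Q.
Proof. by move=> E0 Q0; field; rewrite E0 Q0. Qed.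

(** Here [P] is [(f/z)^delta], [p1] its derivative, [W] the derivative of [z p1], and [Q] is
    [z f'/f]. From [P Q = P + z p1 / delta], the nonlinear terms [(z p1)^2 / P] produced by [Q] and
    by [z f''/f'] cancel: the bracket with [1 - 1/delta] and [1/delta] in [H] is exactly what makes
    [H] linear in [P]. *)
Lemma Hform_alg (K : fieldType) (a g dl P z W p1 Q : K) : dl != 0 -> P != 0 -> Q != 0 ->
  Q = 1 + dl^-1 * (z * p1 / P) ->
  (1 - a + 2 * g) * P + ((a - 3 * g) + g * ((1 - dl^-1) * Q + dl^-1 *
    (1 + (Q - 1 + z * (dl^-1 * (W / P - z * p1 * p1 / P ^+ 2)) / Q)))) * P * Q =
  P + (a - g) / dl * (z * p1) + g / dl ^+ 2 * (z * W).
Proof.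
move=> d0 P0 Q0 eQ; have EP : P * Q = P + dl^-1 * (z * p1) by rewrite eQ; field; rewrite d0 P0.
transitivity ((1 - a + 2 * g) * P + (a - 3 * g) * (P * Q) +
   g * ((P * Q) ^+ 2 / P + dl^-1 ^+ 2 * (z * W - (z * p1) ^+ 2 / P))).
  by field; rewrite P0 Q0 d0.
by rewrite EP; field; rewrite P0 d0.
Qed.

(** * The multiplier that turns the coefficients of [(f/z)^delta] into those of [H] *)

Section HCoefficients.
Variable R : realType.
Local Notation C := (R[i]^o).
Implicit Types (f g h p : C -> C).

Lemma PS_derive1 c f : PS c f -> PS (fun n => n%:R * c n) (fun z => z * derive1 f z).
Proof.
move=> /PS_Dz[f1 hf1 h]; apply: PS_id h _ => z hz.
by rewrite (cder_derive1 (hf1 z hz)).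
Qed.

Lemma PS_an c f : PS c f -> analytic_on (disc 1) f.
Proof. by move=> h; apply: cder_an => z; exact: PS_derivable h. Qed.

(** A statement near 0 only: there the logarithm [L] of [f/z] is available and [f], [f'] do not
    vanish off 0. *)
Lemma Hform_germ (alpha gamma delta : R) f P : 0 < delta -> classA f -> is_bpow delta (fdivz f) P ->
  (forall z, N z < 1 -> bpow delta (fdivz f) z = P z) ->
  exists2 d : R, 0 < d & forall z, z != 0 -> N z < d -> N z < 1 /\ f z != 0 /\ derive1 f z != 0 /\
  Hform alpha gamma delta f z = P z + ((alpha - gamma) / delta)%:C * (z * derive1 P z) +
    (gamma / delta ^+ 2)%:C * (z * derive1 (fun z => z * derive1 P z) z).
Proof.
move=> d0 [anf f0 f1] [anP [r [L [r0 anL L0 hL]]]] bP.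
pose s := Num.min 1 r; have s0 : 0 < s by rewrite lt_min ltr01.
have dn : delta%:C != 0 :> R[i] by apply/eqP => /complexI e; rewrite e ltxx in d0.
have sr z : N z < s -> N z < 1 /\ N z < r by rewrite lt_min => /andP[].
have dL z : N z < s -> cder L z (derive1 L z).
  by move=> /sr[_ zr]; exact: an_cder anL zr.
have dP z : N z < s -> cder P z (derive1 P z).
  by move=> /sr[zr _]; exact: an_cder anP zr.
have near g1 g2 (z l : C) : N z < s -> (forall w, N w < s -> g1 w = g2 w) -> cder g1 z l -> cder g2 z l.
  move=> zs e; apply: cder_near; exists (s - N z); first by lra.
  by move=> w ws; apply: e; have := ND (w - z) z; rewrite subrK; lra.
have Pexp z : N z < s -> P z = cexp (delta%:C * L z).
  by move=> /sr[z1 zr]; have [] := hL z ltac:(exact/discE) ltac:(exact/discE).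
have fexp z : N z < s -> f z = z * cexp (L z).
  move=> /sr[z1 zr]; have [+ _] := hL z ltac:(exact/discE) ltac:(exact/discE).
  by rewrite /fdivz; case: eqP => [-> _|/eqP z0 <-]; rewrite ?f0 ?mul0r// mulrC divfK.
have P0 z : N z < s -> P z != 0 by move=> zs; rewrite Pexp// cexp_neq0.
have P1 z : N z < s -> derive1 P z = delta%:C * derive1 L z * P z.
  move=> zs; apply: (cder_uniq (dP z zs)).
  apply: (near (fun z => cexp (delta%:C * L z))) => //; first by move=> w ws; rewrite Pexp.
  apply: cder_eq; first by apply: (cder_comp (cderZ _ (dL z zs))); exact: cder_cexp.
  by rewrite Pexp// mulrC.
pose DP z := z * derive1 P z.
(* [z f'/f] expressed through [P]: the logarithmic derivative of [f/z] is [1/delta] times that of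
   [P]. *)
pose q z := 1 + delta%:C^-1 * (DP z / P z).
have q1 z : N z < s -> q z = 1 + z * derive1 L z.
  move=> zs; rewrite /q /DP P1//; have := P0 z zs => Pz; field.
  by rewrite dn Pz.
have df z : N z < s -> derive1 f z = cexp (L z) * q z.
  move=> zs; apply: cder_derive1; apply: (near (fun z => z * cexp (L z))) => //.
    by move=> w ws; rewrite fexp.
  apply: cder_eq; first apply: cderM; first exact: cder_id.
    by apply: (cder_comp (dL z zs)); exact: cder_cexp.
  by rewrite q1//; ring.
have [c hc] := an_PS anP.
have dDP z : N z < s -> cder DP z (derive1 DP z).
  by move=> /sr[z1 _]; exact: an_cder (PS_an (PS_derive1 hc)) z1.
have dq z : N z < s -> cder q z (delta%:C^-1 * (derive1 DP z / P z - DP z * derive1 P z / P z ^+ 2)).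
  move=> zs; apply: cder_eq.
    apply: cderD; first exact: cder_cst.
    by apply: cderZ; apply: cderM (dDP z zs) (cderV (P0 z zs) (dP z zs)).
  by rewrite add0r; congr (_ * (_ + _)); rewrite mulNr mulrN mulrA.
have ddf z : N z < s -> cder (derive1 f) z (cexp (L z) * derive1 L z * q z +
   cexp (L z) * (delta%:C^-1 * (derive1 DP z / P z - DP z * derive1 P z / P z ^+ 2))).
  move=> zs; apply: (near (fun z => cexp (L z) * q z)) => //; first by move=> w ws; rewrite df.
  apply: cderM (dq z zs).
  by apply: (cder_comp (dL z zs)); exact: cder_cexp.
have N0s : N (0 : R[i]) < s by rewrite N0.
(* [f' 0 = 1], so a variation smaller than 1 keeps [f'] away from 0. *)
have [d2 d20 hd2] := cder_cont (ddf 0 N0s) ltr01.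
exists (Num.min s d2); first by rewrite lt_min s0.
move=> z z0; rewrite lt_min => /andP[zs zd2].
have [z1 zr] := sr z zs.
have fz : f z != 0 by rewrite fexp// mulf_neq0// cexp_neq0.
have f1z : derive1 f z != 0.
  apply/eqP => e; have := hd2 z; rewrite subr0 => /(_ zd2).
  by rewrite e f1 sub0r NN N1 ltxx.
split => //; split => //; split => //.
have qz : q z != 0 by move: f1z; rewrite df// mulf_eq0 (negbTE (cexp_neq0 _)).
have Ez := cexp_neq0 (L z); have Pz := P0 z zs.
have e1 : z * derive1 f z / f z = q z by rewrite df// fexp//; field; rewrite Ez z0.
have e2 : z * derive1 (derive1 f) z / derive1 f z =
   q z - 1 + z * (delta%:C^-1 * (derive1 DP z / P z - DP z * derive1 P z / P z ^+ 2)) / q z.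
  rewrite (cder_derive1 (ddf z zs)) df//.
  have -> : q z - 1 = z * derive1 L z by rewrite q1// addrAC subrr add0r.
  exact: logderiv2_alg.
pose Fn (x y t : C) : C := (1 - alpha + 2 * gamma)%:C * y +
  ((alpha - 3 * gamma)%:C + gamma%:C * ((1 - delta^-1)%:C * x + (delta^-1)%:C * (1 + t))) * y * x.
transitivity (Fn (q z) (P z) (q z - 1 + z * (delta%:C^-1 * (derive1 DP z / P z - DP z * derive1 P z / P z ^+ 2)) / q z)).
  exact: (f_equal3 Fn e1 (bP z z1) e2).
rewrite /Fn.
have -> : ((alpha - gamma) / delta)%:C = (alpha%:C - gamma%:C) / delta%:C :> R[i].
  by rewrite rmorphM rmorphB fmorphV.
have -> : (gamma / delta ^+ 2)%:C = gamma%:C / delta%:C ^+ 2 :> R[i].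
  by rewrite rmorphM fmorphV rmorphXn.
have -> : (1 - alpha + 2 * gamma)%:C = 1 - alpha%:C + 2 * gamma%:C :> R[i].
  by rewrite rmorphD rmorphB rmorph1 rmorphM /= rmorph_nat.
have -> : (alpha - 3 * gamma)%:C = alpha%:C - 3 * gamma%:C :> R[i].
  by rewrite rmorphB rmorphM /= rmorph_nat.
have -> : (1 - delta^-1)%:C = 1 - delta%:C^-1 :> R[i] by rewrite rmorphB rmorph1 fmorphV.
have -> : (delta^-1)%:C = delta%:C^-1 :> R[i] by rewrite fmorphV.
exact: Hform_alg.
Qed.

(** Coefficients are compared near 0 by [Hform_germ]. The multiplier [1 + (alpha - gamma) n/delta +
    gamma n^2/delta^2] factors because [mu] and [nu] have sum [alpha - gamma] and product
    [gamma]. *)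
Lemma H_coeffs (beta delta alpha gamma mu nu : R) f : 0 < delta -> mu * nu = gamma -> mu + nu = alpha - gamma ->
  classW beta delta alpha gamma f ->
  exists c (hn : nat -> R[i]) (H : C -> C) (phi : R), [/\ PS c (bpow delta (fdivz f)), PS hn H, c 0%N = 1,
    forall n, hn n = ((1 + mu * n%:R / delta) * (1 + nu * n%:R / delta))%:C * c n &
    forall z, N z < 1 -> 0 < Rex (cexp (phi *i) * (H z - beta%:C))].
Proof.
move=> d0 hg ha [hA [p hp] [H [phi [anH HH Hpos]]]].
have hP := bpowP hp; set P := bpow delta (fdivz f) in hP *.
have [c hc] := an_PS hP.1; have [hn hh] := an_PS anH.
exists c, hn, H, phi.
pose q : R := 2^-1; have q21 : 0 < q < 1 by rewrite /q; lra.
have q2 : 0 < q by case/andP: q21.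
split => //; last by move=> z hz; apply: Hpos; exact/discE.
- have hc2 : PSr q c P by exact: hc.
  rewrite -(PSr_at0 q2 hc2); have [_ [r [L [r0 _ L0 hL]]]] := hP.
  have [_ ->] := hL 0 ltac:(by apply/discE; rewrite N0) ltac:(by apply/discE; rewrite N0).
  by rewrite L0 mulr0 cexp0.
have [d dp hd] := @Hform_germ alpha gamma delta f P d0 hA hP (fun z _ => erefl).
have hD := PS_derive1 hc; have hDD := PS_derive1 hD.
have hG := PSD (PSD hc (PSZ ((alpha - gamma) / delta)%:C hD)) (PSZ (gamma / delta ^+ 2)%:C hDD).
have e := PS_uniq dp hh hG _.
have -> : hn = _ := e _; last first.
  move=> z z0 zd; have [z1 [fz [f1z <-]]] := hd z z0 zd.
  by apply: HH => //; exact/discE.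
move=> n; rewrite -ha -hg.
have -> : (1 + mu * n%:R / delta) * (1 + nu * n%:R / delta) = 1 + (mu + nu) / delta * n%:R + mu * nu / delta ^+ 2 * n%:R * n%:R.
  by field; rewrite gt_eqF.
rewrite !(rmorphD, rmorphM) rmorph1 /= rmorph_nat; ring.
Qed.
End HCoefficients.

(** * Tail integrals and monotonicity *)

Section RealLemmas.
Variable R : realType.
Local Notation mu := (@lebesgue_measure R).
Implicit Types (f h : R -> R).

Lemma rder_cont f (t l : R) : is_derive t (1 : R) f l -> {for t, continuous f}.
Proof. by move=> [h _]; apply: differentiable_continuous; exact/derivable1_diffP. Qed.

Lemma rder_near f g (t l : R) : (exists2 d : R, 0 < d & forall y, `|y - t| < d -> f y = g y) ->
  is_derive t (1 : R) f l -> is_derive t (1 : R) g l.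
Proof.
move=> [d d0 fg] /rderP h; apply/rderP => e /h[d' d'0 h'].
exists (Num.min d d'); first by rewrite lt_min d0.
by move=> y; rewrite lt_min => /andP[yd yd']; rewrite -!fg ?h'// subrr normr0.
Qed.

Lemma rmono f f' (c d : R) : (forall t : R, c < t < d -> is_derive t (1 : R) f (f' t)) ->
  (forall t : R, c < t < d -> 0 <= f' t) -> forall s t, c < s -> s <= t -> t < d -> f s <= f t.
Proof.
move=> df f0 s t cs st td.
have [||x xst e] := @MVT_segment R f f' s t st.
- by move=> x; rewrite in_itv /= => /andP[sx xt]; apply: df; lra.
- apply: continuous_in_subspaceT => x; rewrite inE /= in_itv /= => /andP[sx xt].
  by apply: (@rder_cont _ x (f' x)); apply: df; lra.
rewrite -subr_ge0 e mulr_ge0 ?subr_ge0//; apply: f0.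
by move: xst; rewrite in_itv /= => /andP[sx xt]; lra.
Qed.

Lemma rmono_le0 f f' (c : R) : c < 1 -> (forall t : R, c < t < 1 -> is_derive t (1 : R) f (f' t)) ->
  (forall t : R, c < t < 1 -> 0 <= f' t) ->
  (forall e : R, 0 < e -> exists2 d : R, 0 < d & forall t : R, c < t -> 1 - d < t < 1 -> f t <= e) ->
  forall t, c < t < 1 -> f t <= 0.
Proof.
move=> c1 df f0 lim t /andP[ct t1]; apply/ler_addgt0Pr => e /lim[d d0 hd].
pose s := Num.max t (1 - d / 2).
have ts : t <= s by rewrite le_max lexx.
have sd : 1 - d / 2 <= s by rewrite le_max lexx orbT.
have s1 : s < 1 by rewrite gt_max t1 /=; lra.
rewrite add0r; apply: le_trans (rmono df f0 ct ts s1) (hd s _ _); lra.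
Qed.

Lemma tail_der h (c t : R) : c < t -> t < 1 -> mu.-integrable `]c, 1[ (EFin \o h) ->
  {for t, continuous h} ->
  is_derive t (1 : R) (fun t => \int[mu]_(s in `]t, 1[) h s) (- h t).
Proof.
move=> ct t1 ih ch.
pose F (y : R) := \int[mu]_(s in `]c, y]) h s.
have [dF F'] : derivable F t 1 /\ derive1 F t = h t.
  apply: (@continuous_FTC1 R h (BRight c) t ((t + 1) / 2)) => //; first lra.
  apply: integrableS ih => //; apply: subset_itvl; rewrite bnd_simp; lra.
have iF : is_derive t (1 : R) F (h t) by rewrite -F' derive1E; exact: DeriveDef.
have h2 : is_derive t (1 : R) (fun y => \int[mu]_(s in `]c, 1[) h s - F y) (0 - h t).
  by apply: is_deriveB.
rewrite sub0r in h2; apply: rder_near h2.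
exists (Num.min (t - c) (1 - t)); first by rewrite lt_min !subr_gt0 ct.
move=> y; rewrite lt_min !ltr_norml => /andP[/andP[y1 y2] /andP[y3 y4]].
apply: (Rintegral_itvB ih); rewrite bnd_simp; lra.
Qed.

Lemma tail_lim h (c : R) : c < 1 -> mu.-integrable `]c, 1[ (EFin \o h) ->
  forall e : R, 0 < e -> exists2 d : R, 0 < d & forall t : R, c < t -> 1 - d < t < 1 ->
    `|\int[mu]_(s in `]t, 1[) h s| <= e.
Proof.
move=> c1 ih e e0.
have ih2 : mu.-integrable setT (EFin \o (h \_ `]c, 1[)).
  by rewrite -restrict_EFin; apply/integrable_restrict => //=; rewrite setTI.
have [d [d0 hd]] := integral_normr_continuous ih2 e0.
exists d => // t ct /andP[t1 t2].
have sub : `]t, 1[ `<=` `]c, 1[ by apply: subset_itvr; rewrite bnd_simp ltW.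
have iht : mu.-integrable `]t, 1[ (EFin \o h) by exact: integrableS ih.
apply: le_trans (le_normr_Rintegral _ iht) _ => //.
have hm : (mu (`]t, 1%R[%classic : set R) < d%:E)%E.
  by rewrite lebesgue_measure_itv /= lte_fin t2 -EFinB lte_fin; lra.
have mm : measurable (`]t, 1[%classic : set (measurableTypeR R)) by [].
apply: le_trans (ltW (hd _ mm hm)).
rewrite le_eqVlt; apply/orP; left; apply/eqP; apply: eq_Rintegral => s; rewrite inE => st.
by rewrite /patch mem_set//; exact: sub.
Qed.

Lemma head_lim h (e : R) : mu.-integrable `]0, 1[ (EFin \o h) -> 0 < e ->
  exists2 d : R, 0 < d & forall t : R, 0 < t -> t < d -> t < 1 ->
    `|\int[mu]_(s in `]0, 1[) h s - \int[mu]_(s in `]t, 1[) h s| <= e.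
Proof.
move=> ih e0.
have ih2 : mu.-integrable setT (EFin \o (h \_ `]0, 1[)).
  by rewrite -restrict_EFin; apply/integrable_restrict => //=; rewrite setTI.
have [d [d0 hd]] := integral_normr_continuous ih2 e0.
exists d => // t t0 td t1.
have -> : \int[mu]_(s in `]0, 1[) h s - \int[mu]_(s in `]t, 1[) h s = \int[mu]_(s in `]0, t]) h s.
  by rewrite -(Rintegral_itvB (x := t) ih) ?bnd_simp ?(ltW t0)//; ring.
have sub : `]0, t] `<=` `]0, 1[ by apply: subset_itvl; rewrite bnd_simp.
have iht : mu.-integrable `]0, t] (EFin \o h) by exact: integrableS ih.
apply: le_trans (le_normr_Rintegral _ iht) _ => //.
have hm : (mu (`]0%R, t]%classic : set R) < d%:E)%E.
  by rewrite lebesgue_measure_itv /= lte_fin t0 -EFinB subr0 lte_fin.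
have mm : measurable (`]0, t]%classic : set (measurableTypeR R)) by [].
apply: le_trans (ltW (hd _ mm hm)).
rewrite le_eqVlt; apply/orP; left; apply/eqP; apply: eq_Rintegral => s; rewrite inE => st.
by rewrite /patch mem_set//; exact: sub.
Qed.

(** With [J] the tail integral of [phi], the function [- J - E] is nondecreasing. Comparing a point
    near 0 with a point near 1 bounds the integral below by [E] near 1 minus [E] near 0, up to an
    arbitrarily small error. *)
Lemma int_ge0_of_primitive (phi E E' : R -> R) :
  mu.-integrable `]0, 1[ (EFin \o phi) ->
  (forall t : R, 0 < t < 1 -> {for t, continuous phi}) ->
  (forall t : R, 0 < t < 1 -> is_derive t (1 : R) E (E' t)) ->
  (forall t : R, 0 < t < 1 -> E' t <= phi t) ->
  (forall e : R, 0 < e -> exists2 d : R, 0 < d & forall t : R, 0 < t -> t < d -> t < 1 -> E t <= e) ->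
  (forall e : R, 0 < e -> exists2 d : R, 0 < d & forall t : R, 0 < t -> 1 - d < t < 1 -> - e <= E t) ->
  0 <= \int[mu]_(t in `]0, 1[) phi t.
Proof.
move=> iphi cphi dE hE lim0 lim1.
pose J (t : R) := \int[mu]_(s in `]t, 1[) phi s.
have dJ (t : R) : 0 < t < 1 -> is_derive t (1 : R) (fun t => - J t - E t) (phi t - E' t).
  move=> t01; have [t0 t1] := andP t01.
  have := tail_der t0 t1 iphi (cphi t t01) => hJ.
  by have := is_deriveB (is_deriveN hJ) (dE t t01); rewrite opprK.
have mono := rmono dJ (fun t ht => ltac:(by rewrite subr_ge0; exact: hE)).
apply/ler_addgt0Pr => e e0.
have e4 : 0 < e / 4 by lra.
have [d1 d10 h1] := lim0 _ e4; have [d2 d20 h2] := lim1 _ e4.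
have [d3 d30 h3] := head_lim iphi e4.
have [d4 d40 h4] := tail_lim ltr01 iphi e4.
pose s := Num.min (1 / 2) (Num.min (d1 / 2) (d3 / 2)).
pose t := Num.max (1 / 2) (Num.max (1 - d2 / 2) (1 - d4 / 2)).
have s0 : 0 < s by rewrite !lt_min; lra.
have [s1 [s2 s3]] : s <= 1 / 2 /\ s <= d1 / 2 /\ s <= d3 / 2 by rewrite !ge_min !lexx !orbT.
have t1 : t < 1 by rewrite !gt_max; lra.
have [t2 [t3 t4]] : 1 / 2 <= t /\ 1 - d2 / 2 <= t /\ 1 - d4 / 2 <= t by rewrite !le_max !lexx !orbT.
clearbody s t.
have := mono s t s0 ltac:(lra) t1.
have := h1 s s0 ltac:(lra) ltac:(lra); have := h2 t ltac:(lra) ltac:(lra).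
have := h3 s s0 ltac:(lra) ltac:(lra); have := h4 t ltac:(lra) ltac:(lra).
by rewrite -/(J s) -/(J t) !ler_norml => /andP[? ?] /andP[? ?] ? ? ?; lra.
Qed.

End RealLemmas.

(** * The weighted inequality *)

Section Weights.
Variable R : realType.
Implicit Types (f g : R -> R).

Lemma rderM f g (t a b : R) : is_derive t (1 : R) f a -> is_derive t (1 : R) g b ->
  is_derive t (1 : R) (fun t => f t * g t) (a * g t + f t * b).
Proof.
move=> hf hg; have := is_deriveM hf hg => /is_derive_eq; apply.
by rewrite addrC [a * _]mulrC.
Qed.
Lemma rderD f g (t a b : R) : is_derive t (1 : R) f a -> is_derive t (1 : R) g b ->
  is_derive t (1 : R) (fun t => f t + g t) (a + b).
Proof. exact: is_deriveD. Qed.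
Lemma rderB f g (t a b : R) : is_derive t (1 : R) f a -> is_derive t (1 : R) g b ->
  is_derive t (1 : R) (fun t => f t - g t) (a - b).
Proof. exact: is_deriveB. Qed.
Lemma rderN f (t a : R) : is_derive t (1 : R) f a -> is_derive t (1 : R) (fun t => - f t) (- a).
Proof. exact: is_deriveN. Qed.
Lemma rderZ (c : R) f (t a : R) : is_derive t (1 : R) f a -> is_derive t (1 : R) (fun t => c * f t) (c * a).
Proof. by move=> h; exact: (is_deriveZ c h). Qed.
Lemma rder_id (t : R) : is_derive t (1 : R) (fun t => t) 1.
Proof. exact: is_derive_id. Qed.
Lemma rder_cst (c t : R) : is_derive t (1 : R) (fun=> c) 0.
Proof. exact: is_derive_cst. Qed.
Lemma rderV f (t a : R) : f t != 0 -> is_derive t (1 : R) f a ->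
  is_derive t (1 : R) (fun t => (f t)^-1) (- a / f t ^+ 2).
Proof.
move=> f0 [df vf]; split; first exact: derivableV.
by rewrite (deriveV f0 df) vf /= mulNr mulrC -mulNr.
Qed.
Lemma rderX f (t a : R) n : is_derive t (1 : R) f a ->
  is_derive t (1 : R) (fun t => f t ^+ n) (n%:R * f t ^+ n.-1 * a).
Proof.
move=> h; elim: n => [|n IH]; first by rewrite !mul0r; exact: rder_cst.
have -> : (fun t => f t ^+ n.+1) = (fun t => f t * f t ^+ n) by apply/funext => s; rewrite exprS.
apply: is_derive_eq (rderM h IH) _.
case: n {IH} => [|n]; first by rewrite !expr0; ring.
by rewrite /= exprS -(natr1 n.+1); ring.
Qed.
Lemma rder_pow (m t : R) : 0 < t -> is_derive t (1 : R) (fun t => t `^ m) (m * (t `^ m / t)).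
Proof.
move=> t0; apply: is_derive_eq (is_derive1_powR m t0) _.
have tn : t != 0 by rewrite gt_eqF.
by rewrite -(powR_inv1 (ltW t0)) -powRD ?tn ?implybT.
Qed.

(* [psi m t L t <= (1 - t^2) (t / t^m) l t], see [psi_L], says exactly that the weight
   [W] of [weighted_primitive] is nonincreasing. *)
Definition psi (m t : R) := (m - 1) + (3 - m) * t ^+ 2.

(** [psi m] is affine in [t^2] with value 2 at [t = 1]: it increases when [m <= 1], and it is at
    least 2 on the interval when [m >= 3]. *)
Lemma psi_pos (m s t : R) : m <= 1 \/ 3 <= m -> 0 < t -> t <= s -> s < 1 -> 0 < psi m t -> 0 < psi m s.
Proof.
rewrite /psi => hm t0 ts s1; have h : t ^+ 2 <= s ^+ 2 by apply: lerXn2r => //; rewrite nnegrE; lra.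
have h1 : s ^+ 2 <= 1 by apply: exprn_ile1; lra.
have h0 : 0 <= s ^+ 2 by exact: sqr_ge0.
case: hm => hm; nra.
Qed.

(** Times [c], this function is the value of [L] that turns the inequality for [psi] into an
    equality when [l = c t^(3-m)]. Its derivative is at most [- t^3 / t^(2m)] once
    [(3 - m)(1 - m) >= 0], hence the alternative [m <= 1] or [3 <= m]. *)
Lemma der_Q (m t : R) : 0 < t -> psi m t != 0 ->
  is_derive t (1 : R) (fun t => (1 - t ^+ 2) * t ^+ 4 / ((t `^ m) ^+ 2 * psi m t))
   (- (t ^+ 3 / (t `^ m) ^+ 2) - (t ^+ 3 / (t `^ m) ^+ 2) * ((1 - t ^+ 2) ^+ 2 * (3 - m) * (1 - m)) / psi m t ^+ 2).
Proof.
move=> t0 p0; have T0 : t `^ m != 0 by rewrite gt_eqF ?powR_gt0.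
have tn : t != 0 by rewrite gt_eqF.
have dp : is_derive t (1 : R) (psi m) ((3 - m) * (2%:R * t ^+ 1 * 1)).
  have := rderD (rder_cst (m - 1) t) (rderZ (3 - m) (rderX 2 (rder_id t))).
  by move=> /is_derive_eq; apply; rewrite add0r.
have d1 := rderM (rderB (rder_cst 1 t) (rderX 2 (rder_id t))) (rderX 4 (rder_id t)).
have d2 := rderM (rderX 2 (rder_pow m t0)) dp.
have n2 : (t `^ m) ^+ 2 * psi m t != 0 by rewrite mulf_neq0 ?expf_neq0.
apply: is_derive_eq (rderM d1 (rderV (f := fun t => (t `^ m) ^+ 2 * psi m t) n2 d2)) _.
move: (t `^ m) T0 => T T0; move: p0; rewrite /psi => p0 /=; field.
by rewrite T0 tn p0.
Qed.

Section Core.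
Variables (m : R) (l L : R -> R).
Hypotheses (m0 : 0 < m) (hm : m <= 1 \/ 3 <= m).
Hypothesis l0 : forall t : R, 0 < t < 1 -> 0 <= l t.
Hypothesis L0 : forall t : R, 0 < t < 1 -> 0 <= L t.
Hypothesis dL : forall t : R, 0 < t < 1 -> is_derive t (1 : R) L (- (l t / t `^ m)).
Hypothesis L1 : forall e : R, 0 < e -> exists2 d : R, 0 < d & forall t : R, 0 < t -> 1 - d < t < 1 -> L t <= e.
Hypothesis mono : forall s t : R, 0 < s -> s <= t -> t < 1 ->
  l t * t `^ m / t ^+ 3 <= l s * s `^ m / s ^+ 3.

(** Freeze [c], the value at [t] of the monotone quantity [l t^m / t^3]. Beyond [t] one has
    [l s <= c s^(3-m)], so [D = L - c Q] is nondecreasing; its upper limit at 1 is at most 0, whence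
    [L t <= c Q t], which is the claim. Where [psi] is nonpositive the claim is a matter of
    signs. *)
Lemma psi_L (t : R) : 0 < t < 1 -> psi m t * L t <= (1 - t ^+ 2) * (t / t `^ m) * l t.
Proof.
move=> t01; have [t0 t1] := andP t01.
have T0 : 0 < t `^ m by rewrite powR_gt0.
have q1 : 0 <= 1 - t ^+ 2 by rewrite subr_ge0; apply: exprn_ile1; lra.
case: (leP (psi m t) 0) => pt.
  apply: (@le_trans _ _ 0); first by rewrite mulr_le0_ge0 ?L0.
  by rewrite !mulr_ge0 ?l0 ?invr_ge0 ?(ltW t0) ?(ltW T0).
pose c := l t * t `^ m / t ^+ 3.
have c0 : 0 <= c by rewrite /c divr_ge0 ?mulr_ge0 ?l0 ?exprn_ge0 ?(ltW t0) ?(ltW T0).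
pose Qf s : R := (1 - s ^+ 2) * s ^+ 4 / ((s `^ m) ^+ 2 * psi m s).
pose D s := L s - c * Qf s.
have ps s : t <= s -> s < 1 -> 0 < psi m s by move=> ts s1; exact: psi_pos pt.
have dD (s : R) : t <= s -> s < 1 -> is_derive s (1 : R) D (- (l s / s `^ m) - c *
    (- (s ^+ 3 / (s `^ m) ^+ 2) - (s ^+ 3 / (s `^ m) ^+ 2) * ((1 - s ^+ 2) ^+ 2 * (3 - m) * (1 - m)) / psi m s ^+ 2)).
  move=> ts s1; apply: rderB; first by apply: dL; lra.
  by apply: rderZ; apply: der_Q; [lra|rewrite gt_eqF ?ps].
have D'0 (s : R) : t < s < 1 -> 0 <= (- (l s / s `^ m) - c *
    (- (s ^+ 3 / (s `^ m) ^+ 2) - (s ^+ 3 / (s `^ m) ^+ 2) * ((1 - s ^+ 2) ^+ 2 * (3 - m) * (1 - m)) / psi m s ^+ 2)).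
  move=> /andP[ts s1]; have s0 : 0 < s by lra.
  have S0 : 0 < s `^ m by rewrite powR_gt0.
  have h := mono t0 (ltW ts) s1; rewrite -/c in h.
  have h2 : l s / s `^ m <= c * (s ^+ 3 / (s `^ m) ^+ 2).
    rewrite ler_pdivrMr ?exprn_gt0// in h.
    have -> : c * (s ^+ 3 / (s `^ m) ^+ 2) = c * s ^+ 3 / (s `^ m) ^+ 2 by rewrite mulrA.
    rewrite ler_pdivlMr ?exprn_gt0//.
    by have -> : l s / s `^ m * (s `^ m) ^+ 2 = l s * s `^ m by field; rewrite gt_eqF.
  have h3 : 0 <= c * ((s ^+ 3 / (s `^ m) ^+ 2) * ((1 - s ^+ 2) ^+ 2 * (3 - m) * (1 - m)) / psi m s ^+ 2).
    apply: mulr_ge0 => //; apply: divr_ge0; last exact: sqr_ge0.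
    apply: mulr_ge0; first by rewrite divr_ge0 ?exprn_ge0 ?(ltW s0) ?(ltW S0).
    rewrite -mulrA; apply: mulr_ge0; first exact: sqr_ge0.
    by case: hm => ?; nra.
  by rewrite mulrBr mulrN; lra.
have Dle (s : R) : t < s < 1 -> D s <= 0.
  apply: (rmono_le0 t1 _ D'0).
    by move=> u /andP[tu u1]; apply: dD => //; exact: ltW.
  move=> e /L1[d d0 hd]; exists d => // u tu ud; have [u2 u1] := andP ud.
  have : L u <= e by apply: hd => //; lra.
  have : 0 <= c * Qf u; last by rewrite /D; lra.
  apply: mulr_ge0 => //; apply: divr_ge0.
    apply: mulr_ge0; last by apply: exprn_ge0; lra.
    by rewrite subr_ge0; apply: exprn_ile1; lra.
  by apply: mulr_ge0; [exact: sqr_ge0|apply/ltW/ps => //; exact: ltW].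
(* [rmono_le0] speaks of [s > t] only; continuity of [D] at [t] supplies the endpoint. *)
have Dt : D t <= 0.
  rewrite leNgt; apply/negP => Dp.
  have /cvgrPdist_lt/(_ _ Dp) := rder_cont (dD t (lexx _) t1) => /nbhsRP[d d0 hd].
  pose s := t + Num.min d (1 - t) / 2.
  have mp : 0 < Num.min d (1 - t) by rewrite lt_min d0 subr_gt0.
  have [md mt] : Num.min d (1 - t) <= d /\ Num.min d (1 - t) <= 1 - t by rewrite !ge_min !lexx orbT.
  have := hd s; have -> : s - t = Num.min d (1 - t) / 2 by rewrite /s; ring.
  rewrite gtr0_norm; last by lra.
  move=> /(_ ltac:(lra)); have := Dle s ltac:(rewrite /s; lra).
  by rewrite ltr_norml => h1 /andP[h2 h3]; lra.
have e1 : c * Qf t = (1 - t ^+ 2) * (t / t `^ m) * l t / psi m t.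
  rewrite /c /Qf; field.
  by rewrite !gt_eqF.
by rewrite mulrC -ler_pdivlMr// -e1 -subr_le0.
Qed.

Variables (Y x Th Th' : R -> R).
Hypothesis dY : forall t : R, 0 < t < 1 -> is_derive t (1 : R) (fun t => t `^ m * Y t) (m * (t `^ m / t) * x t).
Hypothesis dTh : forall t : R, 0 < t < 1 -> is_derive t (1 : R) Th (Th' t).
Hypothesis Th0 : forall t : R, 0 < t < 1 -> 0 <= Th t.
Hypothesis Th'x : forall t : R, 0 < t < 1 -> Th' t <= (1 - t ^+ 2) * x t.
Variable (K B : R).
Hypothesis LT : forall t : R, 0 < t < 1 -> t `^ m * L t <= K.
Hypothesis YB : forall t : R, 0 < t < 1 -> `|Y t| <= B.
Hypothesis Y0 : forall e : R, 0 < e -> exists2 d : R, 0 < d & forall t : R, 0 < t -> t < d -> t < 1 -> `|Y t| <= e.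
Hypothesis ThS : forall e : R, 0 < e -> exists2 d : R, 0 < d & forall t : R, 0 < t -> t < d -> t < 1 -> Th t <= e * t.

(** Take [E = - L t^m Y + m W Th]. The first term contributes [l Y - m (t^m / t) L x] to the
    derivative, the second at most [m (t^m / t) L x]. Near 0, [t^m L] is bounded while [Y] and
    [Th / t] tend to 0; near 1, [L] tends to 0 and [W Th] is nonnegative. *)
Lemma weighted_primitive : exists E E' : R -> R, [/\
  forall t : R, 0 < t < 1 -> is_derive t (1 : R) E (E' t),
  forall t : R, 0 < t < 1 -> E' t <= l t * Y t,
  forall e : R, 0 < e -> exists2 d : R, 0 < d & forall t : R, 0 < t -> t < d -> t < 1 -> E t <= e &
  forall e : R, 0 < e -> exists2 d : R, 0 < d & forall t : R, 0 < t -> 1 - d < t < 1 -> - e <= E t].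
Proof.
pose T (t : R) := t `^ m.
(* Integration by parts leaves [m (T/t) L x]; since [W (1 - t^2) = (T/t) L] and
   [W' <= 0], the derivative of [W Th] stays below it. *)
pose W (t : R) := (T t / t * L t) / (1 - t ^+ 2).
pose W' (t : R) := T t / t ^+ 2 * (psi m t * L t - (1 - t ^+ 2) * (t / T t) * l t) / (1 - t ^+ 2) ^+ 2.
have T0 (t : R) : 0 < t < 1 -> 0 < T t by move=> /andP[t0 _]; rewrite powR_gt0.
have T1 (t : R) : 0 < t < 1 -> T t <= 1.
  move=> /andP[t0 t1]; have e : 1 `^ m = 1 :> R by rewrite powR1.
  by rewrite -[leRHS]e; apply: ge0_ler_powR; rewrite ?nnegrE ?ler01 ?(ltW t0) ?(ltW t1) ?(ltW m0).
have q0 (t : R) : 0 < t < 1 -> 0 < 1 - t ^+ 2 by move=> /andP[t0 t1]; rewrite subr_gt0; apply: exprn_ilt1 => //; exact: ltW.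
have dW (t : R) : 0 < t < 1 -> is_derive t (1 : R) W (W' t).
  move=> t01; have [t0 t1] := andP t01.
  have tn : t != 0 by rewrite gt_eqF.
  have n2 : 1 - t ^+ 2 != 0 by rewrite gt_eqF ?q0.
  have d1 := rderM (rderM (rder_pow m t0) (rderV (f := fun t => t) tn (rder_id t))) (dL t01).
  have d2 := rderB (rder_cst 1 t) (rderX 2 (rder_id t)).
  apply: is_derive_eq (rderM d1 (rderV (f := fun t => 1 - t ^+ 2) n2 d2)) _.
  have := T0 t t01; have := q0 t t01; rewrite /W' /psi -/(T t); move: (T t) (L t) (l t) => S M k Q0 S0 /=.
  by field; rewrite !gt_eqF.
exists (fun t => - (L t * (T t * Y t)) + m * (W t * Th t)).
exists (fun t => - (- (l t / T t) * (T t * Y t) + L t * (m * (T t / t) * x t)) + m * (W' t * Th t + W t * Th' t)).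
split.
- move=> t t01; apply: rderD; first by apply: rderN; apply: rderM; [exact: dL|exact: dY].
  by apply: rderZ; apply: rderM; [exact: dW|exact: dTh].
- move=> t t01; have [t0 t1] := andP t01.
  have h1 : W' t * Th t <= 0.
    rewrite mulr_le0_ge0 ?Th0// /W'.
    have hp : 0 <= T t / t ^+ 2 by rewrite divr_ge0 ?sqr_ge0// (ltW (T0 t t01)).
    rewrite -mulrA mulr_ge0_le0//; rewrite mulr_le0_ge0 ?invr_ge0 ?sqr_ge0//.
    by rewrite subr_le0; exact: psi_L.
  have W0 : 0 <= W t.
    by rewrite /W divr_ge0 ?(ltW (q0 t t01))// mulr_ge0 ?L0// divr_ge0 ?(ltW t0) ?(ltW (T0 t t01)).
  have h2 : W t * Th' t <= T t / t * L t * x t.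
    apply: le_trans (ler_wpM2l W0 (Th'x t01)) _.
    by rewrite /W mulrA divfK ?gt_eqF ?q0.
  have -> : - (l t / T t) * (T t * Y t) = - (l t * Y t) by field; rewrite gt_eqF ?T0.
  have := ler_wpM2l (ltW m0) (lerD h1 h2); rewrite add0r => h3.
  have -> : - (- (l t * Y t) + L t * (m * (T t / t) * x t)) = l t * Y t - m * (T t / t * L t * x t) by ring.
  lra.
- move=> e e0.
  have K0 : 0 <= K.
    pose q : R := 1 / 2; have h : 0 < q < 1 by rewrite /q; lra.
    by apply: le_trans (LT h); rewrite mulr_ge0 ?L0// powR_ge0.
  have Kp : 0 < K + 1 by lra.
  have e1 : 0 < e / 2 / (K + 1) by rewrite !divr_gt0.
  (* For [t < 1/2] the denominator [1 - t^2] of [W] is at least 1/2, which doubles [e / 4] to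
     [e / 2]. *)
  have e2 : 0 < e / 4 / (m * (K + 1)) by rewrite !divr_gt0// mulr_gt0.
  have [d1 d10 h1] := Y0 e1; have [d2 d20 h2] := ThS e2.
  exists (Num.min (1 / 2) (Num.min d1 d2)); first by rewrite !lt_min d10 d20; lra.
  move=> t t0; rewrite !lt_min => /andP[t2 /andP[td1 td2]] t1.
  have t01 : 0 < t < 1 by rewrite t0.
  have LT0 : 0 <= T t * L t by rewrite mulr_ge0 ?L0 ?(ltW (T0 t t01)).
  have LK := LT t01; rewrite -/(T t) in LK.
  have b1 : `|L t * (T t * Y t)| <= e / 2.
    rewrite mulrCA mulrA normrM (ger0_norm LT0).
    apply: (@le_trans _ _ (K * (e / 2 / (K + 1)))).
      by apply: ler_pM => //; exact: h1.
    have -> : K * (e / 2 / (K + 1)) = e / 2 * (K / (K + 1)) by ring.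
    by rewrite ger_pMr; [rewrite ler_pdivrMr// mul1r; lra|lra].
  have b2 : m * (W t * Th t) <= e / 2.
    have q3 : 1 / 2 <= 1 - t ^+ 2 by nra.
    have -> : m * (W t * Th t) = m * (T t * L t) * (Th t / t) / (1 - t ^+ 2).
      by rewrite /W; field; rewrite !gt_eqF ?q0.
    rewrite ler_pdivrMr ?q0//.
    have b3 : Th t / t <= e / 4 / (m * (K + 1)) by rewrite ler_pdivrMr//; exact: h2.
    apply: (@le_trans _ _ (m * (K + 1) * (e / 4 / (m * (K + 1))))).
      apply: ler_pM => //.
      - by rewrite mulr_ge0// (ltW m0).
      - by rewrite divr_ge0 ?Th0 ?(ltW t0).
      - by rewrite ler_pM2l//; lra.
    rewrite mulrC divfK; last by rewrite gt_eqF// mulr_gt0.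
    nra.
  by have := ler_norm (- (L t * (T t * Y t))); rewrite normrN; lra.
- move=> e e0.
  have B0 : 0 <= B.
    pose q : R := 1 / 2; have h : 0 < q < 1 by rewrite /q; lra.
    by apply: le_trans (YB h).
  have [d d0 hd] := L1 (ltac:(by rewrite divr_gt0//; lra) : 0 < e / (B + 1)).
  exists d => // t t0 td; have t01 : 0 < t < 1 by rewrite t0; case/andP: td.
  have W0 : 0 <= m * (W t * Th t).
    rewrite mulr_ge0 ?(ltW m0)// mulr_ge0 ?Th0//.
    by rewrite /W divr_ge0 ?(ltW (q0 t t01))// mulr_ge0 ?L0// divr_ge0 ?(ltW t0) ?(ltW (T0 t t01)).
  have b1 : L t * (T t * Y t) <= e.
    apply: (@le_trans _ _ (e / (B + 1) * (1 * B))); last first.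
      by rewrite mul1r mulrAC ler_pdivrMr ?ler_pM2l//; lra.
    apply: le_trans (ler_norm _) _; rewrite !normrM.
    apply: ler_pM => //; first by rewrite ger0_norm ?L0//; exact: hd.
    by apply: ler_pM => //; [rewrite gtr0_norm ?T0//; exact: T1|exact: YB].
  lra.
Qed.
End Core.
End Weights.

(** * The kernel inequality for a point of the disc and a [kap] on the circle *)

Section KernelInequality.
Variable R : realType.
Variables (z kap : R[i]).
Hypotheses (z1 : N z < 1) (hk : N (2 * kap - 1) = 1).

Definition kerQ (t : R) : R[i] := (1 - t%:C * z)^-1.
Definition kerV (t : R) : R[i] := kerQ t ^+ 2 - kerQ t.
(** With [w = tz], [kerV] is the Koebe function [w/(1 - w)^2], written as a polynomial in
    [kerQ = 1/(1 - w)]. The subtracted term is the value of [kerQ + kap kerV] at [z = -1],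
    [kap = 1]. *)
Definition kerx (t : R) : R := Rex (kerQ t + kap * kerV t) - ((1 + t) ^+ 2)^-1.
(* The witness [Th] of [weighted_primitive]: nonnegative, [o(t)] at [0], with
   [Th' <= (1 - t^2) kerx]. *)
Definition kerTh (t : R) : R := t / 4 * ((1 - t ^+ 2) * (2 * Rex (kerQ t) - 1) - (1 - t) ^+ 2).
Definition kerTh' (t : R) : R := ((1 - t ^+ 2) * (2 * Rex (kerQ t) - 1) - (1 - t) ^+ 2) / 4 +
  (- 2 * t ^+ 2 * (2 * Rex (kerQ t) - 1) + 2 * (1 - t ^+ 2) * Rex (kerV t) + 2 * t * (1 - t)) / 4.

Lemma Ntz (t : R) : 0 <= t <= 1 -> N (t%:C * z) <= t /\ N (t%:C * z) < 1.
Proof.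
move=> /andP[t0 t1]; rewrite NM NR ger0_norm//; have := N_ge0 z => h.
by split; have := z1; nra.
Qed.

Lemma ker_den (t : R) : 0 <= t <= 1 -> 1 - t%:C * z != 0.
Proof.
move=> /Ntz[_ h]; rewrite subr_eq0; apply/eqP => e.
by move: h; rewrite -e N1 ltxx.
Qed.

(** [s = |tz|] and [q = |1 - tz|^(-2)]; the combination [2 Re kerQ - 1] is the Poisson kernel
    [(1 - s^2) q]. *)
Lemma ker_facts (t : R) : 0 <= t <= 1 -> exists s q : R, [/\ 0 <= s <= t, ((1 + s) ^+ 2)^-1 <= q,
  2 * Rex (kerQ t) - 1 = (1 - s ^+ 2) * q & N (kerV t) <= s * q].
Proof.
move=> t01; have [ht h1] := Ntz t01; have d0 := ker_den t01.
set w := t%:C * z in ht h1 d0 *.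
have dn : 0 < N (1 - w) by rewrite N_gt0.
exists (N w), (N (1 - w) ^- 2); split.
- by rewrite N_ge0 ht.
- rewrite lef_pV2 ?posrE ?exprn_gt0//; last by have := N_ge0 w; lra.
  apply: lerXn2r; rewrite ?nnegrE ?N_ge0 ?addr_ge0 ?N_ge0//.
  by apply: le_trans (NB _ _) _; rewrite N1.
- have e : Rex (kerQ t) = (1 - Rex w) / N (1 - w) ^+ 2.
    rewrite /kerQ -/w Nsqr; case: w {ht h1 d0 dn} => a b /=.
    by rewrite sub0r.
  have n2 : N (1 - w) ^+ 2 = 1 - 2 * Rex w + N w ^+ 2.
    by rewrite !Nsqr !cReD !cImD !cReN !cImN /=; ring.
  have nn : N (1 - w) ^+ 2 != 0 by rewrite expf_neq0// gt_eqF.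
  rewrite e; move: nn n2; set M := N (1 - w) ^+ 2 => nn n2.
  have -> : 1 - N w ^+ 2 = 2 * (1 - Rex w) - M by rewrite n2; ring.
  by move: (Rex w) => y; field.
- have -> : kerV t = w * kerQ t ^+ 2 by rewrite /kerV /kerQ -/w; field.
  by rewrite NM NX /kerQ -/w NV exprVn.
Qed.

(** Harnack's lower bound for the Poisson kernel: it is at least [(1 - s)/(1 + s)], which decreases
    in [s]. *)
Lemma ker_u_ge (t s q : R) : 0 <= t <= 1 -> 0 <= s <= t -> ((1 + s) ^+ 2)^-1 <= q ->
  (1 - t) / (1 + t) <= (1 - s ^+ 2) * q.
Proof.
move=> /andP[t0 t1] /andP[s0 st] hq.
apply: (@le_trans _ _ ((1 - s ^+ 2) * ((1 + s) ^+ 2)^-1)); last by apply: ler_wpM2l => //; nra.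
rewrite ler_pdivrMr; last by lra.
have -> : (1 - s ^+ 2) / (1 + s) ^+ 2 * (1 + t) = (1 - s) * (1 + t) / (1 + s).
  by field; rewrite gt_eqF//; lra.
by rewrite ler_pdivlMr; nra.
Qed.

Lemma kerTh_ge0 (t : R) : 0 < t < 1 -> 0 <= kerTh t.
Proof.
move=> /andP[t0 t1]; have t01 : 0 <= t <= 1 by rewrite !ltW.
have [s [q [hs hq hu0 _]]] := ker_facts t01.
rewrite /kerTh hu0; have := ker_u_ge t01 hs hq; set u := (1 - s ^+ 2) * q => hu.
apply: mulr_ge0; first lra.
have : (1 - t ^+ 2) * ((1 - t) / (1 + t)) <= (1 - t ^+ 2) * u by apply: ler_wpM2l => //; nra.
have -> : (1 - t ^+ 2) * ((1 - t) / (1 + t)) = (1 - t) ^+ 2 by field; rewrite gt_eqF//; lra.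
lra.
Qed.

(** [kap] enters only through [2 Re (kap V) - Re V = Re ((2 kap - 1) V) >= - |V| >= - s q]. With [u]
    the Poisson kernel, four times the difference of the two sides is then at least
    [(1 + t^2) u - 2 t u - (1 - t)^3/(1 + t)], that is [(1 - t)^2 (u - (1 - t)/(1 + t))], which
    Harnack's bound makes nonnegative. *)
Lemma kerTh_ineq (t : R) : 0 < t < 1 -> kerTh' t <= (1 - t ^+ 2) * kerx t.
Proof.
move=> /andP[t0 t1]; have t01 : 0 <= t <= 1 by rewrite !ltW.
have [s [q [hs hq hu hV]]] := ker_facts t01.
have [s0 st] := andP hs.
have hul := ker_u_ge t01 hs hq.
have q0 : 0 <= q by apply: le_trans hq; rewrite invr_ge0 sqr_ge0.
have hK : - (s * q) <= 2 * Rex (kap * kerV t) - Rex (kerV t).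
  have -> : 2 * Rex (kap * kerV t) - Rex (kerV t) = Rex ((2 * kap - 1) * kerV t).
    have R2 (y : R[i]) : Rex (2 * y) = 2 * Rex y by rewrite !mulr_natl !mulr2n cReD.
    by rewrite mulrBl mul1r -mulrA (cReD (2 * _)) cReN R2.
  have := NRe ((2 * kap - 1) * kerV t); rewrite NM hk mul1r ler_norml => /andP[h _].
  by apply: le_trans h; rewrite lerN2.
have e1 : Rex (kerQ t) = (1 + (1 - s ^+ 2) * q) / 2 by rewrite -hu; field.
rewrite /kerTh' /kerx cReD hu e1.
set A := Rex (kap * kerV t) in hK *; set v := Rex (kerV t) in hK *.
have pt : 0 < 1 + t by lra.
set u := (1 - s ^+ 2) * q in hul *.
rewrite -subr_ge0.
have -> : (1 - t ^+ 2) * ((1 + u) / 2 + A - ((1 + t) ^+ 2)^-1) -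
  (((1 - t ^+ 2) * u - (1 - t) ^+ 2) / 4 + (- 2 * t ^+ 2 * u + 2 * (1 - t ^+ 2) * v + 2 * t * (1 - t)) / 4) =
  ((1 + t ^+ 2) * u - (1 - t) ^+ 3 / (1 + t) + 2 * (1 - t ^+ 2) * (2 * A - v)) / 4.
  by field; rewrite gt_eqF.
apply: divr_ge0 => //.
have h1 : (1 - t ^+ 2) * - (s * q) <= (1 - t ^+ 2) * (2 * A - v) by apply: ler_wpM2l => //; nra.
(* The function [s/(1 - s^2)] increases and [s <= t]; cleared of denominators, the gap is
   [(t - s)(1 + ts)]. *)
have h2 : (1 - t ^+ 2) * (s * q) <= t * u.
  have h0 : 0 <= (t - s) * (1 + t * s).
    by apply: mulr_ge0; [rewrite subr_ge0|rewrite addr_ge0 ?mulr_ge0 ?(ltW t0)].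
  by rewrite /u !(mulrA _ _ q); apply: ler_wpM2r => //; lra.
have h3 : (1 - t) ^+ 2 * ((1 - t) / (1 + t)) <= (1 - t) ^+ 2 * u by apply: ler_wpM2l => //; exact: sqr_ge0.
have e3 : (1 - t) ^+ 2 * ((1 - t) / (1 + t)) = (1 - t) ^+ 3 / (1 + t) by ring.
rewrite e3 in h3.
have -> : (1 + t ^+ 2) * u = (1 - t) ^+ 2 * u + 2 * (t * u) by ring.
rewrite mulrN in h1; lra.
Qed.

Lemma der_ReQ (t : R) : 0 <= t <= 1 -> is_derive t (1 : R) (fun t => Rex (kerQ t)) (Rex (kerQ t ^+ 2 * z)).
Proof.
move=> t01; have d0 := ker_den t01.
have h : cder (fun w : R[i]^o => (1 - w)^-1) (t%:C * z) (kerQ t ^+ 2).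
  have h1 := cderB (cder_cst (1 : R[i]^o) (t%:C * z)) (cder_id (t%:C * z)).
  apply: cder_eq (cderV _ h1) _ => //.
  by rewrite sub0r opprK mul1r /kerQ exprVn.
exact: (cder_ray h).
Qed.

Lemma der_kerTh (t : R) : 0 < t < 1 -> is_derive t (1 : R) kerTh (kerTh' t).
Proof.
move=> /andP[t0 t1]; have t01 : 0 <= t <= 1 by rewrite !ltW.
have d1 := rderB (rder_cst 1 t) (rderX 2 (rder_id t)).
have d2 := rderX 2 (rderB (rder_cst 1 t) (rder_id t)).
have d3 := rderB (rderZ 2 (der_ReQ t01)) (rder_cst 1 t).
have d4 := rderM (rder_id t) (rder_cst 4^-1 t).
apply: is_derive_eq (rderM d4 (rderB (rderM d1 d3) d2)) _.
have e : t * Rex (kerQ t ^+ 2 * z) = Rex (kerV t).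
  rewrite -cReRM mulrCA; congr Rex; rewrite /kerV /kerQ; have := ker_den t01.
  by move: (t%:C * z) => w d0; field.
by rewrite /kerTh' -e /=; field.
Qed.

(** [kerTh t] is [t/4] times a continuous function that vanishes at 0, since the Poisson kernel and
    [(1 - t)^2] both equal 1 there. *)
Lemma kerTh_small (e : R) : 0 < e -> exists2 d : R, 0 < d & forall t : R, 0 < t -> t < d -> t < 1 -> kerTh t <= e * t.
Proof.
move=> e0; have t01 : 0 <= (0 : R) <= 1 by rewrite lexx ler01.
have d1 := rderB (rder_cst 1 (0 : R)) (rderX 2 (rder_id 0)).
have d2 := rderX 2 (rderB (rder_cst 1 (0 : R)) (rder_id 0)).
have d3 := rderB (rderZ 2 (der_ReQ t01)) (rder_cst 1 (0 : R)).
have := rder_cont (rderB (rderM d1 d3) d2) => /cvgrPdist_lt/(_ _ e0)/nbhsRP[d d0 hd].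
exists d => // t t0 td t1; have := hd t; rewrite subr0 (gtr0_norm t0) => /(_ td).
rewrite /kerQ mul0r subr0 invr1 /= expr0n /= !subr0 expr1n.
have -> : 1 * (2 * 1 - 1) - 1 = 0 :> R by ring.
rewrite sub0r normrN => /ltW h; have := le_trans (ler_norm _) h.
set X := _ - _ => hX; rewrite /kerTh /kerQ -/X.
nra.
Qed.
End KernelInequality.

(** * Integrability and the fundamental theorem on an open interval *)

Section OpenIntervalIntegrals.
Variable R : realType.
Local Notation mu := (@lebesgue_measure R).
Implicit Types (h : R -> R).

Lemma cont_meas_oo h (a b : R) : (forall t, a < t < b -> {for t, continuous h}) ->
  measurable_fun (`]a, b[%classic : set (measurableTypeR R)) h.
Proof.
move=> ch; apply: measurable_realfun.subspace_continuous_measurable_fun => //.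
by apply: continuous_in_subspaceT => x; rewrite inE /= in_itv /=; exact: ch.
Qed.

Lemma bounded_integrable h (a b M : R) : (forall t, a < t < b -> {for t, continuous h}) ->
  (forall t, a < t < b -> `|h t| <= M) -> mu.-integrable `]a, b[ (EFin \o h).
Proof.
move=> ch hM; apply: measurable_bounded_integrable => //.
- have e : (mu (`]a, b[%classic : set R) < +oo)%E.
    by rewrite lebesgue_measure_itv /= lte_fin; case: ifP => _; rewrite ?ltry// -EFinB ltry.
  exact: e.
- exact: cont_meas_oo.
- exists M; split; rewrite ?num_real// => x Mx y /=; rewrite in_itv /= => hy.
  by apply: le_trans (hM y hy) (ltW Mx).
Qed.

Lemma integrable_bounded_mul (l h : R -> R) (a b M : R) : mu.-integrable `]a, b[ (EFin \o l) ->
  (forall t, a < t < b -> {for t, continuous h}) ->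
  (forall t, a < t < b -> `|h t| <= M) -> mu.-integrable `]a, b[ (EFin \o (fun t => l t * h t)).
Proof.
move=> il ch hM.
have bh : [bounded h x | x in `]a, b[%classic].
  exists M; split; rewrite ?num_real// => x Mx y /=; rewrite in_itv /= => hy.
  by apply: le_trans (hM y hy) (ltW Mx).
have mm : measurable (`]a, b[%classic : set (measurableTypeR R)) by [].
exact: (integrableMl mm il (cont_meas_oo ch) bh).
Qed.

(** Monotone convergence along compact subintervals, on each of which the fundamental theorem bounds
    the integral by [2 * M]. It covers integrands unbounded at the ends, such as [s^(m-1)] with
    [m < 1]. *)
Lemma nonneg_integrable h (E : R -> R) (M : R) :
  (forall t, 0 < t < 1 -> {for t, continuous h}) ->
  (forall t, 0 < t < 1 -> 0 <= h t) ->
  (forall t : R, 0 < t < 1 -> is_derive t (1 : R) E (h t)) ->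
  (forall t, 0 < t < 1 -> `|E t| <= M) ->
  mu.-integrable `]0, 1[ (EFin \o h).
Proof.
move=> ch h0 dE EM.
have mh := cont_meas_oo ch.
(* Starting at 1/2 keeps [a n <= 1 - a n]. *)
pose a (n : nat) : R := n.+2%:R^-1.
have a0 n : 0 < a n by rewrite invr_gt0.
have a2 n : a n <= 1 / 2 by rewrite /a mul1r lef_pV2 ?posrE// ler_nat.
pose F (n : nat) : set (measurableTypeR R) := `[a n, 1 - a n]%classic.
have Fsub n : F n `<=` (`]0, 1[%classic : set R).
  by move=> x; rewrite /F /= !in_itv /= => /andP[h1 h2]; have := a0 n; lra.
have nF : nondecreasing_seq F.
  move=> m n mn; apply/subsetPset => x; rewrite /F /= !in_itv /= => /andP[h1 h2].
  have : a n <= a m by rewrite /a lef_pV2 ?posrE// ler_nat.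
  lra.
have bF : \bigcup_n F n = (`]0, 1[%classic : set R).
  apply/seteqP; split => x; first by move=> [n _]; exact: Fsub.
  rewrite /= in_itv /= => /andP[x0 x1].
  pose e := Num.min x (1 - x); have e0 : 0 < e by rewrite lt_min x0 subr_gt0.
  exists (Num.bound e^-1) => //; rewrite /F /= in_itv /=.
  have : a (Num.bound e^-1) <= e.
    rewrite /a invf_ple ?posrE//; apply: ltW; apply: lt_le_trans (archi_boundP _) _.
      by rewrite invr_ge0 ltW.
    by rewrite ler_nat -addn2 leq_addr.
  by rewrite le_min => /andP[h1 h2]; lra.
have mF n : measurable (F n) by exact: measurable_itv.
have f0 n x : F n x -> (0 <= (h x)%:E)%E.
  by move=> /Fsub; rewrite /= in_itv /= lee_fin; exact: h0.
have cv : (\int[mu]_(x in F i) (h x)%:E)%E @[i --> \oo] --> (\int[mu]_(x in \bigcup_i F i) (h x)%:E)%E.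
  apply: ge0_nondecreasing_set_cvg_integral => //.
  by move=> n; apply/measurable_EFinP; apply: measurable_funS mh => //; exact: measurable_itv.
have le n : (\int[mu]_(x in F n) (h x)%:E <= (2 * M)%:E)%E.
  have an := a2 n; have an0 := a0 n.
  have sub x : a n <= x <= 1 - a n -> 0 < x < 1 by lra.
  have ihF : mu.-integrable (F n) (EFin \o h).
    by apply: cont_integrable => x /sub; exact: ch.
  have e : \int[mu]_(x in F n) h x = E (1 - a n) - E (a n).
    by apply: Rint_FTC; [lra|move=> x /sub; exact: dE|move=> x /sub; exact: ch].
  have -> : (\int[mu]_(x in F n) (h x)%:E)%E = (\int[mu]_(x in F n) h x)%:E.
    by rewrite /Rintegral fineK//; exact: integrable_fin_num.
  rewrite e lee_fin.
  have := EM (a n) ltac:(lra); have := EM (1 - a n) ltac:(lra).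
  by rewrite !ler_norml => /andP[? ?] /andP[? ?]; lra.
apply/integrableP; split; first exact/measurable_EFinP.
apply: (@le_lt_trans _ _ (2 * M)%:E); last exact: ltry.
have -> : (\int[mu]_(x in `]0%R, 1%R[) `|(h x)%:E| = \int[mu]_(x in \bigcup_i F i) (h x)%:E)%E.
  rewrite bF; apply: eq_integral => x; rewrite inE /= in_itv /= => hx.
  by rewrite ger0_norm// h0.
move/cvg_lim : (cv) => <- //.
apply: lime_le; first by apply/cvg_ex; eexists; exact: cv.
by apply: nearW => n; exact: le.
Qed.

(** Both inequalities come from [int_ge0_of_primitive], for the integrands [h - L] and [L - h]:
    their primitives [E - t L] and its opposite tend to 0 at both ends. *)
Lemma int_FTC_open h (E : R -> R) (L : R) :
  mu.-integrable `]0, 1[ (EFin \o h) ->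
  (forall t, 0 < t < 1 -> {for t, continuous h}) ->
  (forall t : R, 0 < t < 1 -> is_derive t (1 : R) E (h t)) ->
  (forall e : R, 0 < e -> exists2 d : R, 0 < d & forall t : R, 0 < t -> t < d -> t < 1 -> `|E t| <= e) ->
  (forall e : R, 0 < e -> exists2 d : R, 0 < d & forall t : R, 0 < t -> 1 - d < t < 1 -> `|E t - L| <= e) ->
  \int[mu]_(t in `]0, 1[) h t = L.
Proof.
move=> ih ch dE E0 E1.
have icst : mu.-integrable `]0, 1[ (EFin \o (fun=> L)).
  by apply: (@bounded_integrable _ 0 1 `|L|) => // t _; exact: cvg_cst.
have mm : measurable (`]0, 1[%classic : set (measurableTypeR R)) by [].
have iL : \int[mu]_(t in `]0, 1[) (fun=> L) t = L.
  by rewrite Rintegral_cst//= lebesgue_measure_itv /= lte_fin ltr01 -EFinB subr0 mulr1.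
have main (s : R) : s = 1 \/ s = -1 -> 0 <= \int[mu]_(t in `]0, 1[) (s * (h t - L)).
  move=> s1; apply: (@int_ge0_of_primitive R _ (fun t => s * (E t - t * L)) (fun t => s * (h t - L))).
  - have := integrableZl mm s (integrableB mm ih icst).
    by congr (mu.-integrable _ _); apply/funext => x.
  - move=> t t01; apply: cvgM; first exact: cvg_cst.
    by apply: cvgB; [exact: ch|exact: cvg_cst].
  - move=> t t01; apply: rderZ.
    apply: is_derive_eq (rderB (dE t t01) (rderM (rder_id t) (rder_cst L t))) _.
    by rewrite mul1r mulr0 addr0.
  - by [].
  - move=> e e0; have e2 : 0 < e / 2 by lra.
    have [d d0 hd] := E0 _ e2; have p : 0 < 2 * (`|L| + 1) by have := normr_ge0 L; lra.
    exists (Num.min d (e / (2 * (`|L| + 1)))); first by rewrite lt_min d0 divr_gt0.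
    move=> t t0; rewrite lt_min ltr_pdivlMr// => /andP[td te] t1.
    have := hd t t0 td t1; have : `|t * L| <= e / 2.
      by rewrite normrM gtr0_norm//; have := normr_ge0 L; nra.
    by rewrite !ler_norml => /andP[? ?] /andP[? ?]; case: s1 => ->; lra.
  - move=> e e0; have e2 : 0 < e / 2 by lra.
    have [d d0 hd] := E1 _ e2; have p : 0 < 2 * (`|L| + 1) by have := normr_ge0 L; lra.
    exists (Num.min d (e / (2 * (`|L| + 1)))); first by rewrite lt_min d0 divr_gt0.
    move=> t t0 /andP[tm t1].
    have [m1 m2] : Num.min d (e / (2 * (`|L| + 1))) <= d /\ Num.min d (e / (2 * (`|L| + 1))) <= e / (2 * (`|L| + 1)) by rewrite !ge_min !lexx orbT.
    have : 1 - t < e / (2 * (`|L| + 1)) by lra.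
    rewrite ltr_pdivlMr// => te.
    have := hd t t0 ltac:(lra); have : `|(1 - t) * L| <= e / 2.
      by rewrite normrM gtr0_norm ?subr_gt0//; have := normr_ge0 L; nra.
    by rewrite !ler_norml => /andP[? ?] /andP[? ?]; case: s1 => ->; lra.
have e (s : R) : \int[mu]_(t in `]0, 1[) (s * (h t - L)) = s * (\int[mu]_(t in `]0, 1[) h t - L).
  rewrite RintegralZl//; last by have := integrableB mm ih icst; congr (mu.-integrable _ _).
  by rewrite RintegralB// iL.
have := main 1 (or_introl erefl); have := main (-1) (or_intror erefl); rewrite !e.
by move=> ? ?; apply/eqP; rewrite eq_le; apply/andP; lra.
Qed.
End OpenIntervalIntegrals.

(** * Positivity of the dual functional *)

Section Averages.
Variable R : realType.
Local Notation C := (R[i]^o).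
Implicit Types (c : nat -> R[i]) (f : C -> C).

Lemma PS_geo : PS (fun=> 1) (fun w : R[i]^o => (1 - w)^-1).
Proof.
move=> r /andP[r0 r1]; exists (1 - r)^-1 => n z zr.
have nz := N_ge0 z.
have d0 : 1 - z != 0.
  by rewrite subr_eq0; apply/eqP => e; move: zr; rewrite -e N1; lra.
have -> : \sum_(k < n) 1 * z ^+ k = (1 - z ^+ n) / (1 - z).
  apply: (mulIf d0); rewrite divfK// mulrC.
  elim: n => [|n IH]; first by rewrite big_ord0 mulr0 expr0 subrr.
  by rewrite big_ord_recr /= mulrDr IH exprS; ring.
have -> : (1 - z)^-1 - (1 - z ^+ n) / (1 - z) = z ^+ n / (1 - z) by field.
rewrite NM NV NX mulrC; apply: ler_pM.
- by rewrite invr_ge0 N_ge0.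
- exact: exprn_ge0.
- rewrite lef_pV2 ?posrE ?N_gt0//; last by lra.
  by have := ND (1 - z) z; rewrite subrK N1; lra.
- apply: lerXn2r; rewrite ?nnegrE// ?divr_ge0// ?(ltW r0)//.
  by rewrite ler_peMr// invf_ge1// ltW.
Qed.

Lemma PS_koebe : PS (fun n => n%:R) (fun w : R[i]^o => w * ((1 - w)^-1) ^+ 2).
Proof.
have [f1 h1 h2] := PS_Dz PS_geo.
have -> : (fun n => n%:R) = (fun n => n%:R * (1 : R[i])) by apply/funext => n; rewrite mulr1.
apply: PS_id h2 _ => w w1; congr (_ * _).
have d0 : 1 - w != 0 by rewrite subr_eq0; apply/eqP => e; move: w1; rewrite -e N1 ltxx.
apply: (cder_uniq (h1 w w1)).
have h := cderB (cder_cst (1 : R[i]^o) w) (cder_id w).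
by apply: cder_eq (cderV (f := fun w : R[i]^o => 1 - w) d0 h) _; rewrite sub0r opprK mul1r exprVn.
Qed.

(* The series with these coefficients solves [F + (z / a) F' = f], so that
   [(t^a F(tz))' = a t^(a-1) f(tz)]. *)
Definition avgc (a : R) c (n : nat) : R[i] := ((1 + n%:R / a)^-1)%:C * c n.

Lemma PS_avg (a : R) c f : 0 < a -> PS c f -> exists2 F : C -> C, PS (avgc a c) F &
  forall (t : R) (z : R[i]), 0 < t -> N (t%:C * z) < 1 ->
    is_derive t (1 : R) (fun t : R => t `^ a * Rex (F (t%:C * z))) (a * (t `^ a / t) * Rex (f (t%:C * z))).
Proof.
move=> a0 hf.
have p n : 1 <= 1 + n%:R / a by rewrite lerDl divr_ge0// ltW.
have hg : cgrow (avgc a c).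
  apply: (@cgrow_mul R _ 1); last exact: PS_cgrow hf.
  move=> n; rewrite NR mul1r normfV ger0_norm; last by have := p n; lra.
  by apply: (@le_trans _ _ 1); [rewrite invf_le1; have := p n; lra|rewrite ler1n].
have [F hF] := PS_of_cgrow hg; exists F => //.
have [F1 hF1 hF2] := PS_Dz hF.
have e w : N w < 1 -> F w + (a^-1)%:C * (w * F1 w) = f w.
  move=> w1; have := PSD hF (PSZ (a^-1)%:C hF2) => h.
  apply: (PS_fun_uniq h _ w1); move: hf; congr PS; apply/funext => n.
  rewrite /avgc; have -> : (n%:R : R[i]) = (n%:R)%:C by rewrite rmorph_nat.
  have q : (1 + n%:R / a)^-1 + a^-1 * (n%:R * (1 + n%:R / a)^-1) = 1 :> R.
    by field; have h0 := ler0n R n; rewrite !gt_eqF//; lra.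
  have qC : ((1 + n%:R / a)^-1)%:C + (a^-1)%:C * ((n%:R)%:C * ((1 + n%:R / a)^-1)%:C) = 1 :> R[i].
    by rewrite -!rmorphM -rmorphD q.
  rewrite -[LHS]mul1r -qC; move: (_^-1)%:C (a^-1)%:C (n%:R)%:C => x1 x2 x3; ring.
move=> t z t0 tz.
apply: is_derive_eq (rderM (rder_pow a t0) (cder_ray (hF1 _ tz))) _.
have -> : Rex (f (t%:C * z)) = Rex (F (t%:C * z)) + a^-1 * (t * Rex (F1 (t%:C * z) * z)).
  by rewrite -(e _ tz) (cReD (F _)) cReRM -[t%:C * z * _]mulrA cReRM [z * _]mulrC.
by field; rewrite !gt_eqF.
Qed.
End Averages.

Section Positivity.
Variable R : realType.
Local Notation C := (R[i]^o).
Local Notation mu := (@lebesgue_measure R).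
Implicit Types (c : nat -> R[i]) (f F : C -> C).

Lemma ct_ray c F z (t : R) : PS c F -> N (t%:C * z) < 1 -> ct (fun t : R => F (t%:C * z)) t.
Proof.
move=> hF tz; have [l hl] := PS_derivable hF tz.
have h : ct (fun t : R => t%:C * z : C) t.
  by apply: ctM; [apply: ct_RC; exact: cvg_id|exact: ct_cst].
exact: (ct_cder h hl).
Qed.

Lemma Nray z (t : R) : N z <= 1 -> 0 <= t -> N (t%:C * z) <= t.
Proof. by move=> hz t0; rewrite NM NR ger0_norm//; have := N_ge0 z; nra. Qed.

Lemma ray_bounded c F z : PS c F -> N z < 1 -> exists B : R, forall t : R, 0 <= t <= 1 -> `|Rex (F (t%:C * z))| <= B.
Proof.
move=> hF hz; have [|B _ hB] := ct_bounded (F := fun t : R => F (t%:C * z)) (@ler01 R).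
  move=> t /andP[t0 t1]; apply: ct_ray hF _.
  by rewrite NM NR ger0_norm//; have := N_ge0 z; nra.
by exists B => t t01; apply: le_trans (NRe _) (hB t t01).
Qed.

(** The bound [N z <= 1] admits the boundary point [z = -1], which carries the comparison
    function. *)
Lemma ray_lim0 c F z (e : R) : PS c F -> N z <= 1 -> 0 < e -> exists2 d : R, 0 < d & forall t : R, 0 < t -> t < d ->
  `|Rex (F (t%:C * z)) - Rex (c 0%N)| <= e.
Proof.
move=> hF hz e0; pose q : R := 1 / 2; have q2 : 0 < q < 1 by rewrite /q; lra.
have F0 : F 0 = c 0%N by apply: (PSr_at0 _ (hF q q2)); case/andP: q2.
have N01 : N (0 : R[i]) < 1 by rewrite N0 ltr01.
have [l hl] := PS_derivable hF N01; have [d d0 hd] := cder_cont hl e0.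
exists d => // t t0 td; rewrite -F0 -cReN -cReD; apply: le_trans (NRe _) (ltW (hd _ _)).
by rewrite subr0; apply: le_lt_trans td; apply: Nray => //; exact: ltW.
Qed.

Lemma pow_small (m e : R) : 0 < m -> 0 < e -> exists2 d : R, 0 < d & forall t : R, 0 < t -> t < d -> t `^ m <= e.
Proof.
move=> m0 e0; exists (e `^ m^-1); first by rewrite powR_gt0.
move=> t t0 td; have -> : e = (e `^ m^-1) `^ m.
  by rewrite -powRrM mulVf ?powRr1 ?gt_eqF// ltW.
by apply: ge0_ler_powR; rewrite ?nnegrE ?powR_ge0 ?(ltW t0) ?(ltW m0) ?(ltW td).
Qed.
Lemma pow_le1 (m t : R) : 0 < m -> 0 < t -> t <= 1 -> t `^ m <= 1.
Proof.
move=> m0 t0 t1; have e : 1 `^ m = 1 :> R by rewrite powR1.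
by rewrite -[leRHS]e; apply: ge0_ler_powR; rewrite ?nnegrE ?ler01 ?(ltW t0) ?(ltW m0).
Qed.
Lemma pow_m1 (m t : R) : 0 < t -> t `^ (m - 1) = t `^ m / t.
Proof.
move=> t0; have tn : t != 0 by rewrite gt_eqF.
by rewrite -(powR_inv1 (ltW t0)) -powRD ?tn ?implybT.
Qed.

Lemma PS_sq : PS (fun n => 1 + n%:R) (fun w : C => ((1 - w)^-1) ^+ 2).
Proof.
apply: PS_id (PSD (@PS_geo R) (@PS_koebe R)) _ => w w1.
have d0 : 1 - w != 0 by rewrite subr_eq0; apply/eqP => e; move: w1; rewrite -e N1 ltxx.
by field.
Qed.

(** Rewrites the inner integral in the equation of [g] as a series average: in [s], the function
    [s^m Re Z(-st) / m] is a primitive of the integrand, running from 0 at [s = 0] to the right-hand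
    side at [s = 1]. *)
Lemma zeta_eq (m t : R) Z : 0 < m -> 0 < t < 1 -> PS (avgc m (fun n => 1 + n%:R)) Z ->
  (forall (t : R) (z : R[i]), 0 < t -> N (t%:C * z) < 1 ->
    is_derive t (1 : R) (fun t : R => t `^ m * Rex (Z (t%:C * z))) (m * (t `^ m / t) * Rex (((1 - t%:C * z)^-1) ^+ 2))) ->
  \int[mu]_(s in `]0, 1[) ((1 + s * t) ^- 2 * s `^ (m - 1)) = Rex (Z (t%:C * (- 1))) / m.
Proof.
move=> m0 /andP[t0 t1] hZ dZ.
pose zt : R[i] := - t%:C.
have Nzt : N zt = t by rewrite NN NR gtr0_norm.
have Nst (s : R) : 0 <= s <= 1 -> N (s%:C * zt) < 1.
  by move=> /andP[s0 s1]; rewrite NM NR Nzt ger0_norm//; nra.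
pose h (s : R) := (1 + s * t) ^- 2 * s `^ (m - 1).
pose E (s : R) := m^-1 * (s `^ m * Rex (Z (s%:C * zt))).
have dE (s : R) : 0 < s <= 1 -> is_derive s (1 : R) E (h s).
  move=> /andP[s0 s1]; apply: is_derive_eq (rderZ m^-1 (dZ s zt s0 (Nst s _))) _; first by lra.
  have -> : 1 - s%:C * zt = (1 + s * t)%:C by rewrite /zt mulrN opprK rmorphD rmorph1 rmorphM.
  rewrite -fmorphV -rmorphXn /= /h pow_m1// exprVn.
  by field; rewrite !gt_eqF//; nra.
have ch (s : R) : 0 < s < 1 -> {for s, continuous h}.
  move=> /andP[s0 s1]; have st0 : 1 + s * t != 0 by rewrite gt_eqF//; nra.
  have d1 := rderX 2 (rderD (rder_cst 1 s) (rderM (rder_id s) (rder_cst t s))).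
  have n2 : (1 + s * t) ^+ 2 != 0 by rewrite expf_neq0.
  have d2 := rderM (rderV (f := fun s => (1 + s * t) ^+ 2) n2 d1) (rder_pow (m - 1) s0).
  exact: (rder_cont d2).
have h0 (s : R) : 0 < s < 1 -> 0 <= h s.
  by move=> _; rewrite /h mulr_ge0 ?powR_ge0// invr_ge0 sqr_ge0.
have [B hB] := ray_bounded hZ (ltac:(by rewrite Nzt) : N zt < 1).
have B0 : 0 <= B by apply: le_trans (hB 0 _); rewrite ?normr_ge0// lexx ler01.
have EB (s : R) : 0 < s < 1 -> `|E s| <= m^-1 * (1 * B).
  move=> /andP[s0 s1]; rewrite /E !normrM (gtr0_norm (_ : 0 < m^-1)) ?invr_gt0//.
  apply: ler_wpM2l; first by rewrite invr_ge0 ltW.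
  apply: ler_pM => //; last by apply: hB; lra.
  by rewrite ger0_norm ?powR_ge0//; apply: pow_le1 => //; exact: ltW.
have dE1 (s : R) : 0 < s < 1 -> is_derive s (1 : R) E (h s) by move=> /andP[s0 s1]; apply: dE; rewrite s0 ltW.
have ih := nonneg_integrable ch h0 dE1 EB.
apply: (int_FTC_open ih ch dE1).
- move=> e e0; have [d d0 hd] := @pow_small m (e * m / (B + 1)) m0 ltac:(by rewrite divr_gt0 ?mulr_gt0//; lra).
  exists d => // s s0 sd s1; rewrite /E !normrM (gtr0_norm (_ : 0 < m^-1)) ?invr_gt0//.
  rewrite ler_pdivrMl// (ger0_norm (powR_ge0 _ _)).
  have h1 := hd s s0 sd; have h2 := hB s ltac:(lra).
  apply: (@le_trans _ _ (e * m / (B + 1) * B)); first by apply: ler_pM; rewrite ?powR_ge0.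
  rewrite mulrAC ler_pdivrMr; last by lra.
  by rewrite (mulrC m) ler_pM2l ?mulr_gt0//; lra.
- move=> e e0; have o1 : 0 < (1 : R) <= 1 by rewrite ltr01 lexx.
  have /cvgrPdist_lt/(_ _ e0)/nbhsRP[d d0 hd] := rder_cont (dE 1 o1).
  exists d => // s s0 /andP[s1 s2].
  have -> : Rex (Z (t%:C * -1)) / m = E 1.
    by rewrite /E powR1 mul1r mulrC rmorph1 mul1r /zt mulrN1.
  by rewrite distrC; apply: ltW; apply: hd; rewrite ltr_norml; lra.
Qed.

Variables (lam : R -> R) (a : R).
Hypothesis a0 : 0 < a.
Hypothesis lam_ge0 : forall t : R, 0 < t < 1 -> 0 <= lam t.
Hypothesis lam_int : mu.-integrable `]0, 1[ (EFin \o lam).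
Hypothesis lam1 : \int[mu]_(t in `]0, 1[) lam t = 1.
Hypothesis lam_cont : forall t : R, 0 < t < 1 -> {for t, continuous lam}.
Let La (t : R) := \int[mu]_(s in `]t, 1[) (lam s / s `^ a).
Hypothesis La_gt0 : forall t : R, 0 < t < 1 -> 0 < La t.

Lemma powV_cont (s : R) : 0 < s -> {for s, continuous (fun s => (s `^ a)^-1)}.
Proof.
move=> s0; have n0 : s `^ a != 0 by rewrite gt_eqF ?powR_gt0.
exact: (rder_cont (rderV (f := fun s => s `^ a) n0 (rder_pow a s0))).
Qed.
Lemma La_integrable (t0 : R) : 0 < t0 -> mu.-integrable `]t0, 1[ (EFin \o (fun s => lam s / s `^ a)).
Proof.
move=> t00; apply: (@integrable_bounded_mul _ lam (fun s => (s `^ a)^-1) t0 1 (t0 `^ a)^-1).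
- by apply: integrableS lam_int => //; apply: subset_itvr; rewrite bnd_simp ltW.
- by move=> s /andP[s0 s1]; apply: powV_cont; exact: lt_trans s0.
- move=> s /andP[s0 s1]; have sp : 0 < s by exact: lt_trans s0.
  rewrite ger0_norm ?invr_ge0 ?powR_ge0// lef_pV2 ?posrE ?powR_gt0//.
  by apply: ge0_ler_powR; rewrite ?nnegrE ?(ltW t00) ?(ltW sp) ?(ltW s0) ?(ltW a0).
Qed.
Lemma La_der (t : R) : 0 < t < 1 -> is_derive t (1 : R) La (- (lam t / t `^ a)).
Proof.
move=> /andP[t0 t1]; have h2 : 0 < t / 2 by lra.
apply: (tail_der _ t1 (La_integrable h2)); first lra.
by apply: cvgM; [apply: lam_cont; rewrite t0|exact: powV_cont].
Qed.
Lemma La_lim (e : R) : 0 < e -> exists2 d : R, 0 < d & forall t : R, 0 < t -> 1 - d < t < 1 -> La t <= e.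
Proof.
move=> e0; pose q : R := 1 / 2; have q0 : 0 < q by rewrite /q; lra.
have [d d0 hd] := tail_lim (ltac:(rewrite /q; lra) : q < 1) (La_integrable q0) e0.
exists (Num.min d q); first by rewrite lt_min d0.
move=> t t0 /andP[t1 t2]; have [m1 m2] : Num.min d q <= d /\ Num.min d q <= q by rewrite !ge_min !lexx orbT.
by apply: le_trans (ler_norm _) (hd t _ _); rewrite /q in m2 *; lra.
Qed.
(** [t^a La t] is at most the integral of [lam] over []t, 1[], because [s^(-a) <= t^(-a)] there. The
    proof compares derivatives: that of the difference is [a t^(a-1) La t >= 0], and the difference
    has upper limit at most 0 at 1. *)
Lemma La_pow_le1 (t : R) : 0 < t < 1 -> t `^ a * La t <= 1.
Proof.
move=> t01; pose J (t : R) := \int[mu]_(s in `]t, 1[) lam s.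
have J1 (s : R) : 0 < s < 1 -> 0 <= J s <= 1.
  move=> /andP[s0 s1]; apply/andP; split.
    by apply: Rintegral_ge0 => x; rewrite /= in_itv /= => /andP[x0 x1]; apply: lam_ge0; rewrite x1 (lt_trans s0).
  rewrite -lam1 -subr_ge0 -[X in X - _](subrK (\int[mu]_(s in `]0, s]) lam s)).
  rewrite (Rintegral_itvB lam_int) ?bnd_simp ?(ltW s0)// -/(J s) addrAC subrr add0r.
  by apply: Rintegral_ge0 => x; rewrite /= in_itv /= => /andP[x0 x1]; apply: lam_ge0; rewrite x0 (le_lt_trans x1).
have dJ (s : R) : 0 < s < 1 -> is_derive s (1 : R) J (- lam s).
  by move=> s01; have [s0 s1] := andP s01; apply: (tail_der s0 s1 lam_int); exact: lam_cont.
have dD (s : R) : 0 < s < 1 -> is_derive s (1 : R) (fun s => s `^ a * La s - J s) (a * (s `^ a / s) * La s).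
  move=> s01; have [s0 s1] := andP s01.
  apply: is_derive_eq (rderB (rderM (rder_pow a s0) (La_der s01)) (dJ s s01)) _.
  by field; rewrite !gt_eqF ?powR_gt0.
have : t `^ a * La t - J t <= 0.
  apply: (rmono_le0 ltr01 dD _ _ t01).
    move=> s s01; have [s0 s1] := andP s01.
    by rewrite !mulr_ge0 ?powR_ge0 ?invr_ge0 ?(ltW a0) ?(ltW s0) ?(ltW (La_gt0 s01)).
  move=> e e0; have [d d0 hd] := La_lim e0; exists d => // s s0 sd.
  have s01 : 0 < s < 1 by rewrite s0; case/andP: sd.
  have := hd s s0 sd; have [j0 _] := andP (J1 s s01); have := pow_le1 a0 s0 ltac:(lra).
  by have := La_gt0 s01; have := powR_ge0 s a; nra.
by have /andP[_] := J1 t t01; lra.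
Qed.

Variables (g : R -> R) (z kap : R[i]).
Hypotheses (hz : N z < 1) (hk : N (2 * kap - 1) = 1).
Hypotheses (g0 : g 0 = 1) (g_cont : {within `[0, 1], continuous g}).

Lemma cont01_facts : [/\ forall t : R, 0 < t < 1 -> {for t, continuous g},
  exists B : R, forall t : R, 0 <= t <= 1 -> `|g t| <= B &
  forall e : R, 0 < e -> exists2 d : R, 0 < d & forall t : R, 0 < t -> t < d -> `|g t - 1| <= e].
Proof.
have [h1 h2 h3] := (continuous_within_itvP g ltr01).1 g_cont; split.
- by move=> t t01; apply: h1; rewrite in_itv.
- have [c1 _ hc1] := EVT_max ler01 g_cont; have [c2 _ hc2] := EVT_min ler01 g_cont.
  exists (`|g c1| + `|g c2|) => t t01.
  have b1 := hc1 t ltac:(by rewrite in_itv); have b2 := hc2 t ltac:(by rewrite in_itv).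
  rewrite ler_norml; have := ler_norm (g c1); have := ler_norm (- g c2); rewrite normrN.
  by have := normr_ge0 (g c1); have := normr_ge0 (g c2); lra.
- move=> e e0; move/cvgrPdist_lt : h2 => /(_ _ e0); rewrite /at_right /within /= => /nbhsRP[d d0 hd].
  exists d => // t t0 td; rewrite -g0 distrC; apply: ltW; apply: hd => //.
  by rewrite subr0 gtr0_norm.
Qed.

Let raydiff (S : C -> C) (t : R) := Rex (S (t%:C * z)) - (1 + g t) / 2.

Lemma raydiff_facts c S : PS c S -> c 0%N = 1 -> [/\ forall t : R, 0 < t < 1 -> {for t, continuous (raydiff S)},
  exists B : R, forall t : R, 0 < t < 1 -> `|raydiff S t| <= B &
  forall e : R, 0 < e -> exists2 d : R, 0 < d & forall t : R, 0 < t -> t < d -> t < 1 -> `|raydiff S t| <= e].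
Proof.
move=> hS c0; have [h1 [B hB] h3] := cont01_facts; split.
- move=> t t01; apply: cvgB.
    apply: (ct_Re (F := fun t : R => S (t%:C * z))); apply: ct_ray hS _.
    have [t0 t1] := andP t01.
    by apply: le_lt_trans (Nray (ltW hz) (ltW t0)) t1.
  by apply: cvgM; [apply: cvgD; [exact: cvg_cst|exact: h1]|exact: cvg_cst].
- have [B' hB'] := ray_bounded hS hz; exists (B' + (1 + B) / 2) => t t01.
  have := hB t ltac:(lra); have := hB' t ltac:(lra).
  by rewrite /raydiff !ler_norml => /andP[? ?] /andP[? ?]; lra.
- move=> e e0; have e2 : 0 < e / 2 by lra.
  have [d1 d10 hd1] := h3 e e0; have [d2 d20 hd2] := ray_lim0 hS (ltW hz) e2.
  exists (Num.min d1 d2); first by rewrite lt_min d10.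
  move=> t t0; rewrite lt_min => /andP[td1 td2] t1.
  have := hd1 t t0 td1; have := hd2 t t0 td2; rewrite c0 /= /raydiff.
  by rewrite !ler_norml => /andP[? ?] /andP[? ?]; lra.
Qed.

Lemma kerx_kap (t : R) : 0 <= t <= 1 ->
  Rex ((1 - t%:C * z)^-1 + kap * (t%:C * z * ((1 - t%:C * z)^-1) ^+ 2)) - ((1 + t) ^+ 2)^-1 = kerx z kap t.
Proof.
move=> t01; rewrite /kerx /kerV; congr (Rex (_ + kap * _) - _).
by have := ker_den hz t01; rewrite /kerQ; move: (t%:C * z) => w w0; field.
Qed.

Lemma PS_s0 : PS (fun n => 1 + kap * n%:R) (fun w : C => (1 - w)^-1 + kap * (w * ((1 - w)^-1) ^+ 2)).
Proof. exact: PSD (@PS_geo R) (PSZ kap (@PS_koebe R)). Qed.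

Lemma lam_raydiff_integrable c S : PS c S -> c 0%N = 1 -> mu.-integrable `]0, 1[ (EFin \o (fun t => lam t * raydiff S t)).
Proof.
by move=> hS c0; have [h1 [B hB] _] := raydiff_facts hS c0; exact: integrable_bounded_mul lam_int h1 hB.
Qed.

(** One average, for [gamma = 0]: [weighted_primitive] with [l = lam], [L = La], [Y = raydiff S] and
    [x = kerx]. The equations of [S] and of [g] are both averages with the exponent [a], so
    [t^a raydiff S] differentiates to the difference of their kernels. *)
Lemma positivity_one S :
  (a <= 1 \/ 3 <= a) ->
  (forall s t : R, 0 < s -> s <= t -> t < 1 -> lam t * t `^ a / t ^+ 3 <= lam s * s `^ a / s ^+ 3) ->
  (forall t : R, 0 < t < 1 -> is_derive t (1 : R) (fun t => t `^ a * ((1 + g t) / 2)) (a * (t `^ a / t) * ((1 + t) ^+ 2)^-1)) ->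
  PS (avgc a (fun n => 1 + kap * n%:R)) S ->
  0 <= \int[mu]_(t in `]0, 1[) (lam t * raydiff S t).
Proof.
move=> ha mono dg hS.
have c0 : avgc a (fun n => 1 + kap * n%:R) 0 = 1 by rewrite /avgc mul0r addr0 invr1 mulr0 addr0 mulr1.
have [X1 [B XB] X0] := raydiff_facts hS c0.
have dX (t : R) : 0 < t < 1 -> is_derive t (1 : R) (fun t => t `^ a * raydiff S t) (a * (t `^ a / t) * kerx z kap t).
  move=> t01; have [t0 t1] := andP t01.
  have [F hF dF] := PS_avg a0 PS_s0.
  have tz : N (t%:C * z) < 1 by apply: le_lt_trans (Nray (ltW hz) (ltW t0)) t1.
  have e : (fun t => t `^ a * raydiff S t) = (fun t : R => t `^ a * Rex (S (t%:C * z)) - t `^ a * ((1 + g t) / 2)).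
    by apply/funext => s; rewrite /raydiff mulrBr.
  rewrite e -kerx_kap; last by rewrite !ltW.
  rewrite mulrBr; apply: rderB (dg t t01).
  apply: rder_near (dF t z t0 tz); exists (1 - t); first by lra.
  move=> y; rewrite ltr_norml => /andP[y1 y2]; congr (_ * Rex _); apply: (PS_fun_uniq hF hS).
  rewrite NM NR; have := N_ge0 z; have : `|y| < 1 by rewrite ltr_norml; lra.
  by have := hz; have := normr_ge0 y; nra.
have [E [E' [h1 h2 h3 h4]]] := weighted_primitive a0 ha lam_ge0 (fun t ht => ltW (La_gt0 ht)) La_der La_lim mono dX
  (@der_kerTh R z hz) (@kerTh_ge0 R z hz) (@kerTh_ineq R z kap hz hk) La_pow_le1 XB X0 (@kerTh_small R z hz).
apply: (int_ge0_of_primitive (lam_raydiff_integrable hS c0) _ h1 h2 h3 h4).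
by move=> t t01; apply: cvgM; [exact: lam_cont|exact: X1].
Qed.

Lemma pow_div_anti (b s t : R) : b <= 1 -> 0 < s -> s <= t -> t `^ b / t <= s `^ b / s.
Proof.
move=> b1 s0 st; have t0 : 0 < t by exact: lt_le_trans st.
have sub (u : R) : 0 < u -> u `^ b / u = (u `^ (1 - b))^-1.
  by move=> u0; rewrite -powRN -pow_m1//; congr (_ `^ _); ring.
rewrite !sub// lef_pV2 ?posrE ?powR_gt0//.
by apply: ge0_ler_powR; rewrite ?nnegrE ?subr_ge0 ?(ltW s0) ?(ltW t0).
Qed.

Lemma rmono_ge0 (f f' : R -> R) : (forall t : R, 0 < t < 1 -> is_derive t (1 : R) f (f' t)) ->
  (forall t : R, 0 < t < 1 -> 0 <= f' t) ->
  (forall e : R, 0 < e -> exists2 d : R, 0 < d & forall t : R, 0 < t -> t < d -> - e <= f t) ->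
  forall t : R, 0 < t < 1 -> 0 <= f t.
Proof.
move=> df f0 lim t /andP[t0 t1]; apply/ler_addgt0Pr => e /lim[d d0 hd].
pose s := Num.min t (d / 2).
have s0 : 0 < s by rewrite lt_min t0 divr_gt0.
have [st sd] : s <= t /\ s <= d / 2 by rewrite !ge_min !lexx orbT.
clearbody s.
by have := rmono df f0 s0 st t1; have := hd s s0 ltac:(lra); lra.
Qed.

(** * Two averages: the case of positive [gamma] *)

Section Iterated.
Variable m : R.
Hypotheses (m0 : 0 < m) (m1 : m <= 1) (a1 : a <= 1).
Let Pt (t : R) := \int[mu]_(s in `]t, 1[) (La s / s `^ (m - a + 1)).

(* [Pt] plays for [La t t^a / t] the role that [La] plays for [lam]. *)
Lemma Pt_eq (t : R) : 0 < t -> La t / t `^ (m - a + 1) = La t * t `^ a / t / t `^ m.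
Proof.
move=> t0; have T (b : R) : t `^ b != 0 by rewrite gt_eqF ?powR_gt0.
have tn : t != 0 by rewrite gt_eqF.
have e : t `^ (m - a + 1) * t `^ a = t `^ m * t.
  rewrite -powRD; last by rewrite tn implybT.
  rewrite -[X in _ * X](powRr1 (ltW t0)) -powRD; last by rewrite tn implybT.
  by congr (_ `^ _); ring.
apply: (mulIf (T (m - a + 1))); rewrite divfK//.
apply: (mulIf (mulf_neq0 (T m) tn)); rewrite -{1}e.
by move: (T m) (La t) => Tm L; field; rewrite Tm tn.
Qed.

Lemma Pt_integrable (c : R) : 0 < c -> mu.-integrable `]c, 1[ (EFin \o (fun s => La s / s `^ (m - a + 1))).
Proof.
move=> c0.
have sub (s : R) : c < s < 1 -> 0 < s < 1 by move=> /andP[cs ->]; rewrite (lt_trans c0).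
apply: (@bounded_integrable _ _ c 1 (c^-1 * (c `^ m)^-1)).
  move=> s /sub s01; have [s0 s1] := andP s01.
  have n0 : s `^ (m - a + 1) != 0 by rewrite gt_eqF ?powR_gt0.
  exact: (rder_cont (rderM (La_der s01) (rderV (f := fun s => s `^ (m - a + 1)) n0 (rder_pow _ s0)))).
move=> s cs; have s01 := sub s cs; have [s0 s1] := andP s01; have [cs0 _] := andP cs.
have L0 := La_gt0 s01; rewrite Pt_eq// ger0_norm; last by rewrite !divr_ge0 ?mulr_ge0 ?powR_ge0 ?(ltW s0) ?(ltW L0).
apply: ler_pM; rewrite ?divr_ge0 ?mulr_ge0 ?invr_ge0 ?powR_ge0 ?(ltW s0) ?(ltW L0)//.
  rewrite ler_pdivrMr//; apply: le_trans (_ : 1 <= _); first by rewrite mulrC La_pow_le1.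
  by rewrite mulrC ler_pdivlMr// mul1r ltW.
rewrite lef_pV2 ?posrE ?powR_gt0//.
by apply: ge0_ler_powR; rewrite ?nnegrE ?(ltW c0) ?(ltW s0) ?(ltW m0) ?(ltW cs0).
Qed.

Lemma Pt_der (t : R) : 0 < t < 1 -> is_derive t (1 : R) Pt (- (La t * t `^ a / t / t `^ m)).
Proof.
move=> t01; have [t0 t1] := andP t01; have h2 : 0 < t / 2 by lra.
rewrite -Pt_eq//; apply: (tail_der _ t1 (Pt_integrable h2)); first lra.
have n0 : t `^ (m - a + 1) != 0 by rewrite gt_eqF ?powR_gt0.
exact: (rder_cont (rderM (La_der t01) (rderV (f := fun s => s `^ (m - a + 1)) n0 (rder_pow _ t0)))).
Qed.

Lemma Pt_lim (e : R) : 0 < e -> exists2 d : R, 0 < d & forall t : R, 0 < t -> 1 - d < t < 1 -> Pt t <= e.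
Proof.
move=> e0; pose q : R := 1 / 2; have q0 : 0 < q by rewrite /q; lra.
have [d d0 hd] := tail_lim (ltac:(rewrite /q; lra) : q < 1) (Pt_integrable q0) e0.
exists (Num.min d q); first by rewrite lt_min d0.
move=> t t0 /andP[t1 t2]; have [h1 h2] : Num.min d q <= d /\ Num.min d q <= q by rewrite !ge_min !lexx orbT.
by apply: le_trans (ler_norm _) (hd t _ _); rewrite /q in h2 *; lra.
Qed.

Lemma Pt_ge0 (t : R) : 0 < t < 1 -> 0 <= Pt t.
Proof.
move=> /andP[t0 t1]; apply: Rintegral_ge0 => x; rewrite /= in_itv /= => /andP[x0 x1].
by rewrite divr_ge0 ?powR_ge0// ltW// La_gt0// x1 (lt_trans t0).
Qed.

(** Since [s^a La s <= 1], the integrand of [Pt] is at most [s^(-1-m)], whose tail integral is at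
    most [t^(-m) / m]. *)
Lemma Pt_pow_le (t : R) : 0 < t < 1 -> t `^ m * Pt t <= m^-1.
Proof.
move=> t01; have [t0 t1] := andP t01.
have dD (s : R) : 0 < s < 1 -> is_derive s (1 : R) (fun s => Pt s - m^-1 * (s `^ m)^-1)
    ((1 - s `^ a * La s) / (s * s `^ m)).
  move=> s01; have [s0 s1] := andP s01; have n0 : s `^ m != 0 by rewrite gt_eqF ?powR_gt0.
  apply: is_derive_eq (rderB (Pt_der s01) (rderZ m^-1 (rderV (f := fun s => s `^ m) n0 (rder_pow m s0)))) _.
  by field; rewrite n0 !gt_eqF.
have : Pt t - m^-1 * (t `^ m)^-1 <= 0.
  apply: (rmono_le0 ltr01 dD _ _ t01).
    move=> s s01; have [s0 s1] := andP s01.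
    by rewrite divr_ge0 ?subr_ge0 ?La_pow_le1// mulr_ge0 ?powR_ge0// ltW.
  move=> e e0; have [d d0 hd] := Pt_lim e0; exists d => // s s0 sd.
  have := hd s s0 sd; have : 0 <= m^-1 * (s `^ m)^-1 by rewrite mulr_ge0 ?invr_ge0 ?powR_ge0// ltW.
  lra.
by rewrite subr_le0 ler_pdivlMr ?powR_gt0// mulrC.
Qed.

(** Each of the nonnegative factors [La], [t^a / t], [t^m / t] and [t^(-2)] is nonincreasing, as [a]
    and [m] are at most 1. *)
Lemma Pt_mono (s t : R) : 0 < s -> s <= t -> t < 1 ->
  La t * t `^ a / t * t `^ m / t ^+ 3 <= La s * s `^ a / s * s `^ m / s ^+ 3.
Proof.
move=> s0 st t1; have t0 : 0 < t by exact: lt_le_trans st.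
have s1 : s < 1 by exact: le_lt_trans t1.
have L : La t <= La s.
  have dN (u : R) : 0 < u < 1 -> is_derive u (1 : R) (fun u => - La u) (lam u / u `^ a).
    by move=> u01; rewrite -[lam u / _]opprK; apply: rderN; exact: La_der.
  have N0 (u : R) : 0 < u < 1 -> 0 <= lam u / u `^ a by move=> u01; rewrite divr_ge0 ?powR_ge0 ?lam_ge0.
  by have := rmono dN N0 s0 st t1; rewrite lerN2.
have L0 : 0 <= La t by rewrite ltW// La_gt0// t0.
have e (u : R) : 0 < u -> La u * u `^ a / u * u `^ m / u ^+ 3 = La u * ((u `^ a / u) * ((u `^ m / u) * (u ^+ 2)^-1)).
  by move=> u0; field; rewrite gt_eqF.
have p (b u : R) : 0 < u -> 0 <= u `^ b / u by move=> u0; rewrite divr_ge0 ?powR_ge0// ltW.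
have i (u : R) : 0 <= (u ^+ 2)^-1 by rewrite invr_ge0 sqr_ge0.
have q : 0 <= t `^ m / t / t ^+ 2 by rewrite mulr_ge0// p.
rewrite !e//; apply: ler_pM => //; first by rewrite mulr_ge0// p.
apply: ler_pM => //; [exact: p|exact: pow_div_anti|].
apply: ler_pM => //; [exact: p|exact: pow_div_anti|].
rewrite lef_pV2 ?posrE ?exprn_gt0//; apply: lerXn2r; rewrite ?nnegrE ?(ltW s0) ?(ltW t0)//.
Qed.

(** Integration by parts against [La] replaces the outer average by the inner one: [t^a raydiff S]
    has derivative [a (t^a / t) Y], with [Y] the inner averages at [tz] and [-t] subtracted. What
    remains is [Y] with the weight [l = La t^a / t], to which [weighted_primitive] applies with
    exponent [m] and tail [Pt]; [E] combines the boundary term of the first step with the function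
    [E1] of the second. *)
Lemma positivity_two S :
  (forall t : R, 0 < t < 1 -> is_derive t (1 : R) (fun t => t `^ a * ((1 + g t) / 2))
     (a * (t `^ a / t) * (m * \int[mu]_(s in `]0, 1[) ((1 + s * t) ^- 2 * s `^ (m - 1))))) ->
  PS (avgc a (avgc m (fun n => 1 + kap * n%:R))) S ->
  0 <= \int[mu]_(t in `]0, 1[) (lam t * raydiff S t).
Proof.
move=> dg hS.
have c0 : avgc a (avgc m (fun n => 1 + kap * n%:R)) 0 = 1 by rewrite /avgc !mul0r addr0 invr1 mulr0 addr0 !mulr1.
have cV : avgc m (fun n => 1 + kap * n%:R) 0 = 1 by rewrite /avgc !mul0r addr0 invr1 mulr0 addr0 !mulr1.
have cZ : avgc m (fun n => 1 + n%:R) 0 = 1 by rewrite /avgc !mul0r addr0 invr1 addr0 !mulr1.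
have [X1 [B XB] X0] := raydiff_facts hS c0.
have [V hV dV] := PS_avg m0 PS_s0; have [Z hZ dZ] := PS_avg m0 PS_sq.
have [F hF dF] := PS_avg a0 hV.
pose zeta (t : R) := Rex (Z (t%:C * (-1))); pose Y (t : R) := Rex (V (t%:C * z)) - zeta t.
have Nz1 (t : R) : 0 < t < 1 -> N (t%:C * z) < 1.
  by move=> /andP[t0 t1]; apply: le_lt_trans (Nray (ltW hz) (ltW t0)) t1.
have N1' (t : R) : 0 < t < 1 -> N (t%:C * (-1)) < 1.
  by move=> /andP[t0 t1]; rewrite mulrN1 NN NR gtr0_norm.
have dzeta (t : R) : 0 < t < 1 ->
    is_derive t (1 : R) (fun t => t `^ m * zeta t) (m * (t `^ m / t) * ((1 + t) ^+ 2)^-1).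
  move=> t01; have [t0 t1] := andP t01; apply: is_derive_eq (dZ t (-1) t0 (N1' t t01)) _.
  have -> : 1 - t%:C * -1 = (1 + t)%:C by rewrite mulrN1 opprK rmorphD rmorph1.
  by rewrite -fmorphV -rmorphXn /= exprVn.
have N11 : N (-1 : R[i]) <= 1 by rewrite NN N1.
have zlim (e : R) : 0 < e -> exists2 d : R, 0 < d & forall t : R, 0 < t -> t < d -> `|zeta t - 1| <= e.
  move=> e0; have [d d0 hd] := ray_lim0 hZ N11 e0; exists d => // t t0 td.
  by have := hd t t0 td; rewrite cZ.
have tm (t : R) : 0 < t < 1 -> 0 < t `^ m <= 1 by move=> /andP[t0 t1]; rewrite powR_gt0// pow_le1// ltW.
(* [ray_bounded] does not reach [z = -1] on the unit circle, so [zeta] is confined to [[0, 1]] by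
   comparing [t^m zeta] with 0 and with [t^m] through their derivatives. *)
have zge0 (t : R) : 0 < t < 1 -> 0 <= zeta t.
  move=> t01; rewrite -(pmulr_rge0 _ (proj1 (andP (tm t t01)))); move: t t01.
  apply: (rmono_ge0 dzeta).
    move=> t /andP[t0 t1]; rewrite mulr_ge0 ?invr_ge0 ?sqr_ge0// mulr_ge0 ?(ltW m0)//.
    by rewrite divr_ge0 ?powR_ge0// ltW.
  move=> e e0; have [d d0 hd] := zlim 1 ltr01; exists d => // t t0 td.
  have : 0 <= zeta t by have := hd t t0 td; rewrite ler_norml => /andP[h _]; lra.
  by move=> h; apply: le_trans (_ : 0 <= _); [lra|rewrite mulr_ge0 ?powR_ge0].
have zle1 (t : R) : 0 < t < 1 -> zeta t <= 1.
  move=> t01; rewrite -subr_ge0 -(pmulr_rge0 _ (proj1 (andP (tm t t01)))); move: t t01.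
  have d1 (t : R) : 0 < t < 1 -> is_derive t (1 : R) (fun t => t `^ m * (1 - zeta t))
      (m * (t `^ m / t) * (1 - ((1 + t) ^+ 2)^-1)).
    move=> t01; have [t0 t1] := andP t01.
    have -> : (fun t => t `^ m * (1 - zeta t)) = (fun t => t `^ m - t `^ m * zeta t).
      by apply/funext => s; rewrite mulrBr mulr1.
    by apply: is_derive_eq (rderB (rder_pow m t0) (dzeta t t01)) _; rewrite mulrBr mulr1.
  apply: (rmono_ge0 d1).
    move=> t /andP[t0 t1]; rewrite mulr_ge0//; last by rewrite subr_ge0 invf_le1 ?exprn_gt0 ?exprn_ege1//; lra.
    by rewrite mulr_ge0 ?(ltW m0)// divr_ge0 ?powR_ge0// ltW.
  move=> e e0; have [d d0 hd] := zlim e e0; exists (Num.min d 1); first by rewrite lt_min d0 ltr01.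
  move=> t t0; rewrite lt_min => /andP[td t1].
  have := hd t t0 td; rewrite ler_norml => /andP[_ h].
  have /andP[p1 p2] := tm t (ltac:(by rewrite t0) : 0 < t < 1).
  have h' : 0 <= 1 - zeta t + e by lra.
  by have := mulr_ge0 (ltW p1) h'; move: (t `^ m) p1 p2 => T p1 p2; nra.
have zint (t : R) : 0 < t < 1 -> m * \int[mu]_(s in `]0, 1[) ((1 + s * t) ^- 2 * s `^ (m - 1)) = zeta t.
  by move=> t01; rewrite (zeta_eq m0 t01 hZ dZ) mulrC divfK ?gt_eqF.
have dX (t : R) : 0 < t < 1 -> is_derive t (1 : R) (fun t => t `^ a * raydiff S t) (a * (t `^ a / t) * Y t).
  move=> t01; have [t0 t1] := andP t01.
  have e : (fun t => t `^ a * raydiff S t) = (fun t : R => t `^ a * Rex (S (t%:C * z)) - t `^ a * ((1 + g t) / 2)).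
    by apply/funext => s; rewrite /raydiff mulrBr.
  rewrite e /Y -zint// mulrBr; apply: rderB (dg t t01).
  apply: rder_near (dF t z t0 (Nz1 t t01)); exists (1 - t); first by lra.
  move=> y; rewrite ltr_norml => /andP[y1 y2]; congr (_ * Rex _); apply: (PS_fun_uniq hF hS).
  rewrite NM NR; have := N_ge0 z; have := hz; have : `|y| < 1 by rewrite ltr_norml; lra.
  by have := normr_ge0 y; move: `|y| (N z) => u v ? ? ? ?; nra.
have dY (t : R) : 0 < t < 1 -> is_derive t (1 : R) (fun t => t `^ m * Y t) (m * (t `^ m / t) * kerx z kap t).
  move=> t01; have [t0 t1] := andP t01.
  have e : (fun t => t `^ m * Y t) = (fun t : R => t `^ m * Rex (V (t%:C * z)) - t `^ m * zeta t).
    by apply/funext => s; rewrite /Y mulrBr.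
  rewrite e -kerx_kap; last by rewrite !ltW.
  by rewrite mulrBr; apply: rderB (dzeta t t01); exact: (dV t z t0 (Nz1 t t01)).
have [BV hBV] := ray_bounded hV hz.
have YB (t : R) : 0 < t < 1 -> `|Y t| <= BV + 1.
  move=> t01; have := hBV t ltac:(lra); have := zge0 t t01; have := zle1 t t01.
  by rewrite /Y !ler_norml => ? ? /andP[? ?]; lra.
have Y0 (e : R) : 0 < e -> exists2 d : R, 0 < d & forall t : R, 0 < t -> t < d -> t < 1 -> `|Y t| <= e.
  move=> e0; have e2 : 0 < e / 2 by lra.
  have [d1 d10 hd1] := zlim _ e2; have [d2 d20 hd2] := ray_lim0 hV (ltW hz) e2.
  exists (Num.min d1 d2); first by rewrite lt_min d10.
  move=> t t0; rewrite lt_min => /andP[td1 td2] t1.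
  have := hd1 t t0 td1; have := hd2 t t0 td2; rewrite cV /= /Y.
  by rewrite !ler_norml => /andP[? ?] /andP[? ?]; lra.
pose l (t : R) := La t * t `^ a / t.
have l0 (t : R) : 0 < t < 1 -> 0 <= l t.
  by move=> t01; have [t0 t1] := andP t01; rewrite /l divr_ge0 ?(ltW t0)// mulr_ge0 ?powR_ge0// ltW// La_gt0.
have [E1 [E1' [h1 h2 h3 h4]]] := weighted_primitive m0 (or_introl m1) l0 Pt_ge0 Pt_der Pt_lim Pt_mono dY
  (@der_kerTh R z hz) (@kerTh_ge0 R z hz) (@kerTh_ineq R z kap hz hk) Pt_pow_le YB Y0 (@kerTh_small R z hz).
pose E (t : R) := - (La t * (t `^ a * raydiff S t)) + a * E1 t.
pose E' (t : R) := - (- (lam t / t `^ a) * (t `^ a * raydiff S t) + La t * (a * (t `^ a / t) * Y t)) + a * E1' t.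
have Lt1 (t : R) : 0 < t < 1 -> 0 <= La t * t `^ a <= 1.
  move=> t01; rewrite mulr_ge0 ?powR_ge0 ?(ltW (La_gt0 t01))//=.
  by rewrite mulrC; exact: La_pow_le1.
apply: (@int_ge0_of_primitive R _ E E' (lam_raydiff_integrable hS c0)).
- by move=> t t01; apply: cvgM; [exact: lam_cont|exact: X1].
- move=> t t01; apply: rderD; last by apply: rderZ; exact: h1.
  by apply: rderN; apply: rderM; [exact: La_der|exact: dX].
- move=> t t01; have [t0 t1] := andP t01; have := ler_wpM2l (ltW a0) (h2 t t01); rewrite /E' /l.
  have -> : - (lam t / t `^ a) * (t `^ a * raydiff S t) = - (lam t * raydiff S t) by field; rewrite gt_eqF ?powR_gt0.
  have -> : La t * (a * (t `^ a / t) * Y t) = a * (La t * t `^ a / t * Y t) by ring.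
  by lra.
- move=> e e0; have e2 : 0 < e / 2 by lra.
  have [d1 d10 hd1] := X0 _ e2; have [d2 d20 hd2] := h3 (e / 2 / a) ltac:(by rewrite !divr_gt0).
  exists (Num.min d1 d2); first by rewrite lt_min d10.
  move=> t t0; rewrite lt_min => /andP[td1 td2] t1.
  have b1 := hd1 t t0 td1 t1; have b2 := hd2 t t0 td2 t1.
  rewrite ler_pdivlMr// in b2.
  have /andP[p1 p2] := Lt1 t (ltac:(by rewrite t0) : 0 < t < 1).
  have : `|La t * (t `^ a * raydiff S t)| <= 1 * (e / 2).
    by rewrite (mulrA (La t)) normrM (ger0_norm p1); apply: ler_pM.
  by rewrite /E ler_norml => /andP[? ?]; rewrite mulrC in b2; lra.
- move=> e e0; have e2 : 0 < e / 2 by lra.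
  have B0 : 0 <= B by pose q : R := 1 / 2; apply: le_trans (XB q _); rewrite ?normr_ge0// /q; lra.
  have [d1 d10 hd1] := La_lim (ltac:(by rewrite divr_gt0//; lra) : 0 < e / 2 / (B + 1)).
  have [d2 d20 hd2] := h4 (e / 2 / a) ltac:(by rewrite !divr_gt0).
  exists (Num.min d1 d2); first by rewrite lt_min d10.
  move=> t t0 /andP[tm1 t1]; have t01 : 0 < t < 1 by rewrite t0.
  have [k1 k2] : Num.min d1 d2 <= d1 /\ Num.min d1 d2 <= d2 by rewrite !ge_min !lexx orbT.
  have b1 := hd1 t t0 ltac:(lra); have b2 := hd2 t t0 ltac:(lra).
  have b3 : - (e / 2) <= a * E1 t by rewrite (mulrC a) -ler_pdivrMr// mulNr.
  have L0 := La_gt0 t01.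
  have b4 : `|La t * (t `^ a * raydiff S t)| <= e / 2 / (B + 1) * (1 * B).
    rewrite !normrM (gtr0_norm L0) (ger0_norm (powR_ge0 _ _)); apply: ler_pM; rewrite ?mulr_ge0 ?powR_ge0 ?(ltW L0)//.
    apply: ler_pM; rewrite ?powR_ge0//; last exact: XB.
    by apply: pow_le1 => //; exact: ltW.
  have b5 : e / 2 / (B + 1) * (1 * B) <= e / 2.
    by rewrite mul1r mulrAC ler_pdivrMr ?ler_pM2l//; lra.
  by move: b4; rewrite /E ler_norml => /andP[? ?]; lra.
Qed.
End Iterated.
End Positivity.

(** * Hadamard products *)

Section WeightedIntegral.
Variable R : realType.
Local Notation C := (R[i]^o).
Local Notation mu := (@lebesgue_measure R).
Local Notation I2pi := (`[0, 2 * pi]%classic : set R).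
Implicit Types (c : nat -> R[i]) (f : C -> C).

Lemma PS_dil c f (z : R[i]) : N z <= 1 -> PS c f -> PS (fun j => c j * z ^+ j) (fun w => f (w * z)).
Proof.
move=> hz hf r r01; have r0 : 0 < r by case/andP: r01.
have [M M0 hM] := PSr_M (hf r r01) r0; exists M => n w wr.
have wz : N (w * z) <= N w by rewrite NM; have := N_ge0 w; have := N_ge0 z; nra.
have -> : \sum_(k < n) c k * z ^+ k * w ^+ k = \sum_(k < n) c k * (w * z) ^+ k.
  by apply: eq_bigr => k _; rewrite exprMn -mulrA [w ^+ k * _]mulrC.
apply: le_trans (hM n _ (le_trans wz wr)) _; apply: ler_wpM2l => //.
apply: lerXn2r; rewrite ?nnegrE ?divr_ge0 ?N_ge0 ?(ltW r0)//.
by rewrite ler_wpM2r ?invr_ge0 ?(ltW r0).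
Qed.

Lemma PS_monomial (a : R[i]) k : PS (fun n => if n == k then a else 0) (fun z : C => a * z ^+ k).
Proof.
elim: k => [|k IH].
  by apply: PS_id (@PS_cst R a) _ => z _; rewrite expr0 mulr1.
have := PS_mulz IH => h; have -> : (fun n => if n == k.+1 then a else 0) = (fun n => if n is n'.+1 then if n' == k then a else 0 else 0).
  by apply/funext => -[|n].
by apply: PS_id h _ => z _; rewrite exprS mulrCA.
Qed.

Section Weight.
Variables (D : set R) (e v : R -> C) (Mw : R).
Hypothesis mD : measurable (D : set (measurableTypeR R)).
Hypothesis we : forall (h : R -> C) (B : R), (forall t, D t -> ct h t) -> (forall t, D t -> N (h t) <= B) ->
  cintegrable D (fun t => e t * h t) /\ N (cintegral D (fun t => e t * h t)) <= Mw * B.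
Hypothesis cv : forall t, D t -> ct v t.
Hypothesis v1 : forall t, D t -> N (v t) <= 1.

(** Only partial sums are exchanged with the integral; the remainder of [f] at [z v(t)] integrates
    to a remainder of the same geometric form. One argument thus covers means over the circle and
    integrals against [lam]. *)
Lemma PS_wint c f : PS c f ->
  PS (fun j => cintegral D (fun t => e t * v t ^+ j) * c j) (fun z => cintegral D (fun t => e t * f (z * v t))).
Proof.
move=> hf r r01; have [r0 r1] := andP r01.
have [M M0 hM] := PSr_M (hf r r01) r0.
have Nzv (z : R[i]) t : D t -> N (z * v t) <= N z.
  by move=> /v1 h; rewrite NM; have := N_ge0 z; have := N_ge0 (v t); nra.
have cf (z : R[i]) t : N z <= r -> D t -> ct (fun t => f (z * v t)) t.
  move=> zr Dt; have [|l hl] := @PS_derivable R c f (z * v t) hf.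
    by apply: le_lt_trans r1; apply: le_trans zr; exact: Nzv.
  by apply: (ct_cder _ hl); apply: ctM; [exact: ct_cst|exact: cv].
have Mw0 (h : R -> C) (B : R) : (forall t, D t -> ct h t) -> (forall t, D t -> N (h t) <= B) ->
    N (cintegral D (fun t => e t * h t)) <= Mw * B by move=> h1 h2; case: (we h1 h2).
exists (Mw * M) => n z zr.
have vj j : cintegrable D (fun t => e t * v t ^+ j).
  have h1 t : D t -> ct (fun t => v t ^+ j) t by move=> Dt; apply: ctX; exact: cv.
  have h2 t : D t -> N (v t ^+ j) <= 1 by move=> Dt; rewrite NX exprn_ile1 ?N_ge0 ?v1.
  by case: (we h1 h2).
have [Is1 Is2] := cint_sum n mD (fun j => cintegrableZ (c j * z ^+ j) mD (vj j)).
have [If _] : cintegrable D (fun t => e t * f (z * v t)) /\ N (cintegral D (fun t => e t * f (z * v t))) <= Mw * (M + 0).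
  apply: we => t Dt; first exact: cf.
  have := hM 0%N (z * v t) (le_trans (Nzv z t Dt) zr).
  by rewrite big_ord0 subr0 expr0 mulr1 addr0.
have -> : \sum_(k < n) cintegral D (fun t => e t * v t ^+ k) * c k * z ^+ k =
   cintegral D (fun t => \sum_(k < n) c k * z ^+ k * (e t * v t ^+ k)).
  by rewrite Is2; apply: eq_bigr => k _; rewrite cintZ//; move: (cintegral _ _) => J; ring.
rewrite -(cintB mD If Is1).
have -> : (fun t => e t * f (z * v t) - \sum_(k < n) c k * z ^+ k * (e t * v t ^+ k)) =
   (fun t => e t * (f (z * v t) - \sum_(k < n) c k * (z * v t) ^+ k)).
  apply/funext => t; rewrite mulrBr; congr (_ - _); rewrite mulr_sumr; apply: eq_bigr => k _.
  by rewrite exprMn; ring.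
rewrite -mulrA; apply: Mw0 => t Dt.
  apply: ctB; first exact: cf.
  elim: n {Is1 Is2} => [|n IH].
    have -> : (fun t => \sum_(k < 0) c k * (z * v t) ^+ k) = fun=> 0 :> C by apply/funext => s; rewrite big_ord0.
    exact: ct_cst.
  have -> : (fun t => \sum_(k < n.+1) c k * (z * v t) ^+ k) = fun t => (\sum_(k < n) c k * (z * v t) ^+ k) + c n * (z * v t) ^+ n :> C.
    by apply/funext => s; rewrite big_ord_recr.
  apply: ctD; [exact: IH|apply: ctM; first exact: ct_cst].
  by apply: ctX; apply: ctM; [exact: ct_cst|exact: cv].
apply: le_trans (hM n _ (le_trans (Nzv z t Dt) zr)) _; apply: ler_wpM2l => //.
apply: lerXn2r; rewrite ?nnegrE ?divr_ge0 ?N_ge0 ?(ltW r0)//.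
by rewrite ler_wpM2r ?invr_ge0 ?(ltW r0) ?Nzv.
Qed.
End Weight.

Lemma PS_circ (e v : R -> C) c f : (forall t, ct e t) -> (forall t, ct v t) -> (forall t, N (v t) = 1) -> PS c f ->
  PS (fun j => cintegral I2pi (fun t => e t * v t ^+ j) * c j) (fun z => cintegral I2pi (fun t => e t * f (z * v t))).
Proof.
move=> ce cv v1; have pi0 := pi_ge0 R; have pi2 : 0 <= 2 * pi :> R by lra.
have [M M0 hM] := ct_bounded pi2 (fun t _ => ce t).
have m1 : measurable (I2pi : set (measurableTypeR R)) by [].
apply: (@PS_wint I2pi e v (2 * M * (2 * pi)) m1) => [h B ch hB|t _|t _]; [|exact: cv|by rewrite v1].
have I t : 0 <= t <= 2 * pi -> I2pi t by rewrite /= in_itv.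
have ceh t : 0 <= t <= 2 * pi -> ct (fun t => e t * h t) t by move=> ht; apply: ctM => //; exact/ch/I.
split; first exact: ct_cintegrable.
have -> : 2 * M * (2 * pi) * B = 2 * (M * B) * (2 * pi - 0) by ring.
apply: cint_norm => // t ht; rewrite NM; apply: ler_pM; rewrite ?N_ge0 ?hM//.
exact/hB/I.
Qed.

Section Lam.
Variable lam : R -> R.
Hypothesis lam_ge0 : forall t : R, 0 < t < 1 -> 0 <= lam t.
Hypothesis lam_int : mu.-integrable `]0, 1[ (EFin \o lam).
Hypothesis lam1 : \int[mu]_(t in `]0, 1[) lam t = 1.

Lemma lam_avg (h : R -> R) (B : R) : (forall t, 0 < t < 1 -> {for t, continuous h}) ->
  (forall t, 0 < t < 1 -> `|h t| <= B) ->
  mu.-integrable `]0, 1[ (EFin \o (fun t => lam t * h t)) /\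
  `|\int[mu]_(t in `]0, 1[) (lam t * h t)| <= B.
Proof.
move=> ch hB; have ih := integrable_bounded_mul lam_int ch hB; split => //.
have mm : measurable (`]0, 1[%classic : set (measurableTypeR R)) by [].
apply: le_trans (le_normr_Rintegral mm ih) _.
apply: (@le_trans _ _ (\int[mu]_(t in `]0, 1[) (lam t * B))); last by rewrite RintegralZr// lam1 mul1r.
apply: le_Rintegral => //.
- exact: (integrable_norm ih).
- by have := integrableZr mm B lam_int; congr (mu.-integrable _ _); apply/funext => t.
- move=> t; rewrite /= in_itv /= => ht; rewrite normrM (ger0_norm (lam_ge0 ht)).
  by apply: ler_wpM2l; [exact: lam_ge0|exact: hB].
Qed.

Lemma PS_lam c f : PS c f ->
  PS (fun j => (\int[mu]_(t in `]0, 1[) (lam t * t ^+ j))%:C * c j)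
     (fun z => cintegral `]0, 1[ (fun t => (lam t)%:C * f (t%:C * z))).
Proof.
move=> hf.
have mm : measurable (`]0, 1[%classic : set (measurableTypeR R)) by [].
have := @PS_wint `]0, 1[%classic (fun t => (lam t)%:C) (fun t => t%:C) 2 mm.
move=> /(_ _ _ _ c f hf) h.
have {}h : PS (fun j => cintegral `]0, 1[ (fun t => (lam t)%:C * (t%:C : C) ^+ j) * c j) (fun z => cintegral `]0, 1[ (fun t => (lam t)%:C * f (z * t%:C))).
  apply: h.
  - move=> h B ch hB.
    have ch' t : 0 < t < 1 -> ct h t by move=> ht; apply: ch; rewrite /= in_itv.
    have hB' t : 0 < t < 1 -> N (h t) <= B by move=> ht; apply: hB; rewrite /= in_itv.
    have [i1 b1] := lam_avg (fun t ht => ct_Re (ch' t ht)) (fun t ht => le_trans (NRe _) (hB' t ht)).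
    have [i2 b2] := lam_avg (fun t ht => ct_Im (ch' t ht)) (fun t ht => le_trans (NIm _) (hB' t ht)).
    have e1 : (fun t => Rex ((lam t)%:C * h t)) = (fun t => lam t * Rex (h t)) by apply/funext => t; rewrite cReRM.
    have e2 : (fun t => Imx ((lam t)%:C * h t)) = (fun t => lam t * Imx (h t)) by apply/funext => t; rewrite cImRM.
    split; first by split; [rewrite (funext (fun t => congr1 EFin (cReRM (lam t) (h t))))|rewrite (funext (fun t => congr1 EFin (cImRM (lam t) (h t))))].
    apply: le_trans (Nle _) _; rewrite /cintegral [complex.Re _]/= [complex.Im _]/= e1 e2.
    lra.
  - by move=> t _; apply: ct_RC; exact: cvg_id.
  - by move=> t; rewrite /= in_itv /= => /andP[t0 t1]; rewrite NR gtr0_norm// ltW.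
have e1 : (fun j => (\int[mu]_(t in `]0, 1[) (lam t * t ^+ j))%:C * c j) = (fun j => cintegral `]0, 1[ (fun t => (lam t)%:C * (t%:C : C) ^+ j) * c j).
  apply/funext => j; congr (_ * _); apply: Ceq; rewrite /cintegral /=.
    by apply: eq_Rintegral => t _; rewrite -rmorphXn -rmorphM.
  rewrite (_ : (fun t => _) = fun=> 0) ?Rintegral_cst ?mul0r//.
  by apply/funext => t; rewrite -rmorphXn -rmorphM.
have e2 : (fun z => cintegral `]0, 1[ (fun t => (lam t)%:C * f (t%:C * z))) = (fun z => cintegral `]0, 1[ (fun t => (lam t)%:C * f (z * t%:C))).
  by apply/funext => z; congr cintegral; apply/funext => t; rewrite mulrC [t%:C * _]mulrC mulrC.
by rewrite e1 e2.
Qed.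
End Lam.
End WeightedIntegral.

Section Hadamard.
Variable R : realType.
Local Notation C := (R[i]^o).
Local Notation mu := (@lebesgue_measure R).
Local Notation I2pi := (`[0, 2 * pi]%classic : set R).
Implicit Types (c : nat -> R[i]) (f : C -> C).

Lemma cint_conj D (F : R -> C) : measurable (D : set (measurableTypeR R)) -> cintegrable D F ->
  cintegral D (fun t => conjc (F t) : C) = conjc (cintegral D F).
Proof.
move=> mD [_ i2]; have k : mu.-integrable D (EFin \o (fun t => Imx (F t))) by [].
apply: Ceq => /=.
  by apply: eq_Rintegral => t _; case: (F t).
rewrite -[RHS]mulN1r -RintegralZl//; apply: eq_Rintegral => t _.
by rewrite mulN1r; case: (F t).
Qed.

Lemma conj_cis (t : R) : conjc (cis t) = cis (- t) :> C.
Proof. by apply: Ceq; rewrite ?Re_cis ?Im_cis ?cosN ?sinN /= ?mulN0r ?expR0 ?mul1r. Qed.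

Lemma conjcM (z w : R[i]) : conjc (z * w) = conjc z * conjc w.
Proof. by case: z w => a b [c d]; apply: Ceq => /=; ring. Qed.
Lemma conjcX (z : R[i]) n : conjc (z ^+ n) = conjc z ^+ n.
Proof. by elim: n => [|n IH]; rewrite ?exprS ?conjcM ?IH// !expr0; apply: Ceq; rewrite /= ?oppr0. Qed.

Lemma ct_cisopp (t : R) : ct (fun t => cis (- t)) t.
Proof.
have h : {for t, continuous (fun t : R => - t)} by apply: cvgN; exact: cvg_id.
exact: (cvg_comp _ _ h (@ct_cis R (- t))).
Qed.

(** As a function of [z] the mean is again a power series, and orthogonality of the powers of [cis]
    leaves only its coefficient of index [k]. *)
Lemma coef_extract c f (z : R[i]) k : PS c f -> N z < 1 ->
  cintegral I2pi (fun t => cis t ^+ k * f (z * cis (- t))) = (2 * pi)%:C * (c k * z ^+ k).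
Proof.
move=> hf hz.
have h := PS_circ (fun t => ctX (n := k) (@ct_cis R t)) ct_cisopp (fun t => N_cis (- t)) hf.
have h2 := PS_monomial ((2 * pi)%:C * c k) k.
suff h3 : PS (fun j => if j == k then (2 * pi)%:C * c k else 0)
    (fun z => cintegral I2pi (fun t => cis t ^+ k * f (z * cis (- t)))).
  by rewrite (PS_fun_uniq h3 h2 hz) mulrA.
move: h; congr PS; apply/funext => j.
have e : (fun t => cis t ^+ k * cis (- t) ^+ j : C) = fun t => if (j <= k)%N then cis t ^+ (k - j) else cis t ^- (j - k).
  apply/funext => t; have c0 : cis t != 0 by exact: cexp_neq0.
  rewrite cisN exprVn; case: leqP => jk.
    by rewrite -{1}(subnK jk) exprD mulfK// expf_neq0.
  by rewrite -{1}(subnK (ltnW jk)) exprD invfM mulrCA mulfV ?expf_neq0// mulr1.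
rewrite e; case: (ltngtP j k) => jk.
- by rewrite cint_cisP subn_eq0 leqNgt jk mul0r.
- by rewrite cint_cisN subn_eq0 leqNgt jk mul0r.
- by rewrite cint_cisP jk subnn.
Qed.

Lemma coef_extractN c f (z : R[i]) k : PS c f -> N z < 1 ->
  cintegral I2pi (fun t => cis t ^- k * f (z * cis (- t))) = if k == 0%N then (2 * pi)%:C * c 0%N else 0.
Proof.
move=> hf hz.
have ce (t : R) : ct (fun t => cis t ^- k) t by apply: ctV; [rewrite expf_neq0 ?cexp_neq0|apply: ctX; exact: ct_cis].
have h := PS_circ ce ct_cisopp (fun t => N_cis (- t)) hf.
have h2 := @PS_cst R (if k == 0%N then (2 * pi)%:C * c 0%N else 0).
suff h3 : PS (fun j => if j == 0%N then (if k == 0%N then (2 * pi)%:C * c 0%N else 0) else 0)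
    (fun z => cintegral I2pi (fun t => cis t ^- k * f (z * cis (- t)))).
  exact: (PS_fun_uniq h3 h2 hz).
move: h; congr PS; apply/funext => j.
have e : (fun t => cis t ^- k * cis (- t) ^+ j : C) = fun t => cis t ^- (k + j).
  by apply/funext => t; rewrite cisN exprVn exprD invfM.
rewrite e cint_cisN addn_eq0; case: (altP (k =P 0%N)) => _; case: (altP (j =P 0%N)) => [->|_] //=; by rewrite mul0r.
Qed.

(* With [z = rho z'], [A W z] is the mean over [theta] of
   [A (U (rho e^(i theta)) - beta) (2 Re G (z' e^(-i theta)) - 1 + b)]. *)
Lemma hadamard_neq0 (A : R[i]) (b beta : R) (u Gs : nat -> R[i]) (U G W : C -> C) :
  PS u U -> PS Gs G -> PS (fun n => Gs n * u n) W -> u 0%N = 1 -> Gs 0%N = 1 ->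
  0 < 1 + b -> beta * (1 + b) = b ->
  (forall w, N w < 1 -> 0 < Rex (A * (U w - beta%:C))) ->
  (forall w, N w < 1 -> (1 - b) / 2 <= Rex (G w)) ->
  forall z, N z < 1 -> W z != 0.
Proof.
move=> hU hG hW u0 G0 b0 hb Upos Gge z hz.
have pi0 := pi_gt0 R; have pi2 : 0 <= 2 * pi :> R by lra.
have m1 : measurable (I2pi : set (measurableTypeR R)) by [].
(* Splitting [z] as [rho z'] keeps the arguments of [U] and of [G] on circles strictly inside the
   disc, where both are continuous. *)
pose rho := (1 + N z) / 2; have nz := N_ge0 z.
have r01 : 0 < rho < 1 by rewrite /rho; lra.
have zr : N z < rho by rewrite /rho; lra.
clearbody rho; have [r0 r1] := andP r01.
have rC : (rho%:C : R[i]) != 0 by rewrite -N_eq0 NR normr_eq0 gt_eqF.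
pose z' := z / rho%:C; have zz' : rho%:C * z' = z by rewrite /z' mulrC divfK.
have z'1 : N z' < 1 by rewrite /z' NM NV NR gtr0_norm// ltr_pdivrMr// mul1r.
clearbody z'.
have Nv (t : R) : N (z' * cis (- t)) < 1 by rewrite NM N_cis mulr1.
have cG (t : R) : ct (fun t => G (z' * cis (- t))) t.
  have [l hl] := PS_derivable hG (Nv t).
  by apply: (ct_cder _ hl); apply: ctM; [exact: ct_cst|exact: ct_cisopp].
pose e (t : R) : R := 2 * Rex (G (z' * cis (- t))) - 1 + b.
have e0 t : 0 <= e t by rewrite /e; have := Gge _ (Nv t); lra.
have ce (t : R) : {for t, continuous e}.
  apply: cvgD; last exact: cvg_cst.
  apply: cvgB; last exact: cvg_cst.
  by apply: cvgM; [exact: cvg_cst|exact: (ct_Re (cG t))].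
have ceC (t : R) : ct (fun t => (e t)%:C) t by exact: ct_RC.
have I (F : R -> C) : (forall t, ct F t) -> cintegrable I2pi F by move=> h; exact: ct_cintegrable.
(* Fourier coefficients of the weight [e = G + conj G + (b - 1)]: for [j > 0] only [G] contributes;
   for [j = 0] the three terms give [1 + 1 + (b - 1) = 1 + b]. *)
have E j : cintegral I2pi (fun t => (e t)%:C * cis t ^+ j) =
    if j == 0%N then (2 * pi * (1 + b))%:C else (2 * pi)%:C * (Gs j * z' ^+ j).
  have cj (t : R) : ct (fun t => cis t ^+ j) t by apply: ctX; exact: ct_cis.
  have cjN (t : R) : ct (fun t => cis t ^- j) t by apply: ctV; [rewrite expf_neq0 ?cexp_neq0|exact: cj].
  have c1 (t : R) : ct (fun t => cis t ^+ j * G (z' * cis (- t))) t by apply: ctM; [exact: cj|exact: cG].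
  have c2 (t : R) : ct (fun t => cis t ^- j * G (z' * cis (- t))) t by apply: ctM; [exact: cjN|exact: cG].
  have c3 (t : R) : ct (fun t => conjc (cis t ^- j * G (z' * cis (- t))) : C) t.
    apply: ct_ReIm.
      by have := ct_Re (c2 t); congr continuous_at; apply/funext => s; case: (_ * _).
    have h := ct_Im (ctN (c2 t)); move: h; congr continuous_at; apply/funext => s; by case: (_ * _).
  have c4 (t : R) : ct (fun t => (b - 1)%:C * cis t ^+ j) t by apply: ctM; [exact: ct_cst|exact: cj].
  have -> : (fun t => (e t)%:C * cis t ^+ j) = fun t => (cis t ^+ j * G (z' * cis (- t)) +
      conjc (cis t ^- j * G (z' * cis (- t)))) + (b - 1)%:C * cis t ^+ j :> C.
    apply/funext => t; have -> : conjc (cis t ^- j * G (z' * cis (- t))) = cis t ^+ j * conjc (G (z' * cis (- t))).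
      by rewrite conjcM -exprVn conjcX -cisN conj_cis opprK.
    have -> : (e t)%:C = G (z' * cis (- t)) + conjc (G (z' * cis (- t))) + (b - 1)%:C.
      by rewrite /e; apply: Ceq; case: (G _) => x y /=; ring.
    by move: (cis t ^+ j) (G _) (conjc _) => x1 x2 x3; ring.
  rewrite (cintD m1 (I _ (fun t => ctD (c1 t) (c3 t))) (I _ c4)).
  rewrite (cintD m1 (I _ c1) (I _ c3)) (cint_conj m1 (I _ c2)) (cintZ _ m1 (I _ cj)).
  rewrite (coef_extract _ hG z'1) (coef_extractN _ hG z'1) cint_cisP.
  case: eqP => [->|_]; last by rewrite conjc0 mulr0 !addr0.
  by rewrite G0 expr0 !mulr1; apply: Ceq; rewrite /=; ring.
have hU' : PS (fun n => A * u n + (if n == 0%N then - (A * beta%:C) else 0)) (fun w => A * (U w - beta%:C)).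
  by apply: PS_id (PSD (PSZ A hU) (@PS_cst R (- (A * beta%:C)))) _ => w _; rewrite mulrBr.
have h1 := PS_circ ceC (@ct_cis R) (@N_cis R) hU'.
have h2 := PSZ ((2 * pi)%:C * A) (PS_dil (ltW z'1) hW).
have rC1 : N (rho%:C : R[i]) < 1 by rewrite NR gtr0_norm.
have key : cintegral I2pi (fun t => (e t)%:C * (A * (U (rho%:C * cis t) - beta%:C))) = (2 * pi)%:C * A * W z.
  rewrite -zz'; apply: esym; apply: (PS_fun_uniq (f := fun w => (2 * pi)%:C * A * W (w * z')) _ h1 rC1).
  move: h2; congr PS; apply/funext => j.
  apply: esym; rewrite E; case: eqP => [->|_]; last by rewrite addr0; ring.
  (* The constant terms match because [(1 + b)(1 - beta) = 1]: the mean weight [1 + b] compensates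
     the shift of [U] by [beta]. *)
  have bb : (1 + b) * (1 - beta) = 1 by rewrite mulrBr mulr1 [_ * beta]mulrC hb addrK.
  have hC : (1 + b)%:C * (1 - beta%:C) = 1 :> R[i].
    by rewrite -[1 - _](rmorphB (real_complex R) 1) -rmorphM /= bb.
  by rewrite G0 u0 expr0 !mulr1 -[RHS]mulr1 -hC rmorphM /=; ring.
apply/eqP => W0; rewrite W0 mulr0 in key.
pose p (t : R) := Rex (A * (U (rho%:C * cis t) - beta%:C)).
have Nr t : N (rho%:C * cis t) < 1 by rewrite NM N_cis NR mulr1 gtr0_norm.
have cU (t : R) : ct (fun t => A * (U (rho%:C * cis t) - beta%:C)) t.
  have [l hl] := PS_derivable hU (Nr t).
  apply: ctM; first exact: ct_cst.
  apply: ctB; last exact: ct_cst.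
  by apply: (ct_cder _ hl); apply: ctM; [exact: ct_cst|exact: ct_cis].
have cp (t : R) : {for t, continuous p} by exact: (ct_Re (cU t)).
(* The minimum of [p] on the circle is positive, so the integral of [e p] is at least
   [p t0 * 2 pi (1 + b) > 0], whereas [W z = 0] makes it 0. *)
have [t0 _ ht0] : exists2 t0, t0 \in `[0, 2 * pi]%R & forall t, t \in `[0, 2 * pi]%R -> p t0 <= p t.
  by apply: EVT_min => //; apply: continuous_in_subspaceT => t _; exact: cp.
have p0 : 0 < p t0 by exact: Upos.
have i1 : mu.-integrable I2pi (EFin \o (fun t => e t * p t)).
  by apply: cont_integrable => t _; apply: cvgM; [exact: ce|exact: cp].
have i2 : mu.-integrable I2pi (EFin \o (fun t => e t * p t0)).
  by apply: cont_integrable => t _; apply: cvgM; [exact: ce|exact: cvg_cst].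
have i3 : mu.-integrable I2pi (EFin \o e) by apply: cont_integrable => t _; exact: ce.
have le : \int[mu]_(t in I2pi) (e t * p t0) <= \int[mu]_(t in I2pi) (e t * p t).
  apply: le_Rintegral => // t; rewrite /= in_itv /= => ht; apply: ler_wpM2l => //.
  by apply: ht0; rewrite in_itv.
have v1 : \int[mu]_(t in I2pi) (e t * p t) = 0.
  have := congr1 (fun w => Rex w) key; rewrite /cintegral /=; apply: etrans.
  by apply: eq_Rintegral => t _; rewrite cReRM.
have v2 : \int[mu]_(t in I2pi) e t = 2 * pi * (1 + b).
  have := congr1 (fun w => Rex w) (E 0%N); rewrite /cintegral /=; apply: etrans.
  by apply: eq_Rintegral => t _; rewrite mulr1 mulr0 subr0.
move: le; rewrite v1 RintegralZr// v2 leNgt => /negP; apply.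
by rewrite !mulr_gt0.
Qed.
End Hadamard.

(** * Starlikeness *)

Section Starlike.
Variable R : realType.
Local Notation C := (R[i]^o).
Local Notation mu := (@lebesgue_measure R).
Implicit Types (c : nat -> R[i]) (f : C -> C).

(* If [1 + z K1/K = i tau], then [kap = 1/(1 - i tau)] makes [K + kap z K1] vanish. *)
Lemma Re_logder_gt0 (K K1 : C -> C) : (forall z, N z < 1 -> cder K z (K1 z)) ->
  (forall z, N z < 1 -> exists l, cder K1 z l) ->
  (forall kap : R[i], N (2 * kap - 1) = 1 -> forall z, N z < 1 -> K z + kap * (z * K1 z) != 0) ->
  forall z, N z < 1 -> K z != 0 /\ 0 < Rex (1 + z * K1 z / K z).
Proof.
move=> dK dK1 hK.
(* [kap = 0] lies on the circle [|2 kap - 1| = 1]. *)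
have K0 z : N z < 1 -> K z != 0.
  move=> hz; have h : N (2 * (0 : R[i]) - 1) = 1 by rewrite mulr0 sub0r NN N1.
  by have := hK 0 h z hz; rewrite mul0r addr0.
move=> z hz; split; first exact: K0.
pose q (w : C) := w * K1 w / K w.
pose r (t : R) := Rex (1 + q (t%:C * z)).
have Nt (t : R) : 0 <= t <= 1 -> N (t%:C * z) < 1.
  by move=> /andP[t0 t1]; rewrite NM NR ger0_norm//; have := N_ge0 z; nra.
have cr (t : R) : 0 <= t <= 1 -> {for t, continuous r}.
  move=> /Nt tz; apply: (ct_Re (F := fun t : R => 1 + q (t%:C * z))).
  have [l hl] := dK1 _ tz.
  have dq := cderM (cderM (cder_id (t%:C * z)) hl) (cderV (K0 _ tz) (dK _ tz)).
  apply: ctD; first exact: ct_cst.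
  apply: (ct_cder (f := q) _ dq); apply: ctM; last exact: ct_cst.
  by apply: ct_RC; exact: cvg_id.
rewrite ltNge; apply/negP => rz.
have r1 : r 1 <= 0 by rewrite /r rmorph1 mul1r.
have r0 : r 0 = 1 by rewrite /r /q rmorph0 !mul0r addr0.
(* The real part starts at 1 at the centre and is nonpositive at [z], so it vanishes somewhere on
   the segment between them. *)
have [t] : exists2 t, t \in `[0, 1]%R & r t = 0.
  apply: IVT => //.
    by apply: continuous_in_subspaceT => t; rewrite inE /= in_itv /=; exact: cr.
  by rewrite r0 ge_min r1 orbT le_max ler01.
rewrite in_itv /= => t01; rewrite /r; set w := t%:C * z => e0.
have hw : N w < 1 by exact: Nt.
pose y : R[i] := 1 + q w; have Ry : Rex y = 0 by [].
have qy : q w = y - 1 by rewrite /y addrAC subrr add0r.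
clearbody y; have d0 : 1 - y != 0.
  apply/eqP => /(congr1 (fun u => Rex u)); rewrite cReD cReN Ry subr0 /= => /eqP.
  by rewrite oner_eq0.
have hk : N (2 * (1 - y)^-1 - 1) = 1.
  have -> : 2 * (1 - y)^-1 - 1 = (1 + y) / (1 - y) by field.
  rewrite NM NV; have -> : N (1 + y) = N (1 - y).
    apply/eqP; rewrite -(@eqrXn2 _ 2)// ?N_ge0// !Nsqr !cReD !cImD !cReN !cImN Ry /=.
    by apply/eqP; ring.
  by rewrite mulfV// N_eq0.
have := hK _ hk w hw; rewrite (_ : w * K1 w = q w * K w); last by rewrite /q divfK ?K0.
rewrite qy mulrA (_ : (1 - y)^-1 * (y - 1) = -1); last by field.
by rewrite mulN1r subrr eqxx.
Qed.

Lemma starlike_mulz (xi : R) (F E E1 : C -> C) :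
  (forall z, N z < 1 -> F z = z * E z) -> (forall z, N z < 1 -> cder E z (E1 z)) -> E 0 = 1 ->
  (forall z, N z < 1 -> E z != 0 /\ xi < Rex (1 + z * E1 z / E z)) ->
  starlike xi F.
Proof.
move=> FE dE E0 hE.
have dF z : N z < 1 -> cder F z (E z + z * E1 z).
  move=> hz; have h := cder_eq (cderM (cder_id z) (dE z hz)) (erefl _).
  rewrite mul1r in h; apply: cder_near h; exists (1 - N z); first by rewrite subr_gt0.
  by move=> w hw; rewrite FE//; have := ND (w - z) z; rewrite subrK; lra.
have N01 : N (0 : R[i]) < 1 by rewrite N0.
split; first split.
- by apply: cder_an => z hz; exists (E z + z * E1 z); exact: dF.
- by rewrite FE// mul0r.
- by rewrite (cder_derive1 (dF 0 N01)) E0 mul0r addr0.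
move=> z /discE hz z0; have [Ez0 hx] := hE z hz; rewrite FE// mulf_neq0//; split => //.
rewrite (cder_derive1 (dF z hz)).
by have -> : z * (E z + z * E1 z) / (z * E z) = 1 + z * E1 z / E z by field; rewrite Ez0 z0.
Qed.

(** With [E = Kf^(1/delta)], [z E'/E] is [1/delta] times [z K1/Kf], whose real part exceeds -1: this
    is where the order [1 - 1/delta] comes from. Conversely [(F/z)^delta] is [Kf], by uniqueness of
    branches. *)
Lemma starlike_power (delta : R) (Kf K1 F : C -> C) : 0 < delta ->
  (forall z, N z < 1 -> cder Kf z (K1 z)) -> Kf 0 = 1 ->
  (forall z, N z < 1 -> Kf z != 0 /\ 0 < Rex (1 + z * K1 z / Kf z)) ->
  (forall z, F z = z * bpow delta^-1 Kf z) ->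
  starlike (1 - delta^-1) F /\ starlike 0 (fun z => z * bpow delta (fdivz F) z).
Proof.
move=> d0 dK K0 hK hF.
have [L [L0 dL KL]] := log_exists dK (fun z hz => proj1 (hK z hz)) K0.
have di : 0 < delta^-1 by rewrite invr_gt0.
have dd : (delta%:C * (delta^-1)%:C : R[i]) = 1 by rewrite -rmorphM /= mulfV ?gt_eqF.
pose E (z : C) : C := cexp ((delta^-1)%:C * L z).
have dLd z : N z < 1 -> cder (fun z => (delta^-1)%:C * L z) z ((delta^-1)%:C * (K1 z / Kf z)).
  by move=> hz; exact: cderZ (dL z hz).
have dE z : N z < 1 -> cder E z (E z * ((delta^-1)%:C * (K1 z / Kf z))).
  by move=> hz; exact: cder_comp (dLd z hz) (cder_cexp _).
have E0 : E 0 = 1 by rewrite /E L0 mulr0 cexp0.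
have anL : analytic_on (disc 1) L by apply: cder_an => z hz; eexists; exact: dL.
have anLd : analytic_on (disc 1) (fun z => (delta^-1)%:C * L z : C).
  by apply: cder_an => z hz; eexists; exact: dLd.
have bE : is_bpow delta^-1 Kf E.
  split; first by apply: cder_an => z hz; eexists; exact: dE.
  by exists 1, L; split => // z /discE hz _; split; [exact: KL|].
have FE z : N z < 1 -> F z = z * E z by move=> hz; rewrite hF (bpowE bE).
have sF : starlike (1 - delta^-1) F.
  apply: (starlike_mulz FE dE E0) => z hz; split; first exact: cexp_neq0.
  have [_ h] := hK z hz.
  have -> : z * (E z * ((delta^-1)%:C * (K1 z / Kf z))) / E z = (delta^-1)%:C * (z * K1 z / Kf z).
    have := cexp_neq0 ((delta^-1)%:C * L z); rewrite -/(E z) => Ez.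
    by move: (E z) (K1 z) (_%:C) Ez (Kf z)^-1 => e k d Ez kv; field.
  move: h; rewrite !cReD cReRM; set x := Rex (z * _ / _) => h.
  rewrite [Rex 1]/= in h *.
  have := mulr_gt0 di h; rewrite mulrDr mulr1; lra.
split; first exact: sF.
have fE z : N z < 1 -> fdivz F z = E z.
  move=> hz; rewrite /fdivz; case: eqP => [->|/eqP z0]; last by rewrite FE// mulrC mulKf.
  by have [[_ _ ->] _] := sF; rewrite E0.
have bK : is_bpow delta (fdivz F) Kf.
  split; first by apply: cder_an => z hz; eexists; exact: dK.
  exists 1, (fun z => (delta^-1)%:C * L z); split; [exact: ltr01|exact: anLd|by rewrite L0 mulr0|].
  move=> z /discE hz _; split; first by rewrite fE.
  by rewrite mulrA dd mul1r KL.
apply: (starlike_mulz _ dK K0 hK) => z hz.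
by rewrite (bpowE bK).
Qed.

End Starlike.

(** * From the positive dual functional to starlikeness *)

Section Main.
Variable R : realType.
Local Notation C := (R[i]^o).
Local Notation lm := (@lebesgue_measure R).

(** Positivity of the dual functional is kept as a hypothesis on every [kap], [z] and [S], so that
    the cases of one and of two averages share the rest of the argument. *)
Lemma Vop_starlike (alpha gamma mu nu delta beta : R) (lam g : R -> R) (f : C -> C) :
  0 <= mu -> 0 <= nu -> mu * nu = gamma -> mu + nu = alpha - gamma -> 0 < delta ->
  (forall t : R, 0 < t < 1 -> 0 <= lam t) ->
  lm.-integrable `]0, 1[ (EFin \o lam) ->
  (\int[lm]_(t in `]0, 1[) lam t = 1) ->
  (forall t : R, 0 < t < 1 -> {for t, continuous g}) ->
  (exists B : R, forall t : R, 0 <= t <= 1 -> `|g t| <= B) ->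
  beta < 1 ->
  beta / (1 - beta) = - (\int[lm]_(t in `]0, 1[) (lam t * g t)) ->
  (forall (kap z : R[i]) (S : C -> C), N (2 * kap - 1) = 1 -> N z < 1 ->
    PS (fun n => (((1 + mu * n%:R / delta) * (1 + nu * n%:R / delta))^-1)%:C * (1 + kap * n%:R)) S ->
    0 <= \int[lm]_(t in `]0, 1[) (lam t * (Rex (S (t%:C * z)) - (1 + g t) / 2))) ->
  classW beta delta alpha gamma f ->
  starlike (1 - delta^-1) (Vop lam delta f) /\
  starlike 0 (fun z : C => z * bpow delta (fdivz (Vop lam delta f)) z).
Proof.
move=> mu0 nu0 hmn hmnD d0 lam0 ilam lam1 cg [B hB] beta1 hbeta Spos hW.
have [c [hn [H [phi [hP hH c0 hhn Hpos]]]]] := H_coeffs d0 hmn hmnD hW.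
pose h (n : nat) : R := (1 + mu * n%:R / delta) * (1 + nu * n%:R / delta).
have h1 n : 1 <= h n.
  by apply: mulr_ege1; rewrite lerDl divr_ge0 ?mulr_ge0 ?(ltW d0).
have h0 n : 0 < h n by apply: lt_le_trans (h1 n).
have hC n : ((h n)^-1)%:C * (h n)%:C = 1 :> R[i] by rewrite -rmorphM /= mulVf ?gt_eqF.
pose l (j : nat) : R := \int[lm]_(t in `]0, 1[) (lam t * t ^+ j).
have l00 : l 0%N = 1 by rewrite -lam1; apply: eq_Rintegral => t _; rewrite expr0 mulr1.
have hK := PS_lam lam0 ilam lam1 hP.
set K := (fun z => cintegral _ _) in hK.
have [K1 dK hK1] := PS_Dz hK.
have N01 : N (0 : R[i]) < 1 by rewrite N0.
have K0 : K 0 = 1.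
  have q2 : 0 < (1 / 2 : R) < 1 by lra.
  have [q0 _] := andP q2; have := PSr_at0 q0 (hK _ q2).
  by rewrite c0 mulr1 -/(l 0%N) l00.
have dK1 z : N z < 1 -> exists l, cder K1 z l.
  have [K2 hK2 dK2] := PS_der hK.
  move=> hz; have [l2 hl2] := PS_derivable hK2 hz; exists l2.
  apply: cder_near hl2; exists (1 - N z); first by rewrite subr_gt0.
  move=> w hw; have w1 : N w < 1 by have := ND (w - z) z; rewrite subrK; lra.
  exact: cder_uniq (dK2 w w1) (dK w w1).
pose b := beta / (1 - beta).
have b1 : 0 < 1 + b.
  have e : 1 + b = (1 - beta)^-1 by rewrite /b; field; lra.
  by rewrite e invr_gt0; lra.
have bb : beta * (1 + b) = b by rewrite /b; field; lra.
have K0W kap : N (2 * kap - 1) = 1 -> forall z, N z < 1 -> K z + kap * (z * K1 z) != 0.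
  move=> hk.
  have [S hS] : exists S, PS (fun n => ((h n)^-1)%:C * (1 + kap * n%:R)) S.
    apply: PS_of_cgrow; apply: (@cgrow_mul R _ 1); last exact: PS_cgrow (PS_s0 kap).
    move=> n; rewrite NR mul1r normfV ger0_norm ?(ltW (h0 n))//.
    by apply: (@le_trans _ _ 1); [rewrite invf_le1|rewrite ler1n].
  have hG := PS_lam lam0 ilam lam1 hS.
  set G := (fun z => cintegral _ _) in hG.
  have S0 : ((h 0%N)^-1)%:C * (1 + kap * 0%:R) = 1 by rewrite /h !(mulr0, mul0r, addr0, mulr1) invr1.
  (* The factorization behind the Hadamard product: [l_n (1 + kap n) c_n] is [l_n (1 + kap n) / h_n]
     times [h_n c_n], that is, a coefficient of [G] times one of [H]. *)
  have hW2 : PS (fun n => ((l n)%:C * (((h n)^-1)%:C * (1 + kap * n%:R))) * hn n) (fun z => K z + kap * (z * K1 z)).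
    have := PSD hK (PSZ kap hK1); congr PS; apply/funext => n.
    rewrite hhn -/(h n) -/(l n) -[LHS]mul1r -[X in X * _ = _](hC n).
    by move: (l n)%:C (h n)%:C (_^-1)%:C => x1 x2 x3; ring.
  apply: (hadamard_neq0 (A := cexp (phi *i)) (b := b) (beta := beta) hH hG hW2 _ _ b1 bb Hpos).
  - by rewrite hhn c0 -/(h 0%N) /h !(mulr0, mul0r, addr0) !mulr1.
  - by rewrite -/(l 0%N) l00 S0 mulr1.
  (* As [lam] has integral 1 and [lam g] has integral [- b], the integral of [lam (1 + g)/2] is the
     threshold [(1 - b)/2]. *)
  move=> w hw; have := Spos kap w S hk hw hS.
  have cS (t : R) : 0 < t < 1 -> {for t, continuous (fun t : R => Rex (S (t%:C * w)))}.
    move=> /andP[t0 t1]; apply: (ct_Re (F := fun t : R => S (t%:C * w))); apply: (ct_ray hS).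
    by apply: le_lt_trans (Nray (ltW hw) (ltW t0)) t1.
  have [BS hBS] := ray_bounded hS hw.
  have hBS' (t : R) : 0 < t < 1 -> `|Rex (S (t%:C * w))| <= BS by move=> /andP[? ?]; apply: hBS; rewrite !ltW.
  have hB' (t : R) : 0 < t < 1 -> `|g t| <= B by move=> /andP[? ?]; apply: hB; rewrite !ltW.
  have i1 := integrable_bounded_mul ilam cS hBS'.
  have i2 := integrable_bounded_mul ilam cg hB'.
  have mm : measurable (`]0, 1[%classic : set (measurableTypeR R)) by [].
  have i3 : lm.-integrable `]0, 1[ (EFin \o (fun t => lam t + lam t * g t)).
    by have := integrableD mm ilam i2; congr (lm.-integrable _ _); apply/funext.
  have i4 : lm.-integrable `]0, 1[ (EFin \o (fun t => 2^-1 * (lam t + lam t * g t))).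
    by have := integrableZl mm (2^-1) i3; congr (lm.-integrable _ _); apply/funext.
  have -> : \int[lm]_(t in `]0, 1[) (lam t * (Rex (S (t%:C * w)) - (1 + g t) / 2)) =
     \int[lm]_(t in `]0, 1[) (lam t * Rex (S (t%:C * w)) - 2^-1 * (lam t + lam t * g t)).
    by apply: eq_Rintegral => t _; field.
  rewrite RintegralB// RintegralZl// RintegralD// lam1.
  rewrite -[\int[lm]_(t in _) (lam t * g t)]opprK -hbeta -/b.
  have -> : Rex (G w) = \int[lm]_(t in `]0, 1[) (lam t * Rex (S (t%:C * w))).
    by apply: eq_Rintegral => t _; rewrite cReRM.
  lra.
apply: (starlike_power d0 dK K0 (Re_logder_gt0 dK dK1 K0W)) => z.
by [].
Qed.

End Main.

(** * The growth condition on [lam] as monotonicity of a weight *)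

Section MonotoneWeight.
Variable R : realType.

(** The logarithmic derivative of [lam t^a / t^3], times [t], is [t lam'/lam + a - 3]. *)
Lemma weight_mono (lam : R -> R) (a : R) :
  (forall t : R, 0 < t < 1 -> 0 < lam t) ->
  (forall t : R, 0 < t < 1 -> derivable lam t 1) ->
  (forall t : R, 0 < t < 1 -> t * derive1 lam t / lam t <= 3 - a) ->
  forall s t : R, 0 < s -> s <= t -> t < 1 -> lam t * t `^ a / t ^+ 3 <= lam s * s `^ a / s ^+ 3.
Proof.
move=> lam0 dlam hlam s t s0 st t1.
pose F (u : R) := - (lam u * u `^ a * (u ^+ 3)^-1).
pose F' (u : R) := (u `^ a / u ^+ 4) * ((3 - a) * lam u - u * derive1 lam u).
have dF (u : R) : 0 < u < 1 -> is_derive u (1 : R) F (F' u).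
  move=> u01; have [u0 u1] := andP u01; have un : u != 0 by rewrite gt_eqF.
  have u3 : u ^+ 3 != 0 by rewrite expf_neq0.
  have dl : is_derive u (1 : R) lam (derive1 lam u).
    by split; [exact: dlam|by rewrite derive1E].
  have dp := rderV (f := fun u => u ^+ 3) u3 (rderX 3 (rder_id u)).
  apply: is_derive_eq (rderN (rderM (rderM dl (rder_pow a u0)) dp)) _.
  by rewrite /F' /=; move: (u `^ a) (lam u) (derive1 lam u) => T l l'; field.
have F0 (u : R) : 0 < u < 1 -> 0 <= F' u.
  move=> u01; have [u0 u1] := andP u01.
  apply: mulr_ge0; first by rewrite divr_ge0 ?powR_ge0 ?exprn_ge0 ?(ltW u0).
  by rewrite subr_ge0 -ler_pdivrMr ?lam0// hlam.
by have := rmono dF F0 s0 st t1; rewrite /F lerN2.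
Qed.
End MonotoneWeight.

Local Close Scope complex_scope.
Theorem theorem3p2 (R : realType) (alpha gamma mu nu delta beta : R)
    (lam g : R -> R)
    (halpha : 0 <= alpha) (hgamma : 0 <= gamma)
    (hmu : 0 <= mu) (hnu : 0 <= nu)
    (hmunu : mu * nu = gamma) (hmunuD : mu + nu = alpha - gamma)
    (hgamma0 : gamma = 0 -> mu = 0 /\ nu = alpha)
    (hdelta : 1 <= delta)
    (hlam_ge0 : forall t : R, 0 < t < 1 -> 0 <= lam t)
    (hlam_int : (@lebesgue_measure R).-integrable `]0, 1[ (EFin \o lam))
    (hlam1 : \int[@lebesgue_measure R]_(t in `]0, 1[) lam t = 1)
    (hlam_diff : forall t : R, 0 < t < 1 -> derivable lam t 1)
    (hlam_neq0 : forall t : R, 0 < t < 1 -> lam t != 0)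
    (hg : is_g gamma delta mu nu g)
    (hbeta1 : beta < 1)
    (hbeta : beta / (1 - beta) =
             - \int[@lebesgue_measure R]_(t in `]0, 1[) (lam t * g t))
    (hLambda_gt0 : forall t : R, 0 < t < 1 -> 0 < Lambda lam delta nu t)
    (hLambda_int : (@lebesgue_measure R).-integrable `[0, 1]
                     (EFin \o Lambda lam delta nu))
    (hPi_gt0 : forall t : R, 0 < t < 1 -> 0 < Pi lam gamma delta mu nu t)
    (hPi_int : (@lebesgue_measure R).-integrable `[0, 1]
                 (EFin \o Pi lam gamma delta mu nu))
    (hcond :
      [/\ 0 < gamma, 1 <= delta <= Num.min mu nu &
          forall t : R, 0 < t < 1 ->
            t * derive1 lam t / lam t <= 5 - delta / mu - delta / nu]
      \/
      [/\ gamma = 0, 0 < alpha <= delta / 3 \/ delta <= alpha &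
          forall t : R, 0 < t < 1 ->
            t * derive1 lam t / lam t <= 3 - delta / alpha])
    (f : R[i] -> R[i]) (hf : classW beta delta alpha gamma f) :
  starlike (1 - delta^-1) (Vop lam delta f) /\
  starlike 0 (fun z : R[i] => z * bpow delta (fdivz (Vop lam delta f)) z).

Proof.
have d0 : 0 < delta by lra.
have lam0 t : 0 < t < 1 -> 0 < lam t by move=> t01; rewrite lt_neqAle eq_sym hlam_neq0 ?hlam_ge0.
have clam (t : R) : 0 < t < 1 -> {for t, continuous lam}.
  by move=> t01; apply: differentiable_continuous; exact/derivable1_diffP/hlam_diff.
have [g0 cg dg] := hg.
have [g1 g2 _] := cont01_facts g0 cg.
apply: (Vop_starlike hmu hnu hmunu hmunuD d0 hlam_ge0 hlam_int hlam1 g1 g2 hbeta1 hbeta _ hf) => kap z S hk hz hS.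
case: hcond => [[gam0 /andP[_]]|[gam0 hal hlam]].
- rewrite le_min => /andP[dmu dnu] _.
  have mu0 : 0 < mu by lra.
  have nu0 : 0 < nu by lra.
  have a0 : 0 < delta / nu by rewrite divr_gt0.
  have m0 : 0 < delta / mu by rewrite divr_gt0.
  have a1 : delta / nu <= 1 by rewrite ler_pdivrMr// mul1r.
  have m1 : delta / mu <= 1 by rewrite ler_pdivrMr// mul1r.
  apply: (positivity_two a0 hlam_ge0 hlam_int hlam1 clam hLambda_gt0 hz hk g0 cg m0 m1 a1).
    (* The constant [delta^2 / (mu nu)] is the product of the two exponents [delta/nu] and
       [delta/mu], one for each average. *)
    move=> t t01; have [t0 _] := andP t01; apply: is_derive_eq (dg t t01) _.
    rewrite gt_eqF//; move: (Rintegral _ _ _) => J; rewrite pow_m1//.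
    by field; rewrite !gt_eqF.
  move: hS; congr PS; apply/funext => n; rewrite /avgc mulrA -rmorphM -invfM; congr (_^-1%:C * _)%C.
  by field; rewrite !gt_eqF.
- have [mu0 nua] := hgamma0 gam0; subst nu.
  have al0 : 0 < alpha by case: hal => [/andP[]|] //; lra.
  have a0 : 0 < delta / alpha by rewrite divr_gt0.
  (* [alpha >= delta] gives the first alternative and [alpha <= delta/3] the second; both make
     [(3 - m)(1 - m)] nonnegative for [m = delta/alpha]. *)
  have ha : delta / alpha <= 1 \/ 3 <= delta / alpha.
    case: hal => [/andP[_ h]|h]; [right|left]; last by rewrite ler_pdivrMr// mul1r.
    by rewrite ler_pdivlMr//; lra.
  apply: (positivity_one a0 hlam_ge0 hlam_int hlam1 clam hLambda_gt0 hz hk g0 cg ha).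
  + exact: weight_mono lam0 hlam_diff hlam.
  + move=> t t01; have [t0 _] := andP t01; apply: is_derive_eq (dg t t01) _.
    rewrite gam0 eqxx pow_m1//; have t1 : 1 + t != 0 by rewrite gt_eqF//; lra.
    by field; rewrite t1 !gt_eqF.
  + move: hS; congr PS; apply/funext => n; rewrite /avgc mu0 !mul0r addr0 mul1r.
    by congr (_^-1%:C * _)%C; field; rewrite !gt_eqF.
Qed.
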